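(* Let $f:\mathbb{C}\to\mathbb{C}$ be a homeomorphism of finite distortion with $f(0)=0$ and $f(1)=1$, and assume that $\mathbb{K}(\cdot,f)\in L^1_{loc}(\mathbb{C})$. Suppose moreover that for some $\alpha\ge1$ there are constants $C>0$ and $\delta>0$ such that $$|f(x)-f(y)|\geq C|x-y|^{\alpha}\qquad\text{for all } x,y\in\mathbb{C}\text{ with }|x-y|<\delta.$$ Then $$\limsup_{|z|\to0}\ \frac{|z|}{\sqrt{\log\left(\frac{1}{|z|}\right)}}\,|\arg(f(z))|=0.$$
   Context: A homeomorphism of finite distortion is an orientation-preserving homeomorphism $f:\mathbb{C}\to\mathbb{C}$ in $W^{1,1}_{loc}(\mathbb{C};\mathbb{C})$ whose differential $Df$ vanishes almost everywhere on the zero set of the Jacobian determinant $J(\cdot,f)$ and for which there is a measurable, almost everywhere finite function $\mathbb{K}(\cdot,f)\ge 1$ with $|Df(z)|^2\le \mathbb{K}(z,f)\,J(z,f)$ for a.e. $z$, where $|Df(z)|$ is the operator norm. The distortion function $\mathbb{K}(\cdot,f)$ is the smallest such function: $\mathbb{K}(z,f)=|Df(z)|^2/J(z,f)$ where $J(z,f)>0$, and $\mathbb{K}(z,f)=1$ otherwise. Convention for the argument: for a homeomorphism $f$ of $\mathbb{C}$ with $f(0)=0$, $f(1)=1$, the quantity $\arg(f(z))$ is not reduced modulo $2\pi$; it records the winding of $f$ around the origin along radial segments. Precisely, $\arg(f(re^{i\theta}))=A(r,\theta)$, where $A:(0,\infty)\times[0,2\pi)\to\mathbb{R}$ is the unique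 continuous function with $f(re^{i\theta})=|f(re^{i\theta})|e^{iA(r,\theta)}$ and $A(1,0)=0$. *)

(* Defs.v *)
From HB Require Import structures.
From mathcomp Require Import all_boot all_order all_algebra.
From mathcomp Require Import all_classical all_reals all_analysis.
From mathcomp Require Import measurable_realfun.

Set Implicit Arguments.
Unset Strict Implicit.
Unset Printing Implicit Defensive.

Import Order.TTheory GRing.Theory Num.Theory.
Import numFieldNormedType.Exports.

Local Open Scope classical_set_scope.
Local Open Scope ring_scope.

(* The complex plane is identified with R * R, which carries the product
   topology and the product measure; x + iy is the pair (x, y). *)

Section Plane.
Variable R : realType.
Implicit Types (z h : R * R) (f : R * R -> R * R) (u g phi : R * R -> R).
Implicit Types (M : 'M[R]_2) (Df : R * R -> 'M[R]_2).

(* The library norm of R * R is the sup norm, hence this modulus. *)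
Definition cabs z : R := Num.sqrt (z.1 ^+ 2 + z.2 ^+ 2).

Definition polar (r theta : R) : R * R := (r * cos theta, r * sin theta).

Definition area := (@lebesgue_measure R \x @lebesgue_measure R)%E.

Definition homeomorphism f : Prop :=
  continuous f /\
  exists g : R * R -> R * R, [/\ continuous g, cancel f g & cancel g f].

(* The image under f of every positively oriented circle winds exactly once,
   counterclockwise, around the image of the centre: A is a continuous
   determination of arg (f (z + r e^{it}) - f z). *)
Definition orientation_preserving f : Prop :=
  forall z (r : R), 0 < r ->
  exists A : R -> R,
    [/\ {within `[0, 2 * pi], continuous A},
        forall t, t \in `[0, 2 * pi] ->
          f (z + polar r t) - f z
          = polar (cabs (f (z + polar r t) - f z)) (A t)
      & A (2 * pi) = A 0 + 2 * pi].

Definition loc_integrable u : Prop :=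
  measurable_fun setT u /\
  forall K : set (R * R), compact K ->
    (\int[area]_(z in K) (`|u z|)%:E < +oo)%E.

Definition dirx : R * R := (1, 0).
Definition diry : R * R := (0, 1).

Fixpoint of_class (k : nat) phi : Prop :=
  match k with
  | 0%N => continuous phi
  | k'.+1 =>
      [/\ continuous phi,
          forall z, derivable phi z dirx /\ derivable phi z diry,
          of_class k' (fun z => 'D_dirx phi z)
        & of_class k' (fun z => 'D_diry phi z)]
  end.

Definition test_function phi : Prop :=
  (forall k, of_class k phi) /\ compact (closure [set z | phi z != 0]).

Definition weak_partial (e : R * R) u g : Prop :=
  forall phi, test_function phi ->
    \int[area]_z (u z * 'D_e phi z) = - \int[area]_z (g z * phi z).

(* f is in W^{1,1}_loc with weak differential Df; the rows of Df are the
   components of f, the columns the directions of differentiation.  Df is a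
   Borel representative: it is determined by f up to a null set, which does
   not affect any condition below. *)
Definition W11loc f Df : Prop :=
  [/\ loc_integrable (fun z => (f z).1) /\ loc_integrable (fun z => (f z).2),
      forall i j : 'I_2, loc_integrable (fun z => Df z i j),
      weak_partial dirx (fun z => (f z).1) (fun z => Df z 0 0)
        /\ weak_partial diry (fun z => (f z).1) (fun z => Df z 0 1)
    & weak_partial dirx (fun z => (f z).2) (fun z => Df z 1 0)
        /\ weak_partial diry (fun z => (f z).2) (fun z => Df z 1 1)].

Definition mxact M h : R * R :=
  (M 0 0 * h.1 + M 0 1 * h.2, M 1 0 * h.1 + M 1 1 * h.2).

Definition opnorm M : R := sup [set cabs (mxact M h) | h in [set h | cabs h <= 1]].

Definition homeo_finite_distortion f Df : Prop :=
  [/\ homeomorphism f,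
      orientation_preserving f,
      W11loc f Df,
      {ae area, forall z, \det (Df z) = 0 -> Df z = 0}
    & exists K : R * R -> \bar R,
        [/\ measurable_fun setT K,
            forall z, (1 <= K z)%E,
            {ae area, forall z, (K z < +oo)%E}
          & {ae area, forall z,
              ((opnorm (Df z) ^+ 2)%:E <= K z * (\det (Df z))%:E)%E}]].

Definition distortion Df z : R :=
  if 0 < \det (Df z) then opnorm (Df z) ^+ 2 / \det (Df z) else 1.

(* argf z is the unreduced argument of f z: in the coordinates (r, theta) of
   z = r e^{i theta}, 0 <= theta < 2 pi, it is the continuous branch that
   vanishes at z = 1.  These conditions determine argf away from 0, and argf
   may jump across the positive real axis. *)
Definition arg_branch f (argf : R * R -> R) : Prop :=
  [/\ {within `]0, +oo[%classic `*` `[0, 2 * pi[%classic,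
        continuous (fun p : R * R => argf (polar p.1 p.2))},
      forall r theta, 0 < r -> 0 <= theta < 2 * pi ->
        f (polar r theta)
        = polar (cabs (f (polar r theta))) (argf (polar r theta))
    & argf (1, 0) = 0].

End Plane.

(* Main.v *)
Require Import Defs.
From mathcomp Require Import all_boot all_order all_algebra.
From mathcomp Require Import all_classical all_reals all_analysis.
From mathcomp Require Import measurable_realfun.
From mathcomp Require Import ring lra.
Import Order.TTheory GRing.Theory Num.Theory.
Import numFieldNormedType.Exports.
Set Implicit Arguments.
Unset Strict Implicit.
Unset Printing Implicit Defensive.
Local Open Scope classical_set_scope.
Local Open Scope ring_scope.

(* Let s be the sup norm of z0. The rectangle of points within s/2 of a segment
   that joins z0 to a point q at distance about 1 avoids a ray from 0 to
   infinity. The preimage of the circle |w| = |f z0| meets that ray, hence leaves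
   the rectangle: arg f changes by at most 2 pi between z0 and some point of the
   boundary of the rectangle, and likewise for q.
   Choosing by Fubini sides on which f is absolutely continuous, the variation
   of arg f along the boundary is at most a multiple of the integral of
   |Df|/|f| over a strip divided by s. Since |Df|^2 <= K J, this integral is
   at most l * int K + (1/l) * int J/|f|^2. The area inequality
   int_A J <= 32 |f(A)|, summed over dyadic annuli, and the lower bound on |f|
   give int J/|f|^2 = O(log (1/s)), while int K over the strip tends to 0; take l
   of the order of sqrt (log (1/s)).
   The area inequality is a covering argument: on a square where Df is close in
   mean to a constant matrix G, f is close to an affine map on a frame, so that
   the image of the square covers a parallelogram. *)

(** * Plane measure and grids *)

(** The weak derivative is controlled on almost every line parallel to an axis but on no prescribed
    line, and the segment that ends at z0 is prescribed: hence the detour to the sides of a frame,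
    which may be chosen. The segment is vertical rather than radial for the same reason. The change
    of variables formula is not at hand, since a homeomorphism in W^{1,1} may send a null set to a
    set of positive area; a single inequality suffices, and its constant is irrelevant. On the
    strip, which keeps at distance s/2 from 0, |f| is at least a multiple of s^alpha, so alpha
    enters only through the number of dyadic annuli. The little o comes from the area of the strip,
    at most 2s, and the absolute continuity of the integral of K: if int K <= eps^2, then l = sqrt
    (log (1/s)) / eps bounds both terms by a multiple of eps sqrt (log (1/s)). The far end of the
    segment lies in a fixed compact set away from 0, where arg f is bounded. *)

Section TwoDim.
Context {R : realType}.
Notation leb := (@lebesgue_measure R).
Notation area := (@area R).

Lemma fubini_area_x (F : R * R -> \bar R) : (forall z, (0 <= F z)%E) ->
  measurable_fun setT F ->
  (\int[area]_z F z = \int[leb]_x \int[leb]_y F (x, y))%E.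
Proof. by move=> F0 mF; rewrite /area fubini_tonelli1. Qed.

Lemma fubini_area_y (F : R * R -> \bar R) : (forall z, (0 <= F z)%E) ->
  measurable_fun setT F ->
  (\int[area]_z F z = \int[leb]_y \int[leb]_x F (x, y))%E.
Proof. by move=> F0 mF; rewrite /area fubini_tonelli2. Qed.

Lemma measurable_plane_swap : measurable_fun setT (fun z : R * R => (z.2, z.1)).
Proof. by apply: measurable_fun_pair. Qed.

(** The exchange of coordinates preserves area; with it, what is proved for lines in one direction
    passes to the other. *)
Lemma ge0_integral_swap (F : R * R -> \bar R) : (forall z, (0 <= F z)%E) ->
  measurable_fun setT F ->
  (\int[area]_z F (z.2, z.1) = \int[area]_z F z)%E.
Proof.
move=> F0 mF; rewrite fubini_area_x//; last exact: (measurableT_comp mF measurable_plane_swap).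
by rewrite fubini_area_y.
Qed.

Lemma integral_swap (F : R * R -> \bar R) : measurable_fun setT F ->
  (\int[area]_z F (z.2, z.1) = \int[area]_z F z)%E.
Proof.
move=> mF; rewrite integralE [in RHS]integralE; congr (_ - _)%E.
  transitivity (\int[area]_z (F^\+)%E (z.2, z.1))%E.
    by apply: eq_integral => -[a b] _; rewrite ?funeposE.
  by apply: ge0_integral_swap => //; exact: measurable_funepos.
transitivity (\int[area]_z (F^\-)%E (z.2, z.1))%E.
  by apply: eq_integral => -[a b] _; rewrite ?funenegE.
by apply: ge0_integral_swap => //; exact: measurable_funeneg.
Qed.

Definition box (N : R) : set (R * R) := `[- N, N]%classic `*` `[- N, N]%classic.

Lemma measurable_box N : measurable (box N).
Proof. exact: measurableX. Qed.

Lemma compact_box N : compact (box N).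
Proof. by apply: compact_setX; exact: segment_compact. Qed.

Lemma loc_integrable_box (u : R * R -> R) N : loc_integrable u ->
  area.-integrable (box N) (EFin \o u).
Proof.
move=> [mu iu]; apply/integrableP; split.
  by apply/measurable_EFinP; exact: measurable_funTS.
exact: (iu _ (@compact_box N)).
Qed.

Lemma box_norm N (z : R * R) : box N z <-> `|z| <= N.
Proof.
case: z => x y; rewrite prod_normE/= ge_max /box /= !in_itv/= -!ler_norml.
by split => [[-> ->]//|/andP[]].
Qed.

Lemma compact_sub_box (K : set (R * R)) : compact K -> exists N, K `<=` box N.
Proof.
move=> /compact_bounded[M [_ HM]]; exists (M + 1) => z Kz.
by apply/box_norm; apply: HM Kz; rewrite ltrDl.
Qed.

(* squares of side 1 / (k + 1) *)
Definition cell k (p : int * int) : set (R * R) :=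
  [set z | Num.floor (k.+1%:R * z.1) = p.1 /\ Num.floor (k.+1%:R * z.2) = p.2].

Lemma cellE k p : cell k p =
  `[p.1%:~R / k.+1%:R, (p.1 + 1)%:~R / k.+1%:R[%classic `*`
  `[p.2%:~R / k.+1%:R, (p.2 + 1)%:~R / k.+1%:R[%classic.
Proof.
have H (x : R) (n : int) : Num.floor (k.+1%:R * x) = n <->
    x \in `[n%:~R / k.+1%:R, (n + 1)%:~R / k.+1%:R[.
  rewrite in_itv/= ler_pdivrMr// ltr_pdivlMr// [x * _]mulrC.
  by split => [/eqP|h]; [|apply/eqP]; rewrite floor_eq.
by apply/seteqP; split => -[x y] [/= /H ? /H ?].
Qed.

Lemma measurable_cell k p : measurable (cell k p).
Proof. by rewrite cellE; exact: measurableX. Qed.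

Definition cell_of k (z : R * R) : int * int :=
  (Num.floor (k.+1%:R * z.1), Num.floor (k.+1%:R * z.2)).

Lemma cell_ofP k z : cell k (cell_of k z) z.
Proof. by []. Qed.

Lemma cell_inj k p q z : cell k p z -> cell k q z -> p = q.
Proof. by case: p q => [p1 p2] [q1 q2] [/= <- <-] [/= <- <-]. Qed.

Lemma cell_diam k p z w : cell k p z -> cell k p w -> `|z - w| <= k.+1%:R^-1.
Proof.
have H (x y : R) (n : int) : Num.floor (k.+1%:R * x) = n -> Num.floor (k.+1%:R * y) = n ->
    `|x - y| <= k.+1%:R^-1.
  move=> xn yn; have := floor_le_tmp (k.+1%:R * x); have := floor_le_tmp (k.+1%:R * y).
  have := floorD1_gt (k.+1%:R * x); have := floorD1_gt (k.+1%:R * y).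
  rewrite xn yn intrD => h1 h2 h3 h4.
  rewrite -(@ler_pM2l _ k.+1%:R)// divff// -[X in X * _](@ger0_norm _ k.+1%:R)// -normrM.
  by rewrite mulrBr ler_norml; apply/andP; split; lra.
case: z w => [x y] [x' y'] [/= h1 h2] [/= h3 h4].
by rewrite prod_normE/= ge_max (H _ _ _ h1 h3) (H _ _ _ h2 h4).
Qed.

Definition cells_in k (A : set (R * R)) := [set p | cell k p `<=` A].

Definition cell_union k (I : set (int * int)) := \bigcup_(p in I) cell k p.

(** Enumeration of the cells through the coding of pairs of integers, since countable additivity is
    stated for sequences; a number that codes no index of [I] gives the empty set. *)
Definition cell_seq k (I : set (int * int)) n : set (R * R) :=
  if @pickle_inv (int * int)%type n is Some p then
    if p \in I then cell k p else set0 else set0.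

Lemma cell_seqP k I n z : cell_seq k I n z -> exists p, [/\ pickle p = n, I p & cell k p z].
Proof.
rewrite /cell_seq; have := @pickle_invK (int * int)%type n.
case: (pickle_inv n) => [p|_ []] /= pn; case: ifPn => [/set_mem Ip pz|_ []].
by exists p; split.
Qed.

Lemma cell_seqE k I : cell_union k I = \bigcup_n cell_seq k I n.
Proof.
apply/seteqP; split => [z [p Ip pz]|z [n _ /cell_seqP[p [_ Ip pz]]]]; last by exists p.
exists (pickle p); first by [].
by rewrite /cell_seq pickleK_inv mem_set.
Qed.

Lemma measurable_cell_seq k I n : measurable (cell_seq k I n).
Proof.
rewrite /cell_seq; case: (pickle_inv n) => [p|]; last exact: measurable0.
by case: ifPn => _; [exact: measurable_cell|exact: measurable0].
Qed.

Lemma trivIset_cell_seq k I : trivIset setT (cell_seq k I).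
Proof.
move=> m n _ _ [z [/cell_seqP[p [<- _ pz]] /cell_seqP[q [<- _ qz]]]].
by rewrite (cell_inj pz qz).
Qed.

Lemma measurable_cell_union k I : measurable (cell_union k I).
Proof.
by rewrite cell_seqE; apply: bigcupT_measurable => n; exact: measurable_cell_seq.
Qed.

Lemma open_cells (A : set (R * R)) z : open A -> A z ->
  \forall k \near \oo, cells_in k A (cell_of k z).
Proof.
move=> oA Az; have /nbhs_ballP[e /= e0 He] := open_nbhs_nbhs (conj oA Az).
have [N _ HN] := near_infty_natSinv_lt (PosNum e0).
exists N => // k /HN/= ke w kw; apply: He; rewrite -ball_normE/=.
exact: le_lt_trans (cell_diam (cell_ofP k z) kw) ke.
Qed.

(** The measurable sets are those of the product sigma-algebra, so open sets need an argument:
    around each point of [A], a cell of every fine enough grid fits into [A], hence [A] is a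
    countable union of cells. *)
Lemma measurable_open2 (A : set (R * R)) : open A -> measurable A.
Proof.
move=> oA; have -> : A = \bigcup_k cell_union k (cells_in k A).
  apply/seteqP; split => [z Az|z [k _ [p pA] kp]]; last exact: pA kp.
  have [N _ HN] := open_cells oA Az; exists N => //.
  by exists (cell_of N z); [exact: (HN N (leqnn N))|].
by apply: bigcupT_measurable => k; exact: measurable_cell_union.
Qed.

Lemma measurable_closed2 (A : set (R * R)) : closed A -> measurable A.
Proof.
by move=> cA; rewrite -[A]setCK; apply: measurableC; apply: measurable_open2; exact: closed_openC.
Qed.

Lemma compact_measurable2 (K : set (R * R)) : compact K -> measurable K.
Proof. by move=> /(compact_closed (@norm_hausdorff _ _))/measurable_closed2. Qed.

Lemma loc_integrable_swap (u : R * R -> R) : loc_integrable u ->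
  loc_integrable (fun z => u (z.2, z.1)).
Proof.
move=> lu; have [mu iu] := lu; split; first exact: (measurableT_comp mu measurable_plane_swap).
move=> K cK; have [N KN] := compact_sub_box cK.
have mus : measurable_fun setT (fun z : R * R => (`|u (z.2, z.1)|)%:E).
  by apply/measurable_EFinP; apply: measurableT_comp => //; exact: (measurableT_comp mu measurable_plane_swap).
apply: (@le_lt_trans _ _ (\int[area]_(z in box N) `|u (z.2, z.1)|%:E)%E).
  apply: ge0_subset_integral => //; first exact: compact_measurable2.
    exact: measurable_box.
  exact: measurable_funTS.
have := iu _ (@compact_box N); apply: le_lt_trans.
rewrite integral_mkcond [leRHS]integral_mkcond.
rewrite -[leRHS]integral_swap; last first.
  apply/(measurable_restrictT _ _).1; first exact: measurable_box.
  by apply/measurable_EFinP; apply: measurable_funTS; apply: measurableT_comp.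
rewrite le_eqVlt; apply/orP; left; apply/eqP; apply: eq_integral => -[x y] _ /=.
rewrite !patchE; congr (if _ then _ else _).
by apply/idP/idP; rewrite !inE => -[].
Qed.

Lemma measure_cell_union k I (m : {measure set (measurableTypeR R * measurableTypeR R)%type -> \bar R}) :
  (m (cell_union k I) = \sum_(0 <= n <oo) m (cell_seq k I n))%E.
Proof.
rewrite cell_seqE; apply: measure_semi_bigcup.
- by move=> n; exact: measurable_cell_seq.
- exact: trivIset_cell_seq.
- by rewrite -cell_seqE; exact: measurable_cell_union.
Qed.

Lemma le_measure_cell_union k I (m1 m2 : {measure set (measurableTypeR R * measurableTypeR R)%type -> \bar R}) :
  (forall p, I p -> (m1 (cell k p) <= m2 (cell k p))%E) ->
  (m1 (cell_union k I) <= m2 (cell_union k I))%E.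
Proof.
move=> le12; rewrite !measure_cell_union.
apply: lee_nneseries; first by [].
move=> n _; rewrite /cell_seq.
by case: (pickle_inv n) => [p|]; [case: ifPn => [/set_mem/le12|]|]; rewrite ?measure0.
Qed.

Lemma le_measure_integral_cell_union k I (c : R) (D : R * R -> \bar R) :
  0 <= c -> measurable_fun setT D -> (forall z, (0 <= D z)%E) ->
  (forall p, I p -> (c%:E * area (cell k p) <= \int[area]_(z in cell k p) D z)%E) ->
  (c%:E * area (cell_union k I) <= \int[area]_(z in cell_union k I) D z)%E.
Proof.
move=> c0 mD D0 le12.
have E : (area (cell_union k I) = \sum_(0 <= n <oo) area (cell_seq k I n))%E.
  exact: measure_cell_union.
rewrite E cell_seqE ge0_integral_bigcup//; last 3 first.
- by move=> n; exact: measurable_cell_seq.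
- exact: measurable_funTS.
- exact: trivIset_cell_seq.
rewrite -nneseriesZl//; apply: lee_nneseries.
  by move=> n _ _; rewrite mule_ge0//; exact: measure_ge0.
move=> n _; rewrite /cell_seq.
case: (pickle_inv n) => [p|]; last by rewrite integral_set0 [area set0]measure0 mule0.
case: ifPn => [/set_mem/le12//|_].
by rewrite integral_set0 [area set0]measure0 mule0.
Qed.

(** Induction on Borel sets from the closed ones. The product sigma-algebra is generated by
    rectangles, these by half-lines in each coordinate, and the preimage of a closed half-line under
    a projection is closed. *)
Lemma measurable_closed_ind (C : set (set (R * R))) : sigma_algebra setT C ->
  (forall F : set (R * R), closed F -> C F) -> forall A, measurable A -> C A.
Proof.
move=> sC CF.
have [C0 CC CU] := sC.
have CI A B : C A -> C B -> C (A `&` B).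
  move=> CA CB.
  have -> : A `&` B = setT `\` \bigcup_n (if n is O then setT `\` A else setT `\` B).
    apply/seteqP; split => [z [Az Bz]|z [_ h]].
      by split => // -[[|n] _] /= [].
    split; apply: contrapT => h'; apply: h; first by exists O.
    by exists 1%N.
  by apply: (CC); apply: CU => -[|n]; exact: (CC).
have H (pr : R * R -> R) : continuous pr -> forall B : set R, measurable B -> C (pr @^-1` B).
  move=> cp B mB.
  have {mB} : <<s @RGenInftyO.G R >> B.
    have E : @measurable _ (measurableTypeR R) = <<s @RGenInftyO.G R >> := RGenInftyO.measurableE R.
    by rewrite -E.
  apply: (@smallest_sub _ _ _ [set B | C (pr @^-1` B)]) => [|_ [x ->]] /=.
    split => /= [|X CX|F CF'].
    - by rewrite preimage_set0.
    - by have := CC _ CX; congr C; apply/seteqP; split.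
    - by rewrite preimage_bigcup; exact: CU.
  have -> : pr @^-1` `]-oo, x[ = setT `\` (pr @^-1` `[x, +oo[).
    apply/seteqP; split => z /=; rewrite !in_itv/= andbT.
      by move=> zx; split => //; rewrite leNgt zx.
    by move=> [_ /negP]; rewrite -ltNge.
  apply: (CC); apply: CF; apply: (@closed_comp _ _ pr); last exact: interval_closed.
  by move=> z _; exact: cp.
move=> A; rewrite measurable_prod_measurableType.
apply: smallest_sub => // _ [B1 mB1 [B2 mB2 <-]].
have -> : B1 `*` B2 = (fst @^-1` B1) `&` (snd @^-1` B2) by apply/seteqP; split => -[].
by apply: CI; apply: H => // z; [exact: cvg_fst|exact: cvg_snd].
Qed.

(** The neighbourhoods of [A] of radius 1/(n+1) decrease to [A] because [A] is closed, and a finite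
    measure is continuous along them. *)
Lemma closed_outer_regularity (m : {finite_measure set (measurableTypeR R * measurableTypeR R)%type -> \bar R}) (A : set (R * R)) (e : R) :
  closed A -> 0 < e ->
  exists2 O : set (R * R), open O /\ A `<=` O & (m (O `\` A) <= e%:E)%E.
Proof.
move=> cA e0.
pose O n : set (R * R) := \bigcup_(z in A) ball z n.+1%:R^-1.
have oO n : open (O n).
  by apply: bigcup_open => z _; exact: ball_open.
have AO n : A `<=` O n by move=> z Az; exists z => //; apply: ballxx.
have IO : \bigcap_n (O n `\` A) = set0.
  rewrite -subset0 => z Oz.
  have [_ nAz] := Oz 0%N I; apply: nAz.
  rewrite (closure_id A).1// => B /nbhs_ballP[d /= d0 zB].
  have [N _ HN] := near_infty_natSinv_lt (PosNum d0).
  have [[w Aw wz] _] := Oz N I; exists w; split => //; apply: zB.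
  by apply: ball_sym; apply: le_ball wz; apply/ltW; apply: (HN N (leqnn N)).
have mO n : measurable (O n `\` A).
  apply: measurableD; first exact: measurable_open2.
  exact: measurable_closed2.
have dO : {homo (fun n => O n `\` A) : n k / (n <= k)%N >-> (k <= n)%O}.
  move=> n k nk; rewrite subsetEset => z [[w Aw wz] nA]; split => //.
  by exists w => //; apply: le_ball wz; rewrite lef_pV2 ?posrE// ler_nat.
have mfin : (m (O 0%N `\` A) < +oo)%E by rewrite ltey_eq (fin_num_measure m _ (mO 0%N)).
have mI : measurable (\bigcap_n (O n `\` A)) by rewrite IO.
have := nonincreasing_cvg_mu mfin mO mI dO.
rewrite IO measure0 => /fine_cvgP[_ /cvgrPdist_le /(_ _ e0)] [N _ HN].
exists (O N) => //.
have := HN N (leqnn N); rewrite /= sub0r normrN => h.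
rewrite -(fineK (fin_num_measure m _ (mO N))) lee_fin.
exact: le_trans (ler_norm _) h.
Qed.

(** The sets that can be approximated from outside by open sets and from inside by closed sets form
    a sigma-algebra. Inner approximation is carried along for the sake of complements, which
    exchange the two. *)
Lemma outer_regularity (m : {finite_measure set (measurableTypeR R * measurableTypeR R)%type -> \bar R}) (A : set (R * R)) (e : R) :
  measurable A -> 0 < e ->
  exists2 O : set (R * R), open O /\ A `<=` O & (m (O `\` A) <= e%:E)%E.
Proof.
move=> mA; move: e.
pose C (A : set (R * R)) := [/\ measurable A,
  forall e : R, 0 < e -> exists2 O : set (R * R), open O /\ A `<=` O & (m (O `\` A) <= e%:E)%E &
  forall e : R, 0 < e -> exists2 F : set (R * R), closed F /\ F `<=` A & (m (A `\` F) <= e%:E)%E].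
suff: C A by case.
apply: measurable_closed_ind mA; last first.
  move=> F cF; split.
  - exact: measurable_closed2.
  - by move=> e; exact: closed_outer_regularity.
  - by move=> e e0; exists F; [split|rewrite setDv measure0 lee_fin ltW].
split.
- split; first exact: measurable0.
  + by move=> e e0; exists set0; [split => //; exact: open0|rewrite setDv measure0 lee_fin ltW].
  + by move=> e e0; exists set0; [split => //; exact: closed0|rewrite setDv measure0 lee_fin ltW].
- move=> B [mB hB cB]; rewrite setTD; split; first exact: measurableC.
  + move=> e /cB[F [cF FB] mF]; exists (~` F).
      by split; [exact: closed_openC|exact: subsetC].
    apply: le_trans mF; rewrite le_eqVlt; apply/orP; left; apply/eqP; congr (m _).
    by apply/seteqP; split => z [/= h1 h2]; split => //; exact: contrapT.
  + move=> e /hB[U [oU BU] mU]; exists (~` U).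
      by split; [exact: open_closedC|exact: subsetC].
    apply: le_trans mU; rewrite le_eqVlt; apply/orP; left; apply/eqP; congr (m _).
    by apply/seteqP; split => z [/= h1 h2]; split => //; exact: contrapT.
- move=> B CB.
  have mB n : measurable (B n) by have [] := CB n.
  have mU : measurable (\bigcup_n B n) by exact: bigcupT_measurable.
  have small (X : nat -> set (R * R)) (e : R) : 0 < e -> (forall n, measurable (X n)) ->
      (forall n, (m (X n) <= (e / (2 ^ n.+1)%:R)%:E)%E) -> (m (\bigcup_n X n) <= e%:E)%E.
    move=> e0 mX Xe.
    apply: (@le_trans _ _ (\sum_(0 <= n <oo) m (X n))%E).
      apply: (@measure_sigma_subadditive _ _ _ m _ X) => //.
      exact: bigcupT_measurable.
    apply: (@le_trans _ _ (\sum_(0 <= n <oo) (0 + (e / (2 ^ n.+1)%:R)%:E))%E).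
      by apply: lee_nneseries => // n _; rewrite add0e; exact: Xe.
    apply: le_trans (epsilon_trick _ _ _) _ => //; first exact: ltW.
    by rewrite eseries0// add0e.
  have ek (e : R) n : 0 < e -> 0 < e / (2 ^ n.+1)%:R.
    by move=> e0; rewrite divr_gt0// ltr0n expn_gt0.
  split => //.
  + move=> e e0.
    have /choice[ O HO] n : exists O : set (R * R), (open O /\ B n `<=` O) /\
        (m (O `\` B n) <= (e / (2 ^ n.+1)%:R)%:E)%E.
      by have [_ /(_ _ (ek _ n e0))[U ? ?] _] := CB n; exists U.
    exists (\bigcup_n O n).
      split; first by apply: bigcup_open => n _; have [[]] := HO n.
      by move=> z [n _ Bz]; exists n => //; have [[_ BU] _] := HO n; exact: BU.
    have mO n : measurable (O n `\` B n).
      by apply: measurableD => //; apply: measurable_open2; have [[]] := HO n.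
    apply: le_trans (small _ _ e0 mO _); last by move=> n; have [] := HO n.
    apply: le_measure; rewrite ?inE.
    * apply: measurableD => //; apply: bigcupT_measurable => n.
      by apply: measurable_open2; have [[]] := HO n.
    * exact: bigcupT_measurable.
    * by move=> z [[n _ Oz] nB]; exists n => //; split => // Bz; apply: nB; exists n.
  + move=> e e0; have e20 : 0 < e / 2 by rewrite divr_gt0.
    have /choice[F HF] n : exists F : set (R * R), (closed F /\ F `<=` B n) /\
        (m (B n `\` F) <= (e / 2 / (2 ^ n.+1)%:R)%:E)%E.
      by have [_ _ /(_ _ (ek _ n e20))[F ? ?]] := CB n; exists F.
    have mF n : measurable (F n) by apply: measurable_closed2; have [[]] := HF n.
    have mBF n : measurable (B n `\` F n) by exact: measurableD.
    (* A countable union of closed sets need not be closed: finitely many are kept, and continuity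
       from above along [G] pays for the others with the second e / 2. *)
    pose G n := (\bigcup_n B n) `\` \big[setU/set0]_(i < n) F i.
    have mG n : measurable (G n) by apply: measurableD => //; exact: bigsetU_measurable.
    have IG : \bigcap_n G n = (\bigcup_n B n) `\` \bigcup_n F n.
      apply/seteqP; split => z.
        move=> Gz; have [Bz _] := Gz 0%N I; split => // -[n _ Fz].
        have [_] := Gz n.+1 I; apply; rewrite -bigcup_mkord; exists n => //=.
      move=> [Bz nF] n _; split => //; rewrite -bigcup_mkord => -[k _ Fz].
      by apply: nF; exists k.
    have mIG : measurable (\bigcap_n G n) by exact: bigcapT_measurable.
    have dG : {homo G : n k / (n <= k)%N >-> (k <= n)%O}.
      move=> n k nk; rewrite subsetEset; apply: setDS.
      exact: subset_bigsetU.
    have mfin : (m (G 0%N) < +oo)%E by rewrite ltey_eq (fin_num_measure m _ (mG 0%N)).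
    have Ge : (m (\bigcap_n G n) <= (e / 2)%:E)%E.
      rewrite IG; apply: le_trans (small _ _ e20 mBF _); last by move=> n; have [] := HF n.
      apply: le_measure; rewrite ?inE.
      * by rewrite -IG.
      * exact: bigcupT_measurable.
      * by move=> z [[n _ Bz] nF]; exists n => //; split => // Fz; apply: nF; exists n.
    have fI := fineK (fin_num_measure m _ mIG).
    have : (m \o G) n @[n --> \oo] --> (fine (m (\bigcap_n G n)))%:E.
      by rewrite fI; exact: (nonincreasing_cvg_mu mfin mG mIG dG).
    move=> /fine_cvgP[_ /cvgrPdist_le /(_ _ e20)] [N _ HN].
    exists (\big[setU/set0]_(i < N) F i).
      split; first by apply: closed_bigsetU => n _; have [[]] := HF n.
      by rewrite -bigcup_mkord => z [n _ Fz]; exists n => //; have [[_ BU] _] := HF n; exact: BU.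
    have := HN N (leqnn N); rewrite /= => h.
    rewrite -/(G N) -(fineK (fin_num_measure m _ (mG N))) lee_fin.
    move: h; have : fine (m (\bigcap_n G n)) <= e / 2 by rewrite -lee_fin fI.
    rewrite ler_norml => h3 /andP[h1 h2]; lra.
Qed.

End TwoDim.

(** * Smooth test functions *)

Section Flat.
Context {R : realType}.
Implicit Types (x y : R) (f g : R -> R).

(** The functions x^(-k) exp (-1/x), extended by 0. The whole family is introduced because
    differentiation maps [flat k] to a combination of [flat k.+1] and [flat k.+2]. *)
Definition flat k x : R := if 0 < x then x^-1 ^+ k * expR (- x^-1) else 0.

Lemma flat_ge0 k x : 0 <= flat k x.
Proof.
rewrite /flat; case: ifPn => // x0.
by rewrite mulr_ge0 ?expR_ge0// exprn_ge0// invr_ge0 ltW.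
Qed.

(** exp (1/x) is at least the term of order k + 2 of its series, which absorbs x^(-k) and leaves
    x^2. A quadratic bound is all that differentiability at 0 requires. *)
Lemma flat_le_sqr k x : `|flat k x| <= (k.+2)`!%:R * `|x| ^+ 2.
Proof.
rewrite ger0_norm ?flat_ge0// /flat; case: ifPn => [x0|_]; last first.
  by rewrite mulr_ge0 ?ler0n// exprn_ge0.
have y0 : 0 < x^-1 by rewrite invr_gt0.
rewrite (gtr0_norm x0) expRN.
have := expR_ge1Dxn k.+1 (ltW y0) => He.
have : x^-1 ^+ k.+2 / (k.+2)`!%:R <= expR x^-1.
  by apply: le_trans He; rewrite lerDr.
rewrite ler_pdivrMr ?ltr0n ?fact_gt0// => {}He.
rewrite ler_pdivrMr ?expR_gt0//.
have -> : x^-1 ^+ k = x ^+ 2 * x^-1 ^+ k.+2.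
  by rewrite !exprS; field; rewrite gt_eqF.
by rewrite [leRHS]mulrAC [leRHS]mulrC ler_pM2l ?exprn_gt0// mulrC.
Qed.

Lemma is_derive_sqr_bound f (C : R) : (forall x, `|f x| <= C * `|x| ^+ 2) ->
  is_derive (0 : R) 1 f 0.
Proof.
move=> fC; have f0 : f 0 = 0.
  apply/eqP; rewrite -normr_le0 (le_trans (fC 0))//.
  by rewrite normr0 expr0n/= mulr0.
have H : (fun h => h^-1 *: (f (h *: (1:R) + 0) - f 0)) @ (0 : R)^' --> (0 : R).
  apply/cvgrPdist_le => e e0; near=> h.
  rewrite f0 subr0 sub0r normrN addr0 normrM normfV.
  have h0 : h != 0 by near: h; exact: nbhs_dnbhs_neq.
  rewrite ler_pdivrMl ?normr_gt0// /GRing.scale/= mulr1.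
  apply: (le_trans (fC h)); rewrite expr2 mulrA [leRHS]mulrC ler_wpM2r//.
  have : `|h| <= e / (`|C| + 1).
    near: h; apply: cvg_within.
    have := @cvgr0_norm_le R R _ (nbhs (0:R)) _ (@id R).
    by apply => //; rewrite divr_gt0// ltr_wpDl.
  rewrite ler_pdivlMr ?ltr_wpDl// => he.
  apply: le_trans he; rewrite mulrC ler_wpM2l//.
  by rewrite (le_trans (ler_norm C))// lerDl.
split; first by apply/cvg_ex; exists 0.
exact/cvg_lim.
Unshelve. all: by end_near. Qed.

Lemma is_derive_flat k x :
  is_derive x 1 (flat k) (flat k.+2 x - k%:R * flat k.+1 x).
Proof.
have [x0|x0|->] := ltgtP x 0.
- rewrite /flat ltNge (ltW x0)/= mulr0 subr0.
  apply: (@near_eq_is_derive _ _ _ (cst 0)).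
    near=> a; rewrite /= ifN// -leNgt ltW//.
    by near: a; exact: lt_nbhsl.
- rewrite {2 3}/flat x0.
  apply: (@near_eq_is_derive _ _ _ (fun x => x^-1 ^+ k * expR (- x^-1))).
  + near=> a; rewrite /flat ifT//.
    by near: a; exact: lt_nbhsr.
  + have xn0 : x != 0 by rewrite gt_eqF.
    have Hi : is_derive x 1 (fun y : R => y^-1) (- x ^- 2).
      have := is_derive_id x (1:R) => Hid.
      have -> : - x ^- 2 = - x ^- 2 *: (1 : R) by rewrite /GRing.scale/= mulr1.
      exact: (@is_deriveV R (fun y : R => y) x 1 1 xn0 Hid).
    have He : is_derive x 1 (fun y : R => expR (- y^-1)) (x ^- 2 * expR (- x^-1)).
      have Hn : is_derive x 1 (fun y : R => - y^-1) (x ^- 2).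
        by have := @is_deriveN _ _ _ _ _ _ _ Hi; rewrite opprK; apply.
      have := @is_derive1_comp _ expR (fun y => - y^-1) x _ _ (is_derive_expR _) Hn.
      by rewrite mulrC; apply.

    have Hk : is_derive x 1 (fun y : R => y^-1 ^+ k) (k%:R * x^-1 ^+ k.-1 * (- x ^- 2)).
      rewrite (_ : (fun y => _) = (fun y : R => y^-1) ^+ k); first exact: is_deriveX.
      by apply/funext => y; rewrite exprfctE.
    apply: (@is_derive_eq _ _ _ ((fun y : R => y^-1 ^+ k) * (fun y : R => expR (- y^-1)))).
    rewrite /GRing.scale/=.
    case: k {Hk} => [|k]; rewrite ?exprS /= ?mul0r; field; rewrite ?xn0//.
- rewrite {2 3}/flat ltxx mulr0 subr0.
  exact: (is_derive_sqr_bound (flat_le_sqr k)).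
Unshelve. all: by end_near. Qed.

(* Generated by the derivatives of exp (-1/x) and the denominator of the smooth step; stable under
   differentiation. *)
Inductive flat_alg : (R -> R) -> Prop :=
| flat_alg_flat k : flat_alg (flat k)
| flat_alg_flatr k : flat_alg (fun x => flat k (1 - x))
| flat_alg_den : flat_alg (fun x => (flat 0 x + flat 0 (1 - x))^-1)
| flat_alg_cst c : flat_alg (fun=> c)
| flat_alg_add f g : flat_alg f -> flat_alg g -> flat_alg (fun x => f x + g x)
| flat_alg_mul f g : flat_alg f -> flat_alg g -> flat_alg (fun x => f x * g x).

Lemma flat_gt0 k x : 0 < x -> 0 < flat k x.
Proof. by move=> x0; rewrite /flat x0 mulr_gt0 ?expR_gt0// exprn_gt0// invr_gt0. Qed.

Lemma flat_eq0 k x : x <= 0 -> flat k x = 0.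
Proof. by move=> x0; rewrite /flat ltNge x0. Qed.

Lemma flat_den_gt0 x : 0 < flat 0 x + flat 0 (1 - x).
Proof.
have [x0|x0] := ltP 0 x; first by rewrite ltr_wpDr ?flat_ge0// flat_gt0.
by rewrite ltr_wpDl ?flat_ge0// flat_gt0// subr_gt0 (le_lt_trans x0).
Qed.

Lemma is_derive_flatr k x : is_derive x 1 (fun x => flat k (1 - x))
  (- (flat k.+2 (1 - x) - k%:R * flat k.+1 (1 - x))).
Proof.
have Hi : is_derive x 1 (fun y : R => 1 - y) (-1).
  have : is_derive x 1 (cst 1 - id : R -> R) (0 - 1) by exact: is_deriveB.
  by rewrite sub0r; apply.
have Hf := is_derive_flat k (1 - x).
have := @is_derive1_comp _ (flat k) (fun y => 1 - y) x _ _ Hf Hi.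
by rewrite mulrN1; apply.
Qed.

Lemma flat_alg_derive f : flat_alg f ->
  exists2 f', flat_alg f' & forall x, is_derive x 1 f (f' x).
Proof.
have E k : flat_alg (fun x => flat k.+2 x - k%:R * flat k.+1 x).
  have -> : (fun x => flat k.+2 x - k%:R * flat k.+1 x) =
            (fun x => flat k.+2 x + (- k%:R) * flat k.+1 x).
    by apply/funext => x; rewrite mulNr.
  by apply: flat_alg_add; [|apply: flat_alg_mul]; constructor.
have Er k : flat_alg (fun x => - (flat k.+2 (1 - x) - k%:R * flat k.+1 (1 - x))).
  have -> : (fun x => - (flat k.+2 (1 - x) - k%:R * flat k.+1 (1 - x))) =
            (fun x => (-1) * flat k.+2 (1 - x) + k%:R * flat k.+1 (1 - x)).
    by apply/funext => x; ring.
  by apply: flat_alg_add; apply: flat_alg_mul; constructor.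
elim=> [k|k||c|{}f g _ [f' Sf' df'] _ [g' Sg' dg']|{}f g Sf [f' Sf' df'] Sg [g' Sg' dg']].
- by eexists; [exact: (E k)|move=> x; exact: is_derive_flat].
- by eexists; [exact: (Er k)|move=> x; exact: is_derive_flatr].
- pose h x := (flat 0 x + flat 0 (1 - x))^-1 : R.
  pose d x := (flat 2 x - 0%:R * flat 1 x) + - (flat 2 (1 - x) - 0%:R * flat 1 (1 - x)) : R.
  exists (fun x => ((-1) * (h x * h x)) * d x).
    apply: flat_alg_mul; last by apply: flat_alg_add; [exact: E|exact: Er].
    by apply: flat_alg_mul; [constructor|apply: flat_alg_mul; constructor].
  move=> x.
  have dn : is_derive x 1 (fun x => flat 0 x + flat 0 (1 - x)) (d x).
    by apply: is_deriveD; [exact: is_derive_flat|exact: is_derive_flatr].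
  have n0 : flat 0 x + flat 0 (1 - x) != 0 by rewrite gt_eqF ?flat_den_gt0.
  apply: is_derive_eq.
  by rewrite /GRing.scale/= /h; field.
- by exists (fun=> 0); [constructor|move=> x; exact: is_derive_cst].
- by exists (fun x => f' x + g' x); [exact: flat_alg_add|move=> x; exact: is_deriveD].
- exists (fun x => f x * g' x + g x * f' x); last by move=> x; exact: is_deriveM.
  by apply: flat_alg_add; apply: flat_alg_mul.
Qed.

(** All derivatives are given at once as a sequence, so that differences and affine changes of
    variable are treated term by term. *)
Definition smooth f := exists F : nat -> R -> R,
  F 0%N = f /\ forall n x, is_derive x 1 (F n) (F n.+1 x).

Lemma flat_alg_smooth f : flat_alg f -> smooth f.
Proof.
move=> Sf; exists (fun n => iter n (@derive1 R R) f); split => //.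
have D g : flat_alg g -> flat_alg (derive1 g) /\ forall x, is_derive x 1 g (derive1 g x).
  move=> /flat_alg_derive[g' Sg' dg'].
  have -> : derive1 g = g'.
    by apply/funext => x; rewrite derive1E; have := dg' x => ?; exact: derive_val.
  by [].
have Sn n : flat_alg (iter n (@derive1 R R) f).
  by elim: n => //= n /D[].
by move=> n x; have [] := D _ (Sn n).
Qed.

Lemma smooth_affine f m a : smooth f -> smooth (fun x => f (m * (x - a))).
Proof.
move=> [F [F0 dF]]; exists (fun n x => m ^+ n * F n (m * (x - a))); split.
  by apply/funext => x; rewrite expr0 mul1r F0.
move=> n x.
have Hi : is_derive x 1 (fun y : R => m * (y - a)) m.
  have : is_derive x 1 (m \*: (id - cst a) : R -> R) (m *: (1 - 0)).
    by apply: is_deriveZ; exact: is_deriveB.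
  by rewrite /GRing.scale/= subr0 mulr1; apply.
have Hf := @is_derive1_comp _ (F n) (fun y => m * (y - a)) x _ _ (dF n (m * (x - a))) Hi.
apply: (@is_derive_eq _ _ _ ((m ^+ n) \*: (fun x => F n (m * (x - a))))).
by rewrite /GRing.scale/= exprS; ring.
Qed.

Lemma smoothB f g : smooth f -> smooth g -> smooth (fun x => f x - g x).
Proof.
move=> [F [F0 dF]] [G [G0 dG]]; exists (fun n x => F n x - G n x); split.
  by rewrite F0 G0.
by move=> n x; apply: is_deriveB.
Qed.

Lemma smooth_derive f : smooth f -> smooth (derive1 f) /\ forall x, is_derive x 1 f (derive1 f x).
Proof.
move=> [F [F0 dF]].
have -> : derive1 f = F 1%N.
  by apply/funext => x; rewrite derive1E -F0; have := dF 0%N x => ?; exact: derive_val.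
by rewrite -F0; split; [exists (fun n => F n.+1)|exact: dF].
Qed.

Lemma smooth_continuous f : smooth f -> continuous f.
Proof.
move=> /smooth_derive[_ df] x; have [? _] := df x.
exact/differentiable_continuous/derivable1_diffP.
Qed.

(** The usual smooth transition from 0 on x <= 0 to 1 on x >= 1; the denominator is positive since x
    and 1 - x are never both nonpositive. *)
Definition step x : R := flat 0 x * (flat 0 x + flat 0 (1 - x))^-1.

Lemma smooth_step : smooth step.
Proof. by apply: flat_alg_smooth; apply: flat_alg_mul; constructor. Qed.

Lemma step0 x : x <= 0 -> step x = 0.
Proof. by move=> x0; rewrite /step flat_eq0// mul0r. Qed.

Lemma step1 x : 1 <= x -> step x = 1.
Proof.
move=> x1; rewrite /step [flat 0 (1 - x)]flat_eq0 ?subr_le0// addr0 divff//.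
by rewrite gt_eqF// flat_gt0// (lt_le_trans ltr01).
Qed.

Lemma flat0_le x y : x <= y -> flat 0 x <= flat 0 y.
Proof.
move=> xy; have [x0|x0] := ltP 0 x; last by rewrite (flat_eq0 _ x0) flat_ge0.
have y0 : 0 < y by exact: lt_le_trans xy.
by rewrite /flat x0 y0 !expr0 !mul1r ler_expR lerN2 lef_pV2.
Qed.

Lemma step_le x y : x <= y -> step x <= step y.
Proof.
move=> xy; rewrite /step ler_pdivrMr ?flat_den_gt0// mulrAC ler_pdivlMr ?flat_den_gt0//.
rewrite !mulrDr [flat 0 y * flat 0 x]mulrC lerD2l ler_pM ?flat_ge0 ?flat0_le//.
by rewrite lerB.
Qed.

Lemma step_ge0 x : 0 <= step x.
Proof. by rewrite mulr_ge0 ?flat_ge0// invr_ge0 ltW ?flat_den_gt0. Qed.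

Lemma step_le1 x : step x <= 1.
Proof. by rewrite /step ler_pdivrMr ?flat_den_gt0// mul1r lerDl flat_ge0. Qed.

Lemma step_derive_ge0 x : 0 <= derive1 step x.
Proof.
have ds y : is_derive y 1 step (derive1 step y).
  by have [_] := smooth_derive smooth_step; exact.
apply/ler_addgt0Pr => e e0.
(* The term e * y makes the function strictly increasing, as [incr_derive1_ge0] requires; e is
   arbitrary. *)
pose f y : R := step y + e * y.
have df y : is_derive y 1 f (derive1 step y + e).
  have : is_derive y 1 (step + (e \*: id) : R -> R) (derive1 step y + e *: 1).
    by apply: is_deriveD; exact: is_deriveZ.
  by rewrite /GRing.scale/= mulr1; apply.
have <- : derive1 f x = derive1 step x + e.
  by rewrite derive1E; have := df x => ?; exact: derive_val.
apply: (@incr_derive1_ge0 _ f setT).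
- by move=> y _; have [] := df y.
- by move=> y z _ _ yz; rewrite /f ler_ltD ?step_le ?(ltW yz)// ltr_pM2l.
- by rewrite interiorT.
Qed.

Lemma derive1_eq0_near (f : R -> R) c x : (\forall y \near x, f y = c) -> derive1 f x = 0.
Proof.
move=> fc; rewrite derive1E (near_eq_derive (g := cst c))//.
exact: derive_val.
Qed.

(* tent a b n tends to the indicator of ]a, b], spike c n to the Dirac mass at c, and the derivative
   of tent is a difference of two spikes: tested on their tensor products, a weak derivative yields
   its integrals over rectangles. *)
Definition tent (a b : R) n x : R :=
  step (n.+1%:R * (x - a)) - step (n.+1%:R * (x - b)).

Lemma smooth_tent a b n : smooth (tent a b n).
Proof. by apply: smoothB; apply: smooth_affine; exact: smooth_step. Qed.

Lemma tent_ge0 a b n x : a <= b -> 0 <= tent a b n x.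
Proof. by move=> ab; rewrite subr_ge0 step_le// ler_pM2l// lerD2l lerN2. Qed.

Lemma tent_le1 a b n x : tent a b n x <= 1.
Proof. by rewrite lerBlDr (le_trans (step_le1 _))// lerDl step_ge0. Qed.

(** The descending ramp ends at b + 1/(n+1); the bound b + 1 serves all n at once. *)
Lemma tent_eq0 a b n x : a <= b -> x \notin `]a, b + 1[ -> tent a b n x = 0.
Proof.
move=> ab; rewrite in_itv/= negb_and -!leNgt => /orP[xa|xb].
  by rewrite /tent !step0 ?subrr// pmulr_rle0// subr_le0// (le_trans xa).
have h c : c <= b -> 1 <= n.+1%:R * (x - c).
  move=> cb; have x1 : 1 <= x - c by rewrite lerBrDl (le_trans _ xb)// lerD2r.
  by rewrite (le_trans x1)// ler_peMl ?ler1n// (le_trans ler01).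
by rewrite /tent !step1 ?subrr// h.
Qed.

(** The ramps at [a] and [b] become steep. As [step] vanishes at 0, a ramp does not yet count at its
    starting point, which makes the interval half-open. *)
Lemma tent_cvg a b x : a <= b -> tent a b n x @[n --> \oo] --> (\1_(`]a, b]%classic) x : R).
Proof.
move=> ab.
have big c : c < x -> \forall n \near \oo, step (n.+1%:R * (x - c)) = 1.
  move=> cx; have [N _ HN] := near_infty_natSinv_lt (PosNum (eqbRL (subr_gt0 _ _) cx)).
  exists N => // n /HN/= /ltW h; apply: step1.
  by rewrite -ler_pdivrMl ?ltr0n// mulr1.
have small c n : x <= c -> step (n.+1%:R * (x - c)) = 0.
  by move=> xc; rewrite step0// pmulr_rle0// subr_le0.
rewrite indicE; have [xa|ax] := leP x a.
  rewrite memNset ?mulr0n; last by rewrite /= in_itv/= ltNge xa.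
  apply: cvg_near_cst; near=> n.
  by rewrite /tent !small ?subrr// (le_trans xa).
have [xb|bx] := leP x b.
  rewrite mem_set; last by rewrite /= in_itv/= ax xb.
  apply: cvg_near_cst; near=> n.
  by rewrite /tent [X in _ - X]small// subr0; near: n; exact: big.
rewrite memNset; last by rewrite /= in_itv/= ax/= leNgt bx.
apply: cvg_near_cst; near=> n; rewrite /tent.
have -> : step (n.+1%:R * (x - a)) = 1 by near: n; exact: big.
have -> : step (n.+1%:R * (x - b)) = 1 by near: n; exact: big.
by rewrite subrr.
Unshelve. all: by end_near. Qed.

Definition spike (c : R) n x : R := n.+1%:R * derive1 step (n.+1%:R * (x - c)).

Lemma is_derive_ramp (c : R) n x :
  is_derive x 1 (fun y : R => step (n.+1%:R * (y - c))) (spike c n x).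
Proof.
have Hi : is_derive x 1 (fun y : R => n.+1%:R * (y - c)) n.+1%:R.
  have : is_derive x 1 (n.+1%:R \*: (id - cst c) : R -> R) (n.+1%:R *: (1 - 0)).
    by apply: is_deriveZ; exact: is_deriveB.
  by rewrite /GRing.scale/= subr0 mulr1; apply.
have [_ /(_ (n.+1%:R * (x - c))) Hs] := smooth_derive smooth_step.
have := @is_derive1_comp _ step (fun y => n.+1%:R * (y - c)) x _ _ Hs Hi.
by rewrite mulrC; apply.
Qed.

Lemma spike_ge0 c n x : 0 <= spike c n x.
Proof. by rewrite mulr_ge0 ?step_derive_ge0. Qed.

Lemma spike_eq0 c n x : x \notin `[c, c + n.+1%:R^-1] -> spike c n x = 0.
Proof.
rewrite in_itv/= negb_and -!ltNge => /orP[xc|cx].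
  rewrite /spike (@derive1_eq0_near step 0) ?mulr0//.
  have h : n.+1%:R * (x - c) < 0 by rewrite pmulr_rlt0// subr_lt0.
  near=> y; apply: step0; apply/ltW; near: y; exact: lt_nbhsl.
rewrite /spike (@derive1_eq0_near step 1) ?mulr0//.
have h : 1 < n.+1%:R * (x - c) by rewrite -ltr_pdivrMl ?ltr0n// mulr1 ltrBrDl.
near=> y; apply: step1; apply/ltW; near: y; exact: lt_nbhsr.
Unshelve. all: by end_near. Qed.

Lemma spike_continuous c n : continuous (spike c n).
Proof.
have [/smooth_continuous H _] := smooth_derive smooth_step.
move=> x; apply: cvgM; first exact: cvg_cst.
apply: (cvg_comp (fun y => n.+1%:R * (y - c))); last exact: H.
by apply: cvgM; [exact: cvg_cst|apply: cvgB; [exact: cvg_id|exact: cvg_cst]].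
Qed.

Lemma derive1_tent a b n x : derive1 (tent a b n) x = spike a n x - spike b n x.
Proof.
rewrite derive1E.
have : is_derive x 1 (tent a b n) (spike a n x - spike b n x).
  by apply: is_deriveB; exact: is_derive_ramp.
by move=> ?; exact: derive_val.
Qed.

(** A derivative in direction [e] sees only the restriction to a line; this brings derivatives in
    the plane back to one variable. *)
Lemma is_derive_line (e z : R * R) (phi : R * R -> R) (psi : R -> R) t d :
  (forall h, phi (h *: e + z) = psi (h + t)) -> is_derive t 1 psi d -> is_derive z e phi d.
Proof.
move=> E [D1 D2].
have EQ : (fun h : R => h^-1 *: ((phi \o shift z) (h *: e) - phi z)) =
          (fun h : R => h^-1 *: ((psi \o shift t) (h *: (1 : R)) - psi t)).
  apply/funext => h /=; rewrite E; have := E 0; rewrite scale0r !add0r => ->.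
  by rewrite [_%:A]mulr1.
by split; rewrite /derivable /derive EQ.
Qed.

Lemma is_derive_tensor_x (a b : R -> R) da (z : R * R) : is_derive z.1 1 a da ->
  is_derive z (dirx R) (fun z : R * R => a z.1 * b z.2) (da * b z.2).
Proof.
case: z => x y /= ad.
apply: (@is_derive_line _ _ _ ((b y) \*: a : R -> R) x) => [h|] /=.
  by rewrite [h%:A]mulr1 scaler0 add0r mulrC.
by have := is_deriveZ (b y) ad; rewrite /GRing.scale/= mulrC; apply.
Qed.

Lemma is_derive_tensor_y (a b : R -> R) db (z : R * R) : is_derive z.2 1 b db ->
  is_derive z (diry R) (fun z : R * R => a z.1 * b z.2) (a z.1 * db).
Proof.
case: z => x y /= bd.
apply: (@is_derive_line _ _ _ ((a x) \*: b : R -> R) y) => h /=.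
by rewrite [h%:A]mulr1 scaler0 add0r.
Qed.

Lemma derive_tensor_x (a b : R -> R) : smooth a ->
  (fun z => 'D_(dirx R) (fun z : R * R => a z.1 * b z.2) z) =
  (fun z => derive1 a z.1 * b z.2).
Proof.
move=> /smooth_derive[_ da]; apply/funext => z.
by have := is_derive_tensor_x b (da z.1) => ?; exact: derive_val.
Qed.

Lemma derive_tensor_y (a b : R -> R) : smooth b ->
  (fun z => 'D_(diry R) (fun z : R * R => a z.1 * b z.2) z) =
  (fun z => a z.1 * derive1 b z.2).
Proof.
move=> /smooth_derive[_ db]; apply/funext => z.
by have := is_derive_tensor_y a (db z.2) => ?; exact: derive_val.
Qed.

Lemma of_class_tensor (a b : R -> R) k : smooth a -> smooth b ->
  of_class k (fun z : R * R => a z.1 * b z.2).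
Proof.
have c12 (f g : R -> R) : continuous f -> continuous g ->
    continuous (fun z : R * R => f z.1 * g z.2).
  move=> cf cg z; apply: cvgM.
  - by apply: (cvg_comp fst f); [exact: cvg_fst|exact: cf].
  - by apply: (cvg_comp snd g); [exact: cvg_snd|exact: cg].
elim: k a b => [|k IH] a b sa sb /=.
  by apply: c12; exact: smooth_continuous.
have [sa' da] := smooth_derive sa; have [sb' db] := smooth_derive sb.
split; first by apply: c12; exact: smooth_continuous.
- move=> z; have [? _] := is_derive_tensor_x b (da z.1).
  by have [? _] := is_derive_tensor_y a (db z.2).
- by rewrite derive_tensor_x//; exact: IH.
- by rewrite derive_tensor_y//; exact: IH.
Qed.

Lemma test_function_tensor (a b : R -> R) (a1 a2 b1 b2 : R) : smooth a -> smooth b ->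
  (forall x, x \notin `]a1, a2[ -> a x = 0) -> (forall y, y \notin `]b1, b2[ -> b y = 0) ->
  test_function (fun z : R * R => a z.1 * b z.2).
Proof.
move=> sa sb a0 b0; split; first by move=> k; exact: of_class_tensor.
have cK : compact (`[a1, a2]%classic `*` `[b1, b2]%classic).
  by apply: compact_setX; exact: segment_compact.
apply: (subclosed_compact _ cK); first exact: closed_closure.
have -> : `[a1, a2]%classic `*` `[b1, b2]%classic = closure (`[a1, a2]%classic `*` `[b1, b2]%classic).
  apply/closure_id; apply: compact_closed => //.
apply: closure_subset => -[x y] /=; rewrite mulf_eq0 negb_or => /andP[ax bx].
split => /=; apply: subset_itv_oo_cc; rewrite /=; apply/negPn/negP => h.
  by move: ax; rewrite a0 ?eqxx.
by move: bx; rewrite b0 ?eqxx.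
Qed.

End Flat.

(** * Absolute continuity on lines *)

Section OneDim.
Context {R : realType}.
Notation leb := (@lebesgue_measure R).

Lemma continuous_integrable_itv (F : R -> R) (a b : R) : continuous F ->
  leb.-integrable `[a, b] (EFin \o F).
Proof.
move=> cF; apply: continuous_compact_integrable; first exact: segment_compact.
exact: continuous_subspaceT.
Qed.

Lemma Rintegral_support (D : set R) (f : R -> R) :
  (forall x, ~ D x -> f x = 0) ->
  \int[leb]_x f x = \int[leb]_(x in D) f x.
Proof.
move=> f0; rewrite [RHS]Rintegral_mkcond; congr Rintegral; apply/funext => x.
rewrite patchE; case: ifPn => // /negP xD; apply: f0 => Dx.
by apply: xD; rewrite inE.
Qed.

Lemma Rintegral_spike (c : R) n :
  \int[leb]_(x in `[c, c + n.+1%:R^-1]) spike c n x = 1.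
Proof.
have cc : c < c + n.+1%:R^-1 by rewrite ltrDl invr_gt0 ltr0n.
rewrite /Rintegral (@continuous_FTC2 _ _ (fun y : R => step (n.+1%:R * (y - c)))) //.
- have -> : c + n.+1%:R^-1 - c = n.+1%:R^-1 by ring.
  by rewrite subrr mulr0 divff ?pnatr_eq0// [step 0]step0// step1// sube0.
- by apply: continuous_subspaceT; exact: spike_continuous.
- have dr x : derivable (fun y : R => step (n.+1%:R * (y - c))) x 1.
    by have [] := is_derive_ramp c n x.
  have cr : continuous (fun y : R => step (n.+1%:R * (y - c))).
    by move=> x; exact/differentiable_continuous/derivable1_diffP.
  split => //; first by apply: cvg_at_right_filter; exact: cr.
  by apply: cvg_at_left_filter; exact: cr.
- move=> x _; rewrite derive1E.
  by have := is_derive_ramp c n x => ?; exact: derive_val.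
Qed.

(** [spike c n] is a probability density on [c, c + 1/(n+1)], so the integral is a mean of [F]
    there. With [B] = F c this gives the limit, with [B] = 0 a bound uniform in n. *)
Lemma spike_mean (F : R -> R) (c : R) n (B e : R) : continuous F ->
  (forall x, c <= x <= c + n.+1%:R^-1 -> `|F x - B| <= e) ->
  `|\int[leb]_x (F x * spike c n x) - B| <= e.
Proof.
move=> cF Fe; set D := `[c, c + n.+1%:R^-1].
have cs : continuous (spike c n) by exact: spike_continuous.
have cM (f : R -> R) : continuous f -> continuous (fun x => f x * spike c n x).
  by move=> cf x; apply: cvgM; [exact: cf|exact: cs].
rewrite (@Rintegral_support [set` D]); last first.
  by move=> x /negP xD; rewrite spike_eq0 ?mulr0.
have -> : B = \int[leb]_(x in [set` D]) (B * spike c n x).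
  by rewrite RintegralZl// ?Rintegral_spike ?mulr1//; exact: continuous_integrable_itv.
rewrite -RintegralB//; last 2 first.
- by apply: continuous_integrable_itv; exact: cM.
- by apply: continuous_integrable_itv; apply: (cM (cst B)) => x; exact: cvg_cst.
have cd : continuous (fun x => F x * spike c n x - B * spike c n x).
  by move=> x; apply: cvgB; [exact: cM|apply: (cM (cst B)) => y; exact: cvg_cst].
apply: le_trans (le_normr_Rintegral _ _) _ => //.
  exact: continuous_integrable_itv.
rewrite -[leRHS]mulr1 -(Rintegral_spike c n) -RintegralZl//; last first.
  exact: continuous_integrable_itv.
apply: le_Rintegral => //.
- by apply: continuous_integrable_itv => x; apply: cvg_norm; exact: cd.
- by apply: continuous_integrable_itv; apply: (cM (cst e)) => x; exact: cvg_cst.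
- move=> x; rewrite /= in_itv/= => /Fe h.
  by rewrite -mulrBl normrM (ger0_norm (spike_ge0 _ _ _)) ler_wpM2r ?spike_ge0.
Qed.

Lemma spike_cvg (F : R -> R) (c : R) : continuous F ->
  \int[leb]_x (F x * spike c n x) @[n --> \oo] --> F c.
Proof.
move=> cF; apply/cvgrPdist_le => e e0.
have /cvgrPdist_le/(_ _ e0)/nbhs_ballP[d /= d0 Hd] := cF c.
have [N _ HN] := near_infty_natSinv_lt (PosNum d0).
exists N => // n /HN/= nd; rewrite distrC; apply: spike_mean => // x /andP[cx xc].
rewrite distrC; apply: Hd; rewrite /ball/= distrC ger0_norm ?subr_ge0//.
by rewrite ltrBlDl (le_lt_trans xc)// ltrD2l.
Qed.

(** By Lebesgue differentiation [k] is almost everywhere the derivative of its primitive, which is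
    0. The primitives start at the points -n, and countably many of them cover the line. *)
Lemma ae_eq0_of_integral_itv (k : R -> R) : locally_integrable setT k ->
  (forall a b, a <= b -> \int[leb]_(x in `]a, b]) k x = 0) ->
  {ae leb, forall x, k x = 0}.
Proof.
move=> lk k0.
have ik a b : leb.-integrable `[a, b] (EFin \o k).
  case: lk => mk _ lk; apply/integrableP; split.
    by apply/measurable_EFinP; exact: measurable_funTS.
  by apply: lk => //; exact: segment_compact.
have H (n : nat) : {ae leb, forall x, - n%:R < x -> k x = 0}.
  have /= := @FTC1 R k (BRight (- n%:R)) _ lk.
  have ik' y : leb.-integrable `]- n%:R, y] (EFin \o k).
    by apply: integrableS (ik (- n%:R) y) => //; exact: subset_itv_oc_cc.
  move=> /(_ ik'); apply: filterS; first exact: (ae_filter_ringOfSetsType leb).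
  move=> x + nx; rewrite lte_fin => /(_ nx) [_ <-].
  apply: (@derive1_eq0_near _ _ 0); near=> y; apply: k0.
  by apply: ltW; near: y; exact: lt_nbhsr.
have : {ae leb, forall x, forall n : nat, - n%:R < x -> k x = 0}.
  exact: ae_foralln.
apply: filterS; first exact: (ae_filter_ringOfSetsType leb).
move=> x /(_ (Num.truncn `|x|).+1); apply.
rewrite ltrNl (le_lt_trans _ (truncnS_gt _))// -normrN ler_norm.
Unshelve. all: by end_near. Qed.

Lemma le_truncS_bound (x : R) : - (Num.truncn `|x|).+1%:R < x < (Num.truncn `|x|).+1%:R.
Proof. by rewrite -ltr_norml truncnS_gt. Qed.

End OneDim.

Section ACL.
Context {R : realType}.
Notation leb := (@lebesgue_measure R).
Notation area := (@area R).

Lemma abs_bounds (x : R) : [/\ - `|x| <= x, x <= `|x| & 0 <= `|x|].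
Proof. by rewrite ler_norm normr_ge0 lerNl -normrN ler_norm. Qed.

Lemma continuous_measurable2 (F : R * R -> R) : continuous F -> measurable_fun setT F.
Proof.
move=> cF; apply: (measurability _ (RGenOInfty.measurableE R)) => // _ [_ [x ->] <-].
rewrite setTI; apply: measurable_open2; apply: open_comp => //; exact: interval_open.
Qed.

Lemma area_box_lty N : (area (box N) < +oo)%E.
Proof.
rewrite /area /box product_measure1E//; apply: lte_mul_pinfty => //.
  by rewrite ge0_fin_numE//= lebesgue_measure_itv/=; case: ifP => _; rewrite -?EFinB ltry.
by rewrite /= lebesgue_measure_itv/=; case: ifP => _; rewrite -?EFinB ltry.
Qed.

Lemma continuous_integrable_box (F : R * R -> R) N : continuous F ->
  (forall z, ~ box N z -> F z = 0) -> area.-integrable setT (EFin \o F).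
Proof.
move=> cF F0.
have -> : EFin \o F = (EFin \o F) \_ (box N).
  apply/funext => z; rewrite patchE; case: ifPn => // /negP zN.
  by rewrite /= F0// => zN'; apply: zN; rewrite inE.
apply: (@integrable_mkcond _ _ _ (leb \x leb)%E (box N) (EFin \o F) (measurable_box N)).1.
apply: measurable_bounded_integrable.
- exact: measurable_box.
- exact: area_box_lty.
- exact: measurable_funTS (continuous_measurable2 cF).
- have cK : compact (F @` box N).
    by apply: continuous_compact (@compact_box _ N); exact: continuous_subspaceT.
  have [M [Mr HM]] := compact_bounded cK; exists M; split => // x Mx z zN.
  by apply: (HM _ Mx); exists z.
Qed.

Lemma EFin_Rintegral d (T : measurableType d) (m : {measure set T -> \bar R}) (D : set T) (f : T -> R) :
  measurable D -> m.-integrable D (EFin \o f) ->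
  (\int[m]_(x in D) (f x)%:E = (\int[m]_(x in D) f x)%:E)%E.
Proof. by move=> mD fi; rewrite /Rintegral fineK//; exact: integrable_fin_num. Qed.

Lemma continuous_pairl (y : R) : continuous (fun x : R => (x, y)).
Proof. by move=> x; exact: (cvg_pair cvg_id (cvg_cst _)). Qed.

Lemma continuous_pairr (x : R) : continuous (fun y : R => (x, y)).
Proof. by move=> y; exact: (cvg_pair (cvg_cst _) cvg_id). Qed.

Lemma integrable_indicM d (T : measurableType d) (m : {measure set T -> \bar R}) (D : set T) (f : T -> R) :
  measurable D -> m.-integrable D (EFin \o f) ->
  m.-integrable setT (EFin \o (fun x => \1_D x * f x)).
Proof.
move=> mD iD; rewrite (_ : EFin \o _ = (EFin \o f) \_ D); first exact/(integrable_mkcond _ mD).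
apply/funext => x; rewrite patchE /= indicE; case: ifPn => _; first by rewrite mul1r.
by rewrite mul0r.
Qed.

Lemma Rintegral_indicM d (T : measurableType d) (m : {measure set T -> \bar R}) (D : set T) (f : T -> R) :
  \int[m]_x (\1_D x * f x) = \int[m]_(x in D) f x.
Proof.
rewrite [RHS]Rintegral_mkcond; congr Rintegral; apply/funext => x; rewrite patchE indicE.
by case: ifPn => _; rewrite ?mul1r ?mul0r.
Qed.

Lemma continuous_integrable_supp (F : R -> R) (a b : R) : continuous F ->
  (forall x, x \notin `[a, b] -> F x = 0) -> leb.-integrable setT (EFin \o F).
Proof.
move=> cF F0; rewrite (_ : F = (fun x => \1_(`[a, b]%classic) x * F x)).
  by apply: integrable_indicM => //; exact: continuous_integrable_itv.
apply/funext => x; rewrite indicE mem_setE; have [_|xab] := boolP (x \in `[a, b]).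
  by rewrite mul1r.
by rewrite F0// mul0r.
Qed.

(** The outer maximum keeps the endpoints in order when the two intervals are disjoint, as the
    condition a <= b in the vanishing of the integrals demands. *)
Lemma itv_oc_meet (a b n x : R) :
  x \in `](Num.max a (- n)), (Num.max (Num.max a (- n)) (Num.min b n))] =
  (x \in `]a, b]) && (x \in `]- n, n]).
Proof.
rewrite !in_itv/= gt_max !le_max le_min.
by case: (ltP a x) => ax; case: (ltP (-n) x) => nx; case: (leP x b) => //= xb; case: (leP x n) => xn //=.
Qed.

Lemma ae_eq0_of_integral_indic (k : R -> R) :
  (forall a b : R, leb.-integrable setT (EFin \o (fun x => \1_(`]a, b]%classic) x * k x))) ->
  (forall a b : R, a <= b -> \int[leb]_x (\1_(`]a, b]%classic) x * k x) = 0) ->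
  {ae leb, forall x, k x = 0}.
Proof.
move=> ik k0.
have inE' (a b x : R) : (x \in `]a, b]%classic) = (x \in `]a, b]) by rewrite mem_setE.
have H (n : nat) : {ae leb, forall x, \1_(`]- n%:R, n%:R]%classic) x * k x = 0}.
  apply: ae_eq0_of_integral_itv.
    apply: open_integrable_locally; first exact: openT.
    exact: ik.
  move=> a b ab; rewrite Rintegral_mkcond.
  rewrite -[RHS](k0 (Num.max a (- n%:R)) (Num.max (Num.max a (- n%:R)) (Num.min b n%:R))); last first.
    by rewrite le_max lexx.
  congr Rintegral; apply/funext => x; rewrite patchE !indicE !inE' itv_oc_meet.
  by case: ifPn => //=; rewrite mul0r.
have : {ae leb, forall x, forall n : nat, \1_(`]- n%:R, n%:R]%classic) x * k x = 0}.
  exact: ae_foralln.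
apply: filterS; first exact: (ae_filter_ringOfSetsType leb).
move=> x /(_ (Num.truncn `|x|).+1); rewrite indicE inE' in_itv/=.
by have /andP[-> /ltW ->] := le_truncS_bound x; rewrite mul1r.
Qed.

Lemma ae_imp (P Q : R -> Prop) : {ae leb, forall y, P y} -> (forall y, P y -> Q y) ->
  {ae leb, forall y, Q y}.
Proof.
by move=> aP PQ; move: aP; apply: filterS; first exact: (ae_filter_ringOfSetsType leb).
Qed.

Lemma integrable_fubini_y (f : R * R -> \bar R) : area.-integrable setT f ->
  leb.-integrable setT (fun y => \int[leb]_x f (x, y))%E.
Proof.
move=> fi; have mf : measurable_fun setT f := measurable_int _ fi.
apply/integrableP; split; first exact: (measurable_fubini_G (m2 := leb) fi).
have := (@integrable21ltyP _ _ _ _ _ leb leb f mf).1 fi; apply: le_lt_trans.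
apply: ge0_le_integral => //.
- by apply: measurableT_comp => //; exact: (measurable_fubini_G (m2 := leb) fi).
- apply: (measurable_fun_fubini_tonelli_G (m1 := leb) (fun z => `|f z|%E)) => //.
  exact: measurableT_comp.
- by move=> y _; apply: le_abse_integral => //; exact: measurable_fun_pair1.
Qed.

(** The inner integral is finite only for almost every y; elsewhere [Rintegral] returns the default
    value 0, and this affects neither integrability nor the integral. *)
Lemma Rintegral_fubini_y (f : R * R -> R) : area.-integrable setT (EFin \o f) ->
  leb.-integrable setT (EFin \o (fun y => \int[leb]_x f (x, y))) /\
  \int[area]_z f z = \int[leb]_y \int[leb]_x f (x, y).
Proof.
move=> fi; have iG := integrable_fubini_y fi.
have mG := measurable_int _ iG.
have mR : measurable_fun setT (EFin \o (fun y => \int[leb]_x f (x, y))).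
  by apply/measurable_EFinP; apply: (measurableT_comp _ mG); exact: fine_measurable.
split.
  apply: le_integrable iG => // y _.
  rewrite /= /Rintegral; set I := (\int[leb]_x _)%E; have := leey `|I|%E.
  by case: I => [r||] //= _; rewrite ?normr0 ?lexx ?leey.
rewrite /Rintegral; congr fine.
rewrite -(@integral21_prod_meas1 _ _ _ _ _ leb leb _ fi).
apply: ae_eq_integral => //.
have h : {ae leb, forall y, setT y -> (\int[leb]_x (f (x, y))%:E)%E \is a fin_num}.
  exact: (integrable_ae measurableT iG).
by apply: (ae_imp h) => y /(_ I) hy _; rewrite /= fineK.
Qed.

(* u is absolutely continuous with derivative g, tested against all slopes m; the right-hand side
   may be infinite. *)
Definition ac_line (u g : R -> R) := forall s1 s2 m : R, s1 <= s2 ->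
  (`|u s2 - u s1 - m * (s2 - s1)|%:E <= \int[leb]_(x in `[s1, s2]) `|g x - m|%:E)%E.

Section Lines.
Variables (u g : R * R -> R).
Hypothesis cu : continuous u.
Hypothesis lg : loc_integrable g.
(** Tested on tensor products only and free of [dirx], so that the section applies as well to
    functions with exchanged coordinates. *)
Hypothesis weak : forall a b : R -> R, smooth a -> smooth b ->
  forall N : R, (forall x, x \notin `]- N, N[ -> a x = 0) -> (forall y, y \notin `]- N, N[ -> b y = 0) ->
  \int[area]_z (u z * (derive1 a z.1 * b z.2)) = - \int[area]_z (g z * (a z.1 * b z.2)).

Lemma integrable_rect (s1 s2 p1 p2 : R) : area.-integrable setT
  (EFin \o (fun z => \1_(`]p1, p2]%classic) z.2 * (\1_(`]s1, s2]%classic) z.1 * g z))).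
Proof.
pose D : set (R * R) := `]s1, s2]%classic `*` `]p1, p2]%classic.
have mD : measurable D by exact: measurableX.
rewrite (_ : (fun z => _) = (fun z => \1_D z * g z)); last first.
  apply/funext => -[x y]; rewrite mulrA; congr (_ * _).
  rewrite !indicE /D -natrM mulnb; congr (nat_of_bool _)%:R.
  by apply/andP/idP; rewrite !inE => -[].
apply: (@integrable_indicM _ _ (leb \x leb)%E) => //.
have := loc_integrable_box (`|s1| + `|s2| + `|p1| + `|p2|) lg.
apply: integrableS => //; first exact: measurable_box.
have := ler_norm s1; have := ler_norm (- s1); have := ler_norm p1; have := ler_norm (- p1).
have := ler_norm s2; have := ler_norm (- s2).
have := ler_norm p2; have := ler_norm (- p2); rewrite !normrN => *.
have := normr_ge0 s1; have := normr_ge0 p1; have := normr_ge0 p2; have := normr_ge0 s2 => *.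
move=> -[x y] [] /=; rewrite !in_itv/= => /andP[? ?] /andP[? ?].
by split; rewrite /= in_itv/=; apply/andP; split; lra.
Qed.

Lemma continuous_linex y : continuous (fun x => u (x, y)).
Proof.
by move=> x; apply: (cvg_comp (fun x => (x, y)) u); [exact: continuous_pairl|exact: cu].
Qed.

Lemma continuous_liney x : continuous (fun y => u (x, y)).
Proof.
by move=> y; apply: (cvg_comp (fun y => (x, y)) u); [exact: continuous_pairr|exact: cu].
Qed.

Lemma integrable_line_indic (c p1 p2 : R) :
  leb.-integrable setT (EFin \o (fun y => \1_(`]p1, p2]%classic) y * u (c, y))).
Proof.
apply: integrable_indicM => //.
have h : leb.-integrable `[p1, p2] (EFin \o (fun y => u (c, y))).
  by apply: continuous_integrable_itv; exact: continuous_liney.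
by apply: (integrableS _ _ _ h) => //; exact: subset_itv_oc_cc.
Qed.

Section SpikeTent.
Variables (c p1 p2 N : R).
Hypothesis p12 : p1 <= p2.
(** [box N] contains the supports for every n: the spike ends no later than c + 1, the tent no later
    than p2 + 1. *)
Hypothesis HN : 1 + `|c| + 1 + `|p1| + `|p2| <= N.

Let F n (z : R * R) := u z * (spike c n z.1 * tent p1 p2 n z.2).

Let cF n : continuous (F n).
Proof.
move=> z; apply: cvgM; first exact: cu.
apply: cvgM.
  by apply: (cvg_comp fst (spike c n)); [exact: cvg_fst|exact: spike_continuous].
apply: (cvg_comp snd (tent p1 p2 n)); first exact: cvg_snd.
exact/smooth_continuous/smooth_tent.
Qed.

Let n1 n : n.+1%:R^-1 <= 1 :> R. Proof. by rewrite invf_le1 ?ler1n. Qed.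

Let xN n (x : R) : x \in `[c, c + n.+1%:R^-1] -> - N <= x <= N.
Proof.
have HN' := HN; have := n1 n; have [? ? ?] := abs_bounds c; have [? ? ?] := abs_bounds p1.
have [? ? ?] := abs_bounds p2; rewrite in_itv/= => nn /andP[? xc].
have xc1 : x <= c + 1 by apply: le_trans xc _; rewrite lerD2l.
by apply/andP; split; lra.
Qed.

Let yN (y : R) : y \in `]p1, p2 + 1[ -> - N <= y <= N.
Proof.
have HN' := HN; have [? ? ?] := abs_bounds c; have [? ? ?] := abs_bounds p1.
have [? ? ?] := abs_bounds p2; rewrite in_itv/= => /andP[? ?].
by apply/andP; split; lra.
Qed.

Let supp n x y : ~ box N (x, y) -> spike c n x * tent p1 p2 n y = 0.
Proof.
move=> h; have [xc|xc] := boolP (x \in `[c, c + n.+1%:R^-1]); last by rewrite spike_eq0 ?mul0r.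
have [yp|yp] := boolP (y \in `]p1, p2 + 1[); last by rewrite tent_eq0 ?mulr0.
by exfalso; apply: h; split; rewrite /= in_itv/=; [exact: xN xc|exact: yN].
Qed.

Lemma integrable_spike_tent n : area.-integrable setT (EFin \o F n).
Proof.
have := @continuous_integrable_box (F n) N (@cF n); apply => -[x y] zN.
by rewrite /F /= supp ?mulr0.
Qed.

Let H n y := \int[leb]_x (u (x, y) * spike c n x).

Let inner n y : (\int[leb]_x (F n (x, y))%:E)%E = (tent p1 p2 n y * H n y)%:E.
Proof.
have ci : leb.-integrable setT (EFin \o (fun x => u (x, y) * spike c n x)).
  apply: (@continuous_integrable_supp _ c (c + n.+1%:R^-1)).
    by move=> x; apply: cvgM; [exact: continuous_linex|exact: spike_continuous].
  by move=> x xc; rewrite spike_eq0 ?mulr0.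
rewrite -RintegralZl// -EFin_Rintegral//; last exact: (integrableZl measurableT (tent p1 p2 n y) ci).
by apply: eq_integral => x _; rewrite /F /=; congr EFin; ring.
Qed.

Let outer n : \int[area]_z F n z = \int[leb]_y (tent p1 p2 n y * H n y).
Proof.
rewrite /Rintegral; congr fine.
have := @integral21_prod_meas1 _ _ _ _ _ leb leb _ (integrable_spike_tent n).
move=> <-; apply: eq_integral => y _; exact: inner.
Qed.

Let mH n : measurable_fun setT (fun y => tent p1 p2 n y * H n y).
Proof.
apply/measurable_EFinP.
have := @measurable_fubini_G _ _ _ _ _ leb leb _ (integrable_spike_tent n).
by congr measurable_fun; apply/funext => y; exact: inner.
Qed.

Let bound : exists M, forall n y, `|tent p1 p2 n y * H n y| <= \1_(`[- N, N]%classic) y * M.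
Proof.
have cK : compact (u @` box N).
  by apply: continuous_compact (@compact_box _ N); exact: continuous_subspaceT.
have [M [Mr HM]] := compact_bounded cK; exists (M + 1) => n y.
rewrite indicE mem_setE; have [yp|yp] := boolP (y \in `]p1, p2 + 1[); last first.
  rewrite tent_eq0// mul0r normr0 mulr_ge0//.
  have B0 : box N (0, 0).
    have HN' := HN; have [? ? ?] := abs_bounds c; have [? ? ?] := abs_bounds p1; have [? ? ?] := abs_bounds p2.
    by split; rewrite /= in_itv/=; apply/andP; split; lra.
  have M1 : M < M + 1 by rewrite ltrDl.
  apply: le_trans (HM _ M1 (u (0, 0)) _); first exact: normr_ge0.
  by exists (0, 0).
have yNN := yN yp; rewrite in_itv/= yNN mul1r normrM -[leRHS]mul1r.
apply: ler_pM => //; first by rewrite ger0_norm ?tent_ge0// tent_le1.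
rewrite -[H n y]subr0; apply: (@spike_mean _ (fun x => u (x, y)) c n 0 (M + 1)) => [|x xc]; first exact: continuous_linex.
rewrite subr0; apply: (HM (M + 1)); first by rewrite ltrDl.
exists (x, y) => //; split; rewrite /= in_itv//=.
by apply: (@xN n); rewrite in_itv.
Qed.

(** Integrating in x first, the spike turns u (x, y) into a mean that is bounded uniformly in n and
    tends to u (c, y); dominated convergence in y follows. *)
Lemma spike_tent_cvg :
  \int[area]_z (u z * (spike c n z.1 * tent p1 p2 n z.2)) @[n --> \oo] -->
  \int[leb]_y (\1_(`]p1, p2]%classic) y * u (c, y)).
Proof.
have lim y : tent p1 p2 n y * H n y @[n --> \oo] --> (\1_(`]p1, p2]%classic) y * u (c, y)).
  by apply: cvgM; [exact: tent_cvg|apply: (@spike_cvg _ (fun x => u (x, y)) c); exact: continuous_linex].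
have [M HM] := bound.
rewrite (_ : (fun n => _) = (fun n => \int[leb]_y (tent p1 p2 n y * H n y))); last first.
  by apply/funext => n; exact: outer.
apply: fine_cvg; rewrite fineK; last exact: integrable_fin_num (integrable_line_indic _ _ _).
apply: (@dominated_cvg _ _ _ leb setT measurableT _ _ (EFin \o (fun y => \1_(`[- N, N]%classic) y * M))).
- by move=> n; apply/measurable_EFinP; exact: mH.
- by move=> y _; apply: cvg_EFin; [exact: nearW|exact: lim].
- by [].
- apply: integrable_indicM => //; apply: continuous_integrable_itv => x; exact: cvg_cst.
- by move=> n y _; rewrite lee_fin; exact: HM.
Qed.

End SpikeTent.

(** A product of two tents is a test function whose x-derivative is the spike at s1 minus the spike
    at s2, times a tent. In the limit its weak identity becomes the fundamental theorem of calculus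
    integrated over a rectangle. *)
Lemma rect_identity (s1 s2 p1 p2 : R) : s1 <= s2 -> p1 <= p2 ->
  \int[leb]_y (\1_(`]p1, p2]%classic) y * u (s2, y)) -
  \int[leb]_y (\1_(`]p1, p2]%classic) y * u (s1, y)) =
  \int[area]_z (\1_(`]p1, p2]%classic) z.2 * (\1_(`]s1, s2]%classic) z.1 * g z)).
Proof.
move=> s12 p12.
pose N := 1 + (`|s1| + `|s2|) + 1 + `|p1| + `|p2|.
have [? ? ?] := abs_bounds s1; have [? ? ?] := abs_bounds s2.
have [? ? ?] := abs_bounds p1; have [? ? ?] := abs_bounds p2.
have N1 : 1 + `|s1| + 1 + `|p1| + `|p2| <= N by rewrite /N; lra.
have N2 : 1 + `|s2| + 1 + `|p1| + `|p2| <= N by rewrite /N; lra.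
have L1 := spike_tent_cvg p12 N1; have L2 := spike_tent_cvg p12 N2.
have z1 n x : x \notin `]- N, N[ -> tent s1 s2 n x = 0.
  move=> xN; apply: tent_eq0 => //; apply: contra xN; rewrite !in_itv/= => /andP[? ?].
  by apply/andP; split; rewrite /N; lra.
have z2 n x : x \notin `]- N, N[ -> tent p1 p2 n x = 0.
  move=> xN; apply: tent_eq0 => //; apply: contra xN; rewrite !in_itv/= => /andP[? ?].
  by apply/andP; split; rewrite /N; lra.
have E n : \int[area]_z (u z * (spike s1 n z.1 * tent p1 p2 n z.2)) -
    \int[area]_z (u z * (spike s2 n z.1 * tent p1 p2 n z.2)) =
    - \int[area]_z (g z * (tent s1 s2 n z.1 * tent p1 p2 n z.2)).
  rewrite -(weak (smooth_tent _ _ _) (smooth_tent _ _ _) (z1 n) (z2 n)).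
  have := @RintegralB _ _ _ (leb \x leb)%E setT _ _ measurableT (integrable_spike_tent p12 N1 n) (integrable_spike_tent p12 N2 n).
  move=> <-; congr Rintegral; apply/funext => z; rewrite derive1_tent; ring.
have tc (z : R * R) : g z * (tent s1 s2 n z.1 * tent p1 p2 n z.2) @[n --> \oo] -->
    (\1_(`]p1, p2]%classic) z.2 * (\1_(`]s1, s2]%classic) z.1 * g z) : R).
  have -> : \1_(`]p1, p2]%classic) z.2 * (\1_(`]s1, s2]%classic) z.1 * g z) =
     g z * (\1_(`]s1, s2]%classic) z.1 * \1_(`]p1, p2]%classic) z.2) :> R by ring.
  apply: cvgM; first exact: cvg_cst.
  by apply: cvgM; exact: tent_cvg.
have L : \int[area]_z (g z * (tent s1 s2 n z.1 * tent p1 p2 n z.2)) @[n --> \oo] -->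
    \int[area]_z (\1_(`]p1, p2]%classic) z.2 * (\1_(`]s1, s2]%classic) z.1 * g z)).
  apply: fine_cvg; rewrite fineK; last exact: integrable_fin_num (integrable_rect _ _ _ _).
  have mg : measurable_fun setT g by case: lg.
  apply: (@dominated_cvg _ _ _ (leb \x leb)%E setT measurableT _ _ (EFin \o (fun z => \1_(box N) z * `|g z|))).
  - move=> n; apply/measurable_EFinP; apply: measurable_funM => //.
    have -> : (fun z : R * R => tent s1 s2 n z.1 * tent p1 p2 n z.2) = (tent s1 s2 n \o fst) \* (tent p1 p2 n \o snd) by [].
    by apply: measurable_funM; apply: continuous_measurable2 => z;
      (apply: continuous_comp; [exact: cvg_fst||exact: cvg_snd|exact/smooth_continuous/smooth_tent]).
  - by move=> z _; apply: cvg_EFin; [exact: nearW|exact: tc].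
  - by [].
  - apply: (@integrable_indicM _ _ (leb \x leb)%E); first exact: measurable_box.
    by apply: integrable_norm; exact: loc_integrable_box.
  - move=> n [x y] _; rewrite lee_fin /= indicE.
    have [/= zN|zN] := boolP ((x, y) \in box N).
      rewrite mul1r normrM ler_piMr// normrM mulr_ile1// ger0_norm ?tent_ge0 ?tent_le1//.
    rewrite mul0r normr_le0; apply/eqP; apply: contraNeq zN => h; rewrite inE.
    by split; apply: subset_itv_oo_cc; rewrite /=; apply/negPn/negP => /[dup] hx;
      [move/(z1 n)|move/(z2 n)] => e0; move: h; rewrite e0 ?mul0r ?mulr0 eqxx.
have : \int[area]_z (u z * (spike s1 n z.1 * tent p1 p2 n z.2)) -
    \int[area]_z (u z * (spike s2 n z.1 * tent p1 p2 n z.2)) @[n --> \oo] -->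
  \int[leb]_y (\1_(`]p1, p2]%classic) y * u (s1, y)) -
  \int[leb]_y (\1_(`]p1, p2]%classic) y * u (s2, y)) by exact: cvgB.
under eq_fun do rewrite E.
move=> L'.
have := cvg_lim (@Rhausdorff R) L'; rewrite (cvg_lim (@Rhausdorff R) (cvgN L)).
by move=> e; apply/eqP; rewrite -eqr_opp opprB e.
Qed.

Lemma rect_line (s1 s2 p1 p2 : R) y :
  \int[leb]_x (\1_(`]p1, p2]%classic) y * (\1_(`]s1, s2]%classic) x * g (x, y))) =
  \1_(`]p1, p2]%classic) y * \int[leb]_(x in `]s1, s2]) g (x, y).
Proof.
have -> : \int[leb]_(x in `]s1, s2]) g (x, y) = \int[leb]_x (\1_(`]s1, s2]%classic) x * g (x, y)).
  by rewrite Rintegral_indicM.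
rewrite [\1_(`]p1, p2]%classic) y]indicE; case: (y \in _).
  by rewrite [RHS]mul1r; congr Rintegral; apply/funext => x; rewrite [LHS]mul1r.
rewrite [RHS]mul0r (_ : (fun x => _) = cst 0); first by rewrite /Rintegral integral0.
by apply/funext => x; rewrite [LHS]mul0r.
Qed.

Lemma integrable_rect_line (s1 s2 p1 p2 : R) : leb.-integrable setT
  (EFin \o (fun y => \1_(`]p1, p2]%classic) y * \int[leb]_(x in `]s1, s2]) g (x, y))).
Proof.
rewrite (_ : (fun y => _) = (fun y => \int[leb]_x (\1_(`]p1, p2]%classic) y * (\1_(`]s1, s2]%classic) x * g (x, y))))).
  by have [] := Rintegral_fubini_y (integrable_rect s1 s2 p1 p2).
by apply/funext => y; rewrite rect_line.
Qed.

Lemma rect_identity_line (s1 s2 p1 p2 : R) :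
  \int[area]_z (\1_(`]p1, p2]%classic) z.2 * (\1_(`]s1, s2]%classic) z.1 * g z)) =
  \int[leb]_y (\1_(`]p1, p2]%classic) y * \int[leb]_(x in `]s1, s2]) g (x, y)).
Proof.
have [_ ->] := Rintegral_fubini_y (integrable_rect s1 s2 p1 p2).
by congr Rintegral; apply/funext => y; rewrite rect_line.
Qed.

(** In [rect_identity] the interval ]p1, p2] is arbitrary, so the difference of the two sides, as a
    function of y, has integral 0 on every interval. *)
Lemma ae_line_increment (s1 s2 : R) : s1 <= s2 ->
  {ae leb, forall y, u (s2, y) - u (s1, y) = \int[leb]_(x in `]s1, s2]) g (x, y)}.
Proof.
move=> s12.
have := @ae_eq0_of_integral_indic (fun y => u (s2, y) - u (s1, y) - \int[leb]_(x in `]s1, s2]) g (x, y)).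
have ilD a b : leb.-integrable setT (EFin \o (fun y => \1_(`]a, b]%classic) y * u (s2, y) - \1_(`]a, b]%classic) y * u (s1, y))).
  by apply: (integrableB measurableT (integrable_line_indic _ _ _) (integrable_line_indic _ _ _)).
have E a b : (fun y => \1_(`]a, b]%classic) y * (u (s2, y) - u (s1, y) - \int[leb]_(x in `]s1, s2]) g (x, y))) =
    (fun y => \1_(`]a, b]%classic) y * u (s2, y) - \1_(`]a, b]%classic) y * u (s1, y) -
              \1_(`]a, b]%classic) y * \int[leb]_(x in `]s1, s2]) g (x, y)).
  by apply/funext => y; rewrite !mulrBr.
move=> H.
have {}H : {ae leb, forall y, u (s2, y) - u (s1, y) - \int[leb]_(x in `]s1, s2]) g (x, y) = 0}.
  apply: H => [a b|a b ab].
    rewrite E; exact: (integrableB measurableT (ilD a b) (integrable_rect_line _ _ _ _)).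
  rewrite E (RintegralB measurableT (ilD a b) (integrable_rect_line _ _ _ _)).
  rewrite (RintegralB measurableT (integrable_line_indic _ _ _) (integrable_line_indic _ _ _)).
  by rewrite rect_identity// rect_identity_line subrr.
move: H; apply: filterS; first exact: (ae_filter_ringOfSetsType leb).
by move=> y /eqP; rewrite subr_eq0 => /eqP.
Qed.

Lemma ae_line_integrable : {ae leb, forall y, forall n : nat,
  leb.-integrable `[- n%:R, n%:R] (EFin \o (fun x => g (x, y)))}.
Proof.
have A (n : nat) : {ae leb, forall y, \1_(`]- n.+1%:R, n.+1%:R]%classic) y != 0 :> R ->
    leb.-integrable `]- n.+1%:R, n.+1%:R] (EFin \o (fun x => g (x, y)))}.
  have h : {ae leb, forall y, leb.-integrable setT
      (fun x => (\1_(`]- n.+1%:R, n.+1%:R]%classic) y * (\1_(`]- n.+1%:R, n.+1%:R]%classic) x * g (x, y)))%:E)}.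
    exact: (@ae_integrable2 _ _ _ _ _ leb leb _ (integrable_rect (- n.+1%:R) n.+1%:R (- n.+1%:R) n.+1%:R)).
  apply: (ae_imp h) => y iy y0.
  have {y0} ey : \1_(`]- n.+1%:R, n.+1%:R]%classic) y = 1 :> R.
    by move: y0; rewrite indicE; case: (y \in _) => //; rewrite eqxx.
  apply/(integrable_mkcond _ _) => //.
  move: iy; rewrite ey; congr (integrable _ _ _); apply/funext => x.
  by rewrite mul1r patchE indicE; case: ifPn => _; rewrite ?mul1r ?mul0r.
have {}A : {ae leb, forall y, forall n : nat, \1_(`]- n.+1%:R, n.+1%:R]%classic) y != 0 :> R ->
    leb.-integrable `]- n.+1%:R, n.+1%:R] (EFin \o (fun x => g (x, y)))}.
  exact: ae_foralln.
apply: (ae_imp A) => y Ay n.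
have [m nm ym] : exists2 m, (n <= m)%N & y \in `]- m.+1%:R, m.+1%:R].
  have /andP[y1 y2] := le_truncS_bound y.
  exists (maxn n (Num.truncn `|y|)); first exact: leq_maxl.
  rewrite in_itv/=; apply/andP; split.
    by apply: le_lt_trans y1; rewrite lerN2 ler_nat ltnS leq_maxr.
  by apply/ltW; apply: lt_le_trans y2 _; rewrite ler_nat ltnS leq_maxr.
apply: (integrableS _ _ _ (Ay m _)) => //; last first.
  by rewrite indicE mem_setE ym oner_eq0.
move=> x /=; rewrite !in_itv/= => /andP[x1 x2]; apply/andP; split.
  by apply: lt_le_trans x1; rewrite ltrN2 ltr_nat ltnS.
by apply: (le_trans x2); rewrite ler_nat leqW.
Qed.

(** The null set of [ae_line_increment] depends on the endpoints. A common one is obtained for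
    rational endpoints and base points -n; both sides are continuous in the endpoint, hence agree
    everywhere. *)
Lemma ae_ac_line : {ae leb, forall y, ac_line (fun x => u (x, y)) (fun x => g (x, y))}.
Proof.
have A (n : nat) (q : rat) : {ae leb, forall y, - n%:R <= ratr q :> R ->
    u (ratr q, y) - u (- n%:R, y) = \int[leb]_(x in `]- n%:R, ratr q]) g (x, y)}.
  have [nq|nq] := leP (- n%:R) (ratr q : R); last by apply: (ae_imp (ae_line_increment (lexx 0))).
  by apply: (ae_imp (ae_line_increment nq)).
have B : {ae leb, forall y, forall (n m : nat) q, unpickle m = Some q -> - n%:R <= ratr q :> R ->
    u (ratr q, y) - u (- n%:R, y) = \int[leb]_(x in `]- n%:R, ratr q]) g (x, y)}.
  apply: ae_foralln => n; apply: ae_foralln => m.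
  case: (@unpickle rat m) => [q|]; last by apply: (ae_imp (ae_line_increment (lexx 0))).
  by apply: (ae_imp (A n q)) => y h q' [<-].
have C := ae_line_integrable.
(* Two almost sure properties are joined by a countable quantifier: [k] = 0 for the increments, [k]
   > 0 for integrability. *)
have {}B : {ae leb, forall y, forall k : nat, if k is O then (forall (n m : nat) q, unpickle m = Some q -> - n%:R <= ratr q :> R ->
    u (ratr q, y) - u (- n%:R, y) = \int[leb]_(x in `]- n%:R, ratr q]) g (x, y)) else
    (forall n : nat, leb.-integrable `[- n%:R, n%:R] (EFin \o (fun x => g (x, y))))}.
  by apply: ae_foralln => -[|k].
apply: (ae_imp B) => y {}B; have iy := B 1%N; have {}B := B 0%N.
move=> s1 s2 m s12.
have F (n : nat) s : - n.+1%:R <= s <= n.+1%:R ->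
    u (s, y) - u (- n.+1%:R, y) = \int[leb]_(x in `[- n.+1%:R, s]) g (x, y).
  move=> sn; pose N : R := n.+1%:R.
  have NN : - N < N by rewrite gtrN.
  have iN : leb.-integrable `[- N, N] (EFin \o (fun x => g (x, y))) by exact: iy.
  have iNs t : t <= N -> leb.-integrable `[- N, t] (EFin \o (fun x => g (x, y))).
    by move=> tN; apply: (integrableS _ _ _ iN) => //; exact: subset_itvl.
  have cG := parameterized_integral_continuous (ltW NN) iN.
  pose Phi t := u (t, y) - u (- N, y) - \int[leb]_(x in `[- N, t]) g (x, y).
  have cPhi : {within `[- N, N], continuous Phi}.
    move=> t; apply: (@cvgB _ _ _ _ _ (fun t => u (t, y) - u (- N, y))); last exact: cG.
      exact: nbhs_subspace_filter.
    have cu0 : continuous (fun t => u (t, y) - u (- N, y)).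
      by move=> x; apply: cvgB; [exact: continuous_linex|exact: cvg_cst].
    exact: (continuous_subspaceT cu0).
  have Phi0 q : - N <= ratr q <= N -> Phi (ratr q) = 0.
    move=> /andP[Nq qN]; rewrite /Phi (B n.+1 (pickle q) q)// ?pickleK//.
    rewrite Rintegral_itv_obnd_cbnd ?subrr//.
    by apply: (integrableS _ _ _ (iNs _ qN)) => //; exact: subset_itv_oc_cc.
  suff : Phi s = 0 by move=> /eqP; rewrite subr_eq0 => /eqP.
  (* By continuity a nonzero value at s would persist at a nearby rational, where [Phi] vanishes. *)
  apply/eqP; apply: contraT => Phis; have e0 : 0 < `|Phi s| by rewrite normr_gt0.
  have /subspace_continuousP/(_ s) cs := cPhi.
  have {cs} := cs _; rewrite /= in_itv/= => /(_ sn)/cvgrPdist_lt/(_ _ e0).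
  move=> /nbhs_ballP[d /= d0 Hd].
  have [/andP[sN1 sN2]] := sn.
  have : Num.max (- N) (s - d) < Num.min N (s + d).
    by rewrite gt_max !lt_min NN; apply/and3P; split; [rewrite /N; lra..].
  move=> /rat_in_itvoo[q]; rewrite in_itv/= gt_max lt_min => /andP[/andP[q1 q2] /andP[q3 q4]].
  have qd : ball s d (ratr q : R).
    by rewrite /ball/= ltr_norml; apply/andP; split; lra.
  have qN : ratr q \in `[- N, N] by rewrite in_itv/= (ltW q1) (ltW q3).
  have /= := Hd _ qd qN; rewrite /from_subspace Phi0 ?(ltW q1) ?(ltW q3)//.
  by rewrite subr0 ltxx.
have sub (n : nat) : leb.-integrable `[- n%:R, n%:R] (EFin \o (fun x => g (x, y))) by exact: iy.
pose n := maxn (Num.truncn `|s1|) (Num.truncn `|s2|).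
have /andP[a1 b1] := le_truncS_bound s1; have /andP[a2 b2] := le_truncS_bound s2.
have bn1 : (Num.truncn `|s1|).+1%:R <= n.+1%:R :> R by rewrite ler_nat ltnS leq_maxl.
have bn2 : (Num.truncn `|s2|).+1%:R <= n.+1%:R :> R by rewrite ler_nat ltnS leq_maxr.
have h1 : - n.+1%:R <= s1 by apply: le_trans (ltW a1); rewrite lerN2.
have h2 : s2 <= n.+1%:R by apply: le_trans (ltW b2) _.
have F1 := F n s1; rewrite h1 (le_trans s12 h2) in F1.
have F2 := F n s2; rewrite (le_trans h1 s12) h2 in F2.
have I2 : leb.-integrable `[- n.+1%:R, s2] (EFin \o (fun x => g (x, y))).
  by apply: (integrableS _ _ _ (sub n.+1)) => //; exact: subset_itvl.
have I12 : leb.-integrable `[s1, s2] (EFin \o (fun x => g (x, y))).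
  by apply: (integrableS _ _ _ I2) => //; exact: subset_itvr.
have I12o : leb.-integrable `]s1, s2] (EFin \o (fun x => g (x, y))).
  by apply: (integrableS _ _ _ I12) => //; exact: subset_itv_oc_cc.
have E : u (s2, y) - u (s1, y) = \int[leb]_(x in `[s1, s2]) g (x, y).
  rewrite -(Rintegral_itv_obnd_cbnd I12o) -(Rintegral_itvB (a := BLeft (- n.+1%:R)) I2) ?bnd_simp//.
  by rewrite -F1// -F2//; ring.
have Im : leb.-integrable `[s1, s2] (EFin \o (fun=> m)).
  by apply: continuous_integrable_itv => x; exact: cvg_cst.
have Em : m * (s2 - s1) = \int[leb]_(x in `[s1, s2]) m.
  rewrite Rintegral_cst//= lebesgue_measure_itv/= lte_fin; case: ltP => //= h.
  have -> : s2 = s1 by apply/eqP; rewrite eq_le h s12.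
  by rewrite subrr.
have Igm : leb.-integrable `[s1, s2] (EFin \o (fun x => g (x, y) - m)).
  exact: (integrableB _ I12 Im).
rewrite E Em -RintegralB// EFin_normr_Rintegral//.
by apply: le_abse_integral => //; exact: measurable_int Igm.
Qed.

End Lines.

Lemma weak_ac_x (u g : R * R -> R) : continuous u -> loc_integrable g ->
  weak_partial (dirx R) u g ->
  {ae leb, forall y, ac_line (fun x => u (x, y)) (fun x => g (x, y))}.
Proof.
move=> cu lg wp; apply: ae_ac_line => // a b sa sb N a0 b0.
have := wp _ (test_function_tensor sa sb a0 b0).
rewrite (_ : (fun z => u z * _) = (fun z => u z * (derive1 a z.1 * b z.2)))//.
by apply/funext => z; have := derive_tensor_x b sa => /(congr1 (fun h => h z)) /= ->.
Qed.

Lemma Rintegral_swap (F : R * R -> R) : measurable_fun setT F ->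
  \int[area]_z F (z.2, z.1) = \int[area]_z F z.
Proof.
move=> mF; rewrite /Rintegral -(@integral_swap _ (EFin \o F))//.
exact/measurable_EFinP.
Qed.

Lemma measurable_smooth_tensor (a b : R -> R) : smooth a -> smooth b ->
  measurable_fun setT (fun z : R * R => a z.1 * b z.2).
Proof. by move=> sa sb; apply: continuous_measurable2; exact: (of_class_tensor 0 sa sb). Qed.

Lemma weak_ac_y (u g : R * R -> R) : continuous u -> loc_integrable g ->
  weak_partial (diry R) u g ->
  {ae leb, forall x, ac_line (fun y => u (x, y)) (fun y => g (x, y))}.
Proof.
move=> cu lg wp; have mg : measurable_fun setT g by case: lg.
have := @ae_ac_line (fun z => u (z.2, z.1)) (fun z => g (z.2, z.1)); apply.
- move=> z; apply: (cvg_comp (fun z : R * R => (z.2, z.1)) u); last exact: cu.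
  by apply: (@cvg_pair _ _ _ _ (nbhs z.2) (nbhs z.1)); [exact: cvg_snd|exact: cvg_fst].
- exact: loc_integrable_swap.
move=> a b sa sb N a0 b0; have [sa' _] := smooth_derive sa.
have := wp _ (test_function_tensor sb sa b0 a0).
rewrite (_ : (fun z => u z * _) = (fun z => u z * (b z.1 * derive1 a z.2))); last first.
  by apply/funext => z; have := derive_tensor_y b sa => /(congr1 (fun h => h z)) /= ->.
have E1 := @Rintegral_swap (fun z => u z * (b z.1 * derive1 a z.2)) (measurable_funM
  (continuous_measurable2 cu) (measurable_smooth_tensor sb sa')).
have E2 := @Rintegral_swap (fun z => g z * (b z.1 * a z.2)) (measurable_funM
  mg (measurable_smooth_tensor sb sa)).
rewrite -E1 -E2 => E; transitivity (\int[area]_z (u (z.2, z.1) * (b z.2 * derive1 a z.1))).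
  by congr Rintegral; apply/funext => z; rewrite [derive1 a _ * _]mulrC.
by rewrite [LHS]E; congr (- _); congr Rintegral; apply/funext => z; rewrite [b _ * _]mulrC.
Qed.

End ACL.

(** * Choice of lines by Fubini and Chebyshev *)

Section Lines.
Context {R : realType}.
Notation leb := (@lebesgue_measure R).
Notation area := (@area R).

(** Otherwise T would exceed K at almost every point of ]p, q[, and its integral would be at least K
    (q - p) > M. *)
Lemma pick_point (T : R -> \bar R) (P : R -> Prop) (p q M K : R) : p < q ->
  (forall x, (0 <= T x)%E) -> measurable_fun setT T ->
  {ae leb, forall x, P x} ->
  (\int[leb]_(x in `]p, q[) T x <= M%:E)%E -> M < K * (q - p) ->
  exists x, [/\ p < x < q, P x & (T x <= K%:E)%E].
Proof.
move=> pq T0 mT aP TM MK; apply: contrapT => nE.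
have qp0 : 0 < q - p by rewrite subr_gt0.
have lpq : leb `]p, q[ = (q - p)%:E by rewrite lebesgue_measure_itv/= lte_fin pq -EFinB.
have M0 : 0 <= M by rewrite -lee_fin (le_trans _ TM)// integral_ge0.
have K0 : 0 < K by rewrite -(pmulr_lgt0 _ qp0) (le_lt_trans M0).
have : (\int[leb]_(x in `]p, q[) (cst K%:E x) <= \int[leb]_(x in `]p, q[) T x)%E.
  apply: ae_ge0_le_integral => //.
  - by move=> x _; rewrite lee_fin ltW.
  - exact: measurable_funTS.
  - apply: (ae_imp aP) => x Px; rewrite /= in_itv/= => xpq; rewrite leNgt; apply/negP => /ltW h.
    by apply: nE; exists x.
rewrite integral_cst// [X in (_ * X)%E]lpq -EFinM => /le_trans/(_ TM).
by rewrite lee_fin leNgt MK.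
Qed.

(** Half-open, to agree with the cells of the grids, which partition the plane. *)
Definition hrect (a b c d : R) : set (R * R) := `[a, b[%classic `*` `[c, d[%classic.

Lemma measurable_hrect a b c d : measurable (hrect a b c d).
Proof. exact: measurableX. Qed.

(** [pick_point] applied to the integrals of [D] over vertical lines; by Tonelli, their integral
    over ]p, q[ is at most that of [D] over the rectangle. *)
Lemma pick_vline (D : R * R -> R) (P : R -> Prop) (a b c d p q M K : R) :
  (forall z, 0 <= D z) -> measurable_fun setT D -> {ae leb, forall x, P x} ->
  (\int[area]_(z in hrect a b c d) (D z)%:E <= M%:E)%E ->
  a <= p -> p < q -> q <= b -> M < K * (q - p) ->
  exists x, [/\ p < x < q, P x & (\int[leb]_(y in `[c, d[) (D (x, y))%:E <= K%:E)%E].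
Proof.
move=> D0 mD aP DM ap pq qb MK.
pose F (z : R * R) : \bar R := (D z * \1_(`[c, d[%classic) z.2)%:E.
have F0 z : (0 <= F z)%E by rewrite lee_fin mulr_ge0.
have mF : measurable_fun setT F.
  apply/measurable_EFinP; apply: measurable_funM => //.
  by apply: (measurableT_comp (measurable_indic _)) => //.
have FE x : (\int[leb]_y F (x, y) = \int[leb]_(y in `[c, d[) (D (x, y))%:E)%E.
  rewrite [RHS]integral_mkcond; apply: eq_integral => y _.
  by rewrite /F patchE indicE/=; case: ifPn => _; rewrite ?mulr1 ?mulr0.
have mT : measurable_fun setT (fun x => \int[leb]_y F (x, y))%E.
  exact: (measurable_fun_fubini_tonelli_F (m2 := leb) F).
have TM : (\int[leb]_(x in `]p, q[) \int[leb]_y F (x, y) <= M%:E)%E.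
  apply: le_trans DM; rewrite [leRHS]integral_mkcond fubini_area_x; last 2 first.
  - by move=> z; rewrite patchE; case: ifPn => // _; rewrite lee_fin.
  - apply/(measurable_restrictT _ _).1; first exact: measurable_hrect.
    exact/measurable_EFinP/measurable_funTS.
  rewrite integral_mkcond; apply: ge0_le_integral => //.
  - by move=> x _; rewrite patchE; case: ifPn => // _; apply: integral_ge0.
  - by apply/(measurable_restrictT _ _).1 => //; exact: measurable_funTS.
  - apply: (measurable_fun_fubini_tonelli_F (m2 := leb) ((EFin \o D) \_ (hrect a b c d))).
      apply/(measurable_restrictT _ _).1; first exact: measurable_hrect.
      exact/measurable_EFinP/measurable_funTS.
    by move=> z; rewrite patchE; case: ifPn => // _; rewrite lee_fin.
  - move=> x _; rewrite patchE; case: ifPn => [|_].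
      rewrite inE/= in_itv/= => /andP[px xq]; rewrite le_eqVlt; apply/orP; left; apply/eqP.
      apply: eq_integral => y _; rewrite /F patchE indicE mem_setE/=.
      have -> : ((x, y) \in hrect a b c d) = (y \in `[c, d[).
        apply/idP/idP => [|yc]; first by rewrite inE => -[].
        by rewrite inE; split => //=; rewrite in_itv/= (le_trans ap (ltW px)) (lt_le_trans xq qb).
      by case: ifP => _; rewrite ?mulr1 ?mulr0.
    by apply: integral_ge0 => y _; rewrite patchE; case: ifPn => // _; rewrite lee_fin.
have T0 x : (0 <= \int[leb]_y F (x, y))%E by apply: integral_ge0.
have [x [xpq Px xK]] := pick_point pq T0 mT aP TM MK.
by exists x; split => //; rewrite -FE.
Qed.

Lemma pick_hline (D : R * R -> R) (P : R -> Prop) (a b c d p q M K : R) :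
  (forall z, 0 <= D z) -> measurable_fun setT D -> {ae leb, forall x, P x} ->
  (\int[area]_(z in hrect a b c d) (D z)%:E <= M%:E)%E ->
  c <= p -> p < q -> q <= d -> M < K * (q - p) ->
  exists y, [/\ p < y < q, P y & (\int[leb]_(x in `[a, b[) (D (x, y))%:E <= K%:E)%E].
Proof.
move=> D0 mD aP DM.
apply: (@pick_vline (fun z => D (z.2, z.1)) P c d a b) => //.
  exact: (measurableT_comp mD (@measurable_plane_swap R)).
apply: le_trans DM; rewrite integral_mkcond [leRHS]integral_mkcond.
rewrite -[leRHS]ge0_integral_swap; last 2 first.
- by move=> z; rewrite patchE; case: ifPn => // _; rewrite lee_fin.
- apply/(measurable_restrictT _ _).1; first exact: measurable_hrect.
  exact/measurable_EFinP/measurable_funTS.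
rewrite le_eqVlt; apply/orP; left; apply/eqP; apply: eq_integral => -[x y] _ /=.
rewrite !patchE; congr (if _ then _ else _).
by apply/idP/idP; rewrite !inE => -[].
Qed.

End Lines.

(** * Deviation from an affine map on good lines *)

Section Oscillation.
Context {R : realType}.
Notation leb := (@lebesgue_measure R).
Variables (f : R * R -> R * R) (Df : R * R -> 'M[R]_2).

(** Column 1 of [Df] is the y-derivative. The free slope in [ac_line] serves twice: it is an entry
    of a constant matrix in the area inequality, and 0 in the variation of the argument. *)
Definition good_vline x := ac_line (fun y => (f (x, y)).1) (fun y => Df (x, y) 0 1) /\
  ac_line (fun y => (f (x, y)).2) (fun y => Df (x, y) 1 1).

Definition good_hline y := ac_line (fun x => (f (x, y)).1) (fun x => Df (x, y) 0 0) /\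
  ac_line (fun x => (f (x, y)).2) (fun x => Df (x, y) 1 0).

Lemma W11loc_good_vline : continuous f -> W11loc f Df -> {ae leb, forall x, good_vline x}.
Proof.
move=> cf [_ iD [_ w1] [_ w2]].
have c1 : continuous (fun z => (f z).1).
  by move=> z; apply: (cvg_comp f fst); [exact: cf|exact: cvg_fst].
have c2 : continuous (fun z => (f z).2).
  by move=> z; apply: (cvg_comp f snd); [exact: cf|exact: cvg_snd].
have a1 := weak_ac_y c1 (iD 0 1) w1; have a2 := weak_ac_y c2 (iD 1 1) w2.
by move: a2; move: a1; apply: filterS2; first exact: (ae_filter_ringOfSetsType leb).
Qed.

Lemma W11loc_good_hline : continuous f -> W11loc f Df -> {ae leb, forall y, good_hline y}.
Proof.
move=> cf [_ iD [w1 _] [w2 _]].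
have c1 : continuous (fun z => (f z).1).
  by move=> z; apply: (cvg_comp f fst); [exact: cf|exact: cvg_fst].
have c2 : continuous (fun z => (f z).2).
  by move=> z; apply: (cvg_comp f snd); [exact: cf|exact: cvg_snd].
have a1 := weak_ac_x c1 (iD 0 0) w1; have a2 := weak_ac_x c2 (iD 1 0) w2.
by move: a2; move: a1; apply: filterS2; first exact: (ae_filter_ringOfSetsType leb).
Qed.

Definition l1dist (M N : 'M[R]_2) : R :=
  `|M 0 0 - N 0 0| + `|M 0 1 - N 0 1| + (`|M 1 0 - N 1 0| + `|M 1 1 - N 1 1|).

Lemma l1dist_ge0 M N : 0 <= l1dist M N.
Proof. by rewrite !addr_ge0. Qed.

Lemma l1dist_entry (M N : 'M[R]_2) (i j : 'I_2) : `|M i j - N i j| <= l1dist M N.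
Proof.
have h (k : 'I_2) : k = 0 \/ k = 1.
  by case: k => -[|[|//]] ?; [left|right]; apply/val_inj.
rewrite /l1dist; have := normr_ge0 (M 0 0 - N 0 0); have := normr_ge0 (M 0 1 - N 0 1).
have := normr_ge0 (M 1 0 - N 1 0); have := normr_ge0 (M 1 1 - N 1 1).
by case: (h i) => ->; case: (h j) => -> *; lra.
Qed.

Hypothesis mDf : forall i j, measurable_fun setT (fun z => Df z i j).

Lemma measurable_l1dist G : measurable_fun setT (fun z => l1dist (Df z) G).
Proof.
have m i j : measurable_fun setT (fun z => `|Df z i j - G i j|).
  by apply: measurableT_comp => //; exact: measurable_funB.
by apply: measurable_funD; apply: measurable_funD.
Qed.

Lemma vline_osc G x y1 y2 c d (e : R) : good_vline x -> c <= y1 -> y1 <= y2 -> y2 < d ->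
  (\int[leb]_(y in `[c, d[) (l1dist (Df (x, y)) G)%:E <= e%:E)%E ->
  `|(f (x, y2) - f (x, y1)) - mxact G ((x, y2) - (x, y1))| <= e.
Proof.
move=> [g1 g2] cy y12 yd ie.
have H i (u : R * R -> R) : ac_line (fun y => u (x, y)) (fun y => Df (x, y) i 1) ->
    `|u (x, y2) - u (x, y1) - G i 1 * (y2 - y1)| <= e.
  move=> /(_ y1 y2 (G i 1) y12); rewrite -lee_fin => /le_trans; apply; apply: le_trans ie.
  have ml : measurable_fun setT (fun y => (l1dist (Df (x, y)) G)%:E).
    by apply/measurable_EFinP; exact: (measurable_fun_pair2 x (measurable_l1dist G)).
  apply: (@le_trans _ _ (\int[leb]_(y in `[y1, y2]) (l1dist (Df (x, y)) G)%:E)%E).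
    apply: ge0_le_integral => //.
    + apply/measurable_EFinP; apply: measurable_funTS; apply: measurableT_comp => //.
      by apply: measurable_funB => //; exact: (measurable_fun_pair2 x (mDf i 1)).
    + exact: measurable_funTS.
    + by move=> y _; rewrite lee_fin l1dist_entry.
  apply: ge0_subset_integral => //.
  + exact: measurable_funTS.
  + by move=> y _; rewrite lee_fin l1dist_ge0.
  + by move=> y /=; rewrite !in_itv/= => /andP[h1 h2]; rewrite (le_trans cy h1) (le_lt_trans h2 yd).
rewrite prod_normE/= ge_max subrr mulr0 add0r mulr0 add0r.
by rewrite (H _ (fun z => (f z).1) g1) (H _ (fun z => (f z).2) g2).
Qed.

Lemma hline_osc G y x1 x2 a b (e : R) : good_hline y -> a <= x1 -> x1 <= x2 -> x2 < b ->
  (\int[leb]_(x in `[a, b[) (l1dist (Df (x, y)) G)%:E <= e%:E)%E ->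
  `|(f (x2, y) - f (x1, y)) - mxact G ((x2, y) - (x1, y))| <= e.
Proof.
move=> [g1 g2] ax x12 xb ie.
have H i (u : R * R -> R) : ac_line (fun x => u (x, y)) (fun x => Df (x, y) i 0) ->
    `|u (x2, y) - u (x1, y) - G i 0 * (x2 - x1)| <= e.
  move=> /(_ x1 x2 (G i 0) x12); rewrite -lee_fin => /le_trans; apply; apply: le_trans ie.
  have ml : measurable_fun setT (fun x => (l1dist (Df (x, y)) G)%:E).
    by apply/measurable_EFinP; exact: (measurable_fun_pair1 y (measurable_l1dist G)).
  apply: (@le_trans _ _ (\int[leb]_(x in `[x1, x2]) (l1dist (Df (x, y)) G)%:E)%E).
    apply: ge0_le_integral => //.
    + apply/measurable_EFinP; apply: measurable_funTS; apply: measurableT_comp => //.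
      by apply: measurable_funB => //; exact: (measurable_fun_pair1 y (mDf i 0)).
    + exact: measurable_funTS.
    + by move=> x _; rewrite lee_fin l1dist_entry.
  apply: ge0_subset_integral => //.
  + exact: measurable_funTS.
  + by move=> x _; rewrite lee_fin l1dist_ge0.
  + by move=> x /=; rewrite !in_itv/= => /andP[h1 h2]; rewrite (le_trans ax h1) (le_lt_trans h2 xb).
rewrite prod_normE/= ge_max subrr mulr0 addr0 mulr0 addr0.
by rewrite (H _ (fun z => (f z).1) g1) (H _ (fun z => (f z).2) g2).
Qed.

End Oscillation.

(** * The area inequality *)

Section Parallelogram.
Context {R : realType}.
Notation leb := (@lebesgue_measure R).
Notation area := (@area R).

(** The points sent into the open sup-norm ball of radius r by the affine map that has rows (a, b)
    and (c, d) and vanishes at (w1, w2). With these rows forming G^-1, it is the image of a square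
    under G, up to translation. *)
Definition para (a b c d w1 w2 r : R) : set (R * R) :=
  [set w | (`|a * (w.1 - w1) + b * (w.2 - w2)| < r) && (`|c * (w.1 - w1) + d * (w.2 - w2)| < r)].

Lemma measurable_para (a b c d w1 w2 r : R) : measurable (para a b c d w1 w2 r).
Proof.
have cl (k l : R) : continuous (fun w : R * R => `|k * (w.1 - w1) + l * (w.2 - w2)|).
  move=> w; apply: cvg_norm; apply: cvgD; apply: cvgM; (try exact: cvg_cst);
    by apply: cvgB; [exact: cvg_fst||exact: cvg_snd|exact: cvg_cst].
have -> : para a b c d w1 w2 r = [set w | `|a * (w.1 - w1) + b * (w.2 - w2)| < r] `&` [set w | `|c * (w.1 - w1) + d * (w.2 - w2)| < r].
  by apply/seteqP; split => w /= => [/andP//|[? ?]]; apply/andP.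
apply: measurable_open2; apply: openI.
  have := @open_comp _ _ (fun w : R * R => `|a * (w.1 - w1) + b * (w.2 - w2)|) [set y | y < r].
  by apply; [move=> w _; exact: cl|exact: open_lt].
have := @open_comp _ _ (fun w : R * R => `|c * (w.1 - w1) + d * (w.2 - w2)|) [set y | y < r].
by apply; [move=> w _; exact: cl|exact: open_lt].
Qed.

Lemma measurable_continuous_plane (g : R * R -> R * R) : continuous g -> measurable_fun setT g.
Proof.
move=> cg; apply/measurable_fun_pairP; split; apply: continuous_measurable2 => z.
  by apply: (cvg_comp g fst); [exact: cg|exact: cvg_fst].
by apply: (cvg_comp g snd); [exact: cg|exact: cvg_snd].
Qed.

Lemma measurable_homeo_preimage (g : R * R -> R * R) (A : set (R * R)) : continuous g ->
  measurable A -> measurable (g @^-1` A).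
Proof. by move=> cg mA; rewrite -[_ @^-1` _]setTI; exact: measurable_continuous_plane. Qed.

(** The true area is 4 r^2 / |ad - bc|; a quarter of it is enough and comes from vertical sections.
    When |d| <= |b|, a bound on the first linear form controls the second up to a term in x - w1
    alone. *)
Lemma area_parallelogram_aux (a b c d w1 w2 r : R) : `|d| <= `|b| -> a * d - b * c != 0 -> 0 < r ->
  ((r ^+ 2 / `|a * d - b * c|)%:E <=
   area (para a b c d w1 w2 r))%E.
Proof.
move=> db; set D := a * d - b * c => D0 r0.
have b0 : b != 0.
  apply: contraNneq D0 => b0; move: db; rewrite /D b0 normr0 normr_le0 => /eqP ->.
  by rewrite mulr0 mul0r subrr.
have nb : 0 < `|b| by rewrite normr_gt0.
have nD : 0 < `|D| by rewrite normr_gt0.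
set P := para _ _ _ _ _ _ _.
have mP : measurable P by exact: measurable_para.
(* With |x - w1| < l and y within m of [u], every term below is less than r / 2; the product of the
   lengths 2 l and 2 m is r^2 / |D|. *)
pose l := r * `|b| / (2 * `|D|).
have l0 : 0 < l by rewrite divr_gt0// mulr_gt0.
pose m := r / (2 * `|b|).
have m0 : 0 < m by rewrite divr_gt0// mulr_gt0.
have leE (x y : R) : 0 < y -> leb `]x - y, x + y[ = (2 * y)%:E.
  move=> y0; rewrite lebesgue_measure_itv/= lte_fin ifT; last by lra.
  by rewrite -EFinB; congr EFin; ring.
have -> : (r ^+ 2 / `|D|)%:E = (\int[leb]_(x in `](w1 - l)%R, (w1 + l)%R[) (cst (2 * m)%R%:E x))%E.
  rewrite integral_cst//= leE// -EFinM /m /l; congr EFin; field.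
  by rewrite !gt_eqF.
rewrite /area /product_measure1 /= integral_mkcond.
apply: ge0_le_integral => //.
- by move=> x _; rewrite patchE; case: ifPn => // _; rewrite lee_fin mulr_ge0 ?ltW.
- by apply/(measurable_restrictT _ _).1.
- exact: measurable_fun_xsection.
move=> x _; rewrite patchE; case: ifPn => [xl|_]; last exact: measure_ge0.
have {}xl : `|x - w1| < l.
  by move: xl; rewrite inE/= in_itv/= ltr_norml => /andP[? ?]; apply/andP; split; lra.
pose u := w2 - a / b * (x - w1).
rewrite /= -(leE u m m0); apply: le_measure; rewrite ?inE//.
  exact: measurable_xsection.
move=> y /=; rewrite in_itv/= => /andP[y1 y2]; rewrite /xsection/= inE /P /para /=.
have h1 : `|a * (x - w1) + b * (y - w2)| < r / 2.
  have -> : a * (x - w1) + b * (y - w2) = b * (y - u) by rewrite /u; field.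
  rewrite normrM -ltr_pdivlMl//.
  have -> : `|b|^-1 * (r / 2) = m by rewrite /m; field; rewrite gt_eqF.
  by rewrite ltr_norml; apply/andP; split; lra.
apply/andP; split; first by apply: (lt_trans h1); lra.
have -> : c * (x - w1) + d * (y - w2) = d / b * (a * (x - w1) + b * (y - w2)) - D / b * (x - w1).
  by rewrite /D; field.
apply: le_lt_trans (ler_normB _ _) _.
have h2 : `|d / b * (a * (x - w1) + b * (y - w2))| < r / 2.
  apply: le_lt_trans h1; rewrite normrM -[leRHS]mul1r ler_wpM2r//.
  by rewrite normrM normfV ler_pdivrMr// mul1r.
have h3 : `|D / b * (x - w1)| < r / 2.
  rewrite normrM [`|D / b|]normrM normfV -ltr_pdivlMl ?divr_gt0//.
  by apply: (lt_le_trans xl); rewrite /l le_eqVlt; apply/orP; left; apply/eqP; field; rewrite !gt_eqF.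
lra.
Qed.

Lemma area_parallelogram (a b c d w1 w2 r : R) : a * d - b * c != 0 -> 0 < r ->
  ((r ^+ 2 / `|a * d - b * c|)%:E <=
   area (para a b c d w1 w2 r))%E.
Proof.
move=> D0 r0; have [db|/ltW bd] := leP `|d| `|b|; first exact: area_parallelogram_aux.
have E : `|a * d - b * c| = `|c * b - d * a| by rewrite distrC; congr `|_ - _|; exact: mulrC.
rewrite E; have := @area_parallelogram_aux c d a b w1 w2 r bd _ r0.
rewrite (_ : para c d a b w1 w2 r = para a b c d w1 w2 r).
  by apply; rewrite -normr_eq0 -E normr_eq0.
by apply/seteqP; split => w /=; rewrite /para/= andbC.
Qed.

End Parallelogram.

(** * Images of squares *)

Section SquareImage.
Context {R : realType}.
Notation leb := (@lebesgue_measure R).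
Notation area := (@area R).
Variables (f g : R * R -> R * R) (Df : R * R -> 'M[R]_2).
Hypotheses (cf : continuous f) (cg : continuous g) (fK : cancel f g) (gK : cancel g f).
Hypothesis mDf : forall i j, measurable_fun setT (fun z => Df z i j).
Hypotheses (gv : {ae leb, forall x, good_vline f Df x}) (gh : {ae leb, forall y, good_hline f Df y}).

Lemma mxactN (G : 'M[R]_2) (h : R * R) : mxact G (- h) = - mxact G h.
Proof. by rewrite /mxact; apply/pair_equal_spec; split => /=; ring. Qed.

Lemma mxactD (G : 'M[R]_2) (h k : R * R) : mxact G (h + k) = mxact G h + mxact G k.
Proof. by rewrite /mxact; apply/pair_equal_spec; split => /=; ring. Qed.

Definition affine_dev (G : 'M[R]_2) (z w : R * R) := f z - f w - mxact G (z - w).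

Lemma affine_devN G z w : affine_dev G w z = - affine_dev G z w.
Proof. by rewrite /affine_dev -[w - z]opprB mxactN opprK opprB opprB addrC. Qed.

Lemma affine_dev_trans G v z w : affine_dev G z w = affine_dev G z v + affine_dev G v w.
Proof.
rewrite /affine_dev (_ : z - w = (z - v) + (v - w)); last by rewrite addrA subrK.
have -> : f z - f w = f z - f v + (f v - f w) by rewrite addrA subrK.
by rewrite mxactD opprD addrACA.
Qed.

Lemma vline_dev G x y1 y2 c d (e : R) : good_vline f Df x -> c <= y1 < d -> c <= y2 < d ->
  (\int[leb]_(y in `[c, d[) (l1dist (Df (x, y)) G)%:E <= e%:E)%E ->
  `|affine_dev G (x, y2) (x, y1)| <= e.
Proof.
move=> gx /andP[cy1 y1d] /andP[cy2 y2d] ie; have [y12|/ltW y21] := leP y1 y2.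
  exact: (vline_osc mDf gx cy1 y12 y2d ie).
by rewrite affine_devN normrN; exact: (vline_osc mDf gx cy2 y21 y1d ie).
Qed.

Lemma hline_dev G y x1 x2 a b (e : R) : good_hline f Df y -> a <= x1 < b -> a <= x2 < b ->
  (\int[leb]_(x in `[a, b[) (l1dist (Df (x, y)) G)%:E <= e%:E)%E ->
  `|affine_dev G (x2, y) (x1, y)| <= e.
Proof.
move=> gx /andP[cy1 y1d] /andP[cy2 y2d] ie; have [y12|/ltW y21] := leP x1 x2.
  exact: (hline_osc mDf gx cy1 y12 y2d ie).
by rewrite affine_devN normrN; exact: (hline_osc mDf gx cy2 y21 y1d ie).
Qed.

(* A segment leaving the image of the rectangle would have to cross the image of its boundary. *)
Lemma convex_sub_image (P : set (R * R)) (c : R * R) (xm xp ym yp : R) :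
  (forall w t, P w -> 0 <= t <= 1 -> P (f c + t *: (w - f c))) ->
  xm < c.1 < xp -> ym < c.2 < yp ->
  (forall z, xm <= z.1 <= xp -> ym <= z.2 <= yp -> P (f z) ->
     [/\ z.1 != xm, z.1 != xp, z.2 != ym & z.2 != yp]) ->
  forall w, P w -> xm < (g w).1 < xp /\ ym < (g w).2 < yp.
Proof.
move=> Pc cx cy Pb w Pw.
(* Negative exactly inside the open rectangle. If g w were not inside, [N] would vanish somewhere
   along the g-image of the segment from f c to w, that is, at a boundary point with image in
   [P]. *)
pose N (z : R * R) := Order.max (Order.max (xm - z.1) (z.1 - xp)) (Order.max (ym - z.2) (z.2 - yp)).
have cN : continuous N.
  have c1 (k : R) : continuous (fun z : R * R => k - z.1).
    by move=> z; apply: cvgB; [exact: cvg_cst|exact: cvg_fst].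
  have c2 (k : R) : continuous (fun z : R * R => z.1 - k).
    by move=> z; apply: cvgB; [exact: cvg_fst|exact: cvg_cst].
  have c3 (k : R) : continuous (fun z : R * R => k - z.2).
    by move=> z; apply: cvgB; [exact: cvg_cst|exact: cvg_snd].
  have c4 (k : R) : continuous (fun z : R * R => z.2 - k).
    by move=> z; apply: cvgB; [exact: cvg_snd|exact: cvg_cst].
  have cm (F1 F2 : R * R -> R) : continuous F1 -> continuous F2 ->
      continuous (fun z => Order.max (F1 z) (F2 z)).
    by move=> h1 h2 z; apply: (@continuous_max R _ F1 F2 z); [exact: h1|exact: h2].
  exact: (cm _ _ (cm _ _ (c1 xm) (c2 xp)) (cm _ _ (c3 ym) (c4 yp))).
have Nlt z : N z < 0 -> xm < z.1 < xp /\ ym < z.2 < yp.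
  rewrite /N !gt_max => /andP[/andP[? ?] /andP[? ?]].
  by split; apply/andP; split; lra.
have Nlt' z : xm < z.1 < xp -> ym < z.2 < yp -> N z < 0.
  move=> /andP[? ?] /andP[? ?]; rewrite /N !gt_max.
  by apply/andP; split; apply/andP; split; lra.
apply: Nlt; rewrite ltNge; apply/negP => N1.
pose p (t : R) : R * R := f c + t *: (w - f c).
have cp : continuous p.
  by move=> t; apply: cvgD; [exact: cvg_cst|apply: cvgZr_tmp; exact: cvg_id].
have cψ : {within `[0, 1], continuous (fun t => N (g (p t)))}.
  apply: continuous_subspaceT => t; apply: (cvg_comp (g \o p) N); last exact: cN.
  by apply: (cvg_comp p g); [exact: cp|exact: cg].
have p0 : p 0 = f c by rewrite /p scale0r addr0.
have p1 : p 1 = w by rewrite /p scale1r addrC subrK.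
have [|t] := @IVT R _ 0 1 0 ler01 cψ.
  by rewrite p0 p1 fK minEle maxEle; have := Nlt' _ cx cy => h; rewrite (le_trans (ltW h) N1) (ltW h) N1.
rewrite in_itv/= => t01 Nt.
have Pt : P (f (g (p t))) by rewrite gK; exact: Pc.
have : N (g (p t)) <= 0 by rewrite Nt.
rewrite /N !ge_max => /andP[/andP[h1 h2] /andP[h3 h4]].
have [||n1 n2 n3 n4] := Pb _ _ _ Pt; try (apply/andP; split; lra).
have : N (g (p t)) < 0.
  apply: Nlt'; apply/andP; split; rewrite lt_neqAle.
  - by rewrite eq_sym n1/=; lra.
  - by rewrite n2/=; lra.
  - by rewrite eq_sym n3/=; lra.
  - by rewrite n4/=; lra.
by rewrite Nt ltxx.
Qed.

Lemma para_star (a b c d w1 w2 r : R) (w : R * R) t : para a b c d w1 w2 r w -> 0 <= t <= 1 ->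
  para a b c d w1 w2 r ((w1, w2) + t *: (w - (w1, w2))).
Proof.
case: w => u v; rewrite /para/= => /andP[h1 h2] /andP[t0 t1].
have E k l : `|k * (w1 + t * (u - w1) - w1) + l * (w2 + t * (v - w2) - w2)|
    = t * `|k * (u - w1) + l * (v - w2)|.
  by rewrite -[t in RHS]ger0_norm// -normrM; congr `|_|; ring.
by apply/andP; split; rewrite E; [apply: le_lt_trans h1|apply: le_lt_trans h2];
  rewrite ler_piMl.
Qed.

Lemma det_mx22 (G : 'M[R]_2) : \det G = G 0 0 * G 1 1 - G 0 1 * G 1 0.
Proof.
rewrite (expand_det_row _ ord0) !big_ord_recl big_ord0 /cofactor !det_mx11 !mxE/=.
have -> : lift ord0 ord0 = 1 :> 'I_2 by apply/val_inj.
have -> : lift 1 0 = 0 :> 'I_2 by apply/val_inj.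
by rewrite addr0 expr0 mul1r /bump/= expr1 mulN1r mulrN.
Qed.

Lemma pick_vline_cell (G : 'M[R]_2) (a b s M e p : R) : 0 < s -> M < e * (s / 8) ->
  (\int[area]_(z in hrect a (a + s)%R b (b + s)%R) (l1dist (Df z) G)%:E <= M%:E)%E ->
  a <= p -> p + s / 8 <= a + s -> exists x, [/\ p < x, x < p + s / 8, good_vline f Df x &
    (\int[leb]_(y in `[b, (b + s)%R[) (l1dist (Df (x, y)) G)%:E <= e%:E)%E].
Proof.
move=> s0 Me iM h1 h2; have D1 z := l1dist_ge0 (Df z) G.
have mD := measurable_l1dist mDf G.
have [||x [/andP[? ?] ? ?]] := pick_vline D1 mD gv iM h1 _ h2 (K := e).
- by rewrite ltrDl divr_gt0.
- by rewrite addrAC subrr add0r.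
- by exists x.
Qed.

Lemma pick_hline_cell (G : 'M[R]_2) (a b s M e p : R) : 0 < s -> M < e * (s / 8) ->
  (\int[area]_(z in hrect a (a + s)%R b (b + s)%R) (l1dist (Df z) G)%:E <= M%:E)%E ->
  b <= p -> p + s / 8 <= b + s -> exists y, [/\ p < y, y < p + s / 8, good_hline f Df y &
    (\int[leb]_(x in `[a, (a + s)%R[) (l1dist (Df (x, y)) G)%:E <= e%:E)%E].
Proof.
move=> s0 Me iM h1 h2; have D1 z := l1dist_ge0 (Df z) G.
have mD := measurable_l1dist mDf G.
have [||x [/andP[? ?] ? ?]] := pick_hline D1 mD gh iM h1 _ h2 (K := e).
- by rewrite ltrDl divr_gt0.
- by rewrite addrAC subrr add0r.
- by exists x.
Qed.

(** The lines are picked in intervals of length s / 8 that begin at 0, 7/16 and 7/8 of the side,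
    hence gaps of at least 7/16 - 1/8 = 7/8 - 9/16 = 5/16. *)
Lemma subdivision_eighth (a s x y z : R) : 0 < s -> a < x -> x < a + s / 8 ->
  a + 7 / 16 * s < y -> y < a + 7 / 16 * s + s / 8 -> a + 7 / 8 * s < z -> z < a + 7 / 8 * s + s / 8 ->
  [/\ a < x, 5 / 16 * s < y - x, 5 / 16 * s < z - y & z < a + s].
Proof. by move=> *; split; lra. Qed.

(** A good line is chosen through the middle in each direction too: a point of a side is joined to
    the centre along this side and then along a middle line, and each of the two legs costs [e]. *)
Lemma frame_dev (G : 'M[R]_2) (a b s M e : R) : 0 < s -> M < e * (s / 8) ->
  (\int[area]_(z in hrect a (a + s)%R b (b + s)%R) (l1dist (Df z) G)%:E <= M%:E)%E ->
  exists xm xc xp ym yc yp,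
  [/\ [/\ a < xm, 5 / 16 * s < xc - xm, 5 / 16 * s < xp - xc & xp < a + s],
      [/\ b < ym, 5 / 16 * s < yc - ym, 5 / 16 * s < yp - yc & yp < b + s],
      forall x y, (x = xm \/ x = xp) -> ym <= y <= yp -> `|affine_dev G (x, y) (xc, yc)| <= e + e &
      forall x y, (y = ym \/ y = yp) -> xm <= x <= xp -> `|affine_dev G (x, y) (xc, yc)| <= e + e].
Proof.
move=> s0 Me iM.
have e1 c : c <= c + 7 / 16 * s by lra.
have e2 c : c <= c + 7 / 8 * s by lra.
have e3 c : c + s / 8 <= c + s by lra.
have e4 c : c + 7 / 16 * s + s / 8 <= c + s by lra.
have e5 c : c + 7 / 8 * s + s / 8 <= c + s by lra.
have [xm [xm1 xm2 gxm ixm]] := pick_vline_cell s0 Me iM (lexx a) (e3 a).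
have [xc [xc1 xc2 gxc ixc]] := pick_vline_cell s0 Me iM (e1 a) (e4 a).
have [xp [xp1 xp2 gxp ixp]] := pick_vline_cell s0 Me iM (e2 a) (e5 a).
have [ym [ym1 ym2 gym iym]] := pick_hline_cell s0 Me iM (lexx b) (e3 b).
have [yc [yc1 yc2 gyc iyc]] := pick_hline_cell s0 Me iM (e1 b) (e4 b).
have [yp [yp1 yp2 gyp iyp]] := pick_hline_cell s0 Me iM (e2 b) (e5 b).
clear Me iM e1 e2 e3 e4 e5.
have Sx := subdivision_eighth s0 xm1 xm2 xc1 xc2 xp1 xp2.
have Sy := subdivision_eighth s0 ym1 ym2 yc1 yc2 yp1 yp2.
clear xm1 xm2 xc1 xc2 xp1 xp2 ym1 ym2 yc1 yc2 yp1 yp2.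
have [Sx1 Sx2 Sx3 Sx4] := Sx; have [Sy1 Sy2 Sy3 Sy4] := Sy.
have s0' : 0 < 5 / 16 * s by lra.
exists xm, xc, xp, ym, yc, yp; split => // x y.
- move=> hx /andP[h1 h2]; rewrite (affine_dev_trans G (x, yc)).
  have ax : a <= x < a + s by case: hx => ->; clear -s0' Sx1 Sx2 Sx3 Sx4; apply/andP; split; lra.
  have axc : a <= xc < a + s by clear -s0' Sx1 Sx2 Sx3 Sx4; apply/andP; split; lra.
  have byc : b <= yc < b + s by clear -s0' Sy1 Sy2 Sy3 Sy4; apply/andP; split; lra.
  have by' : b <= y < b + s by clear -h1 h2 s0' Sy1 Sy2 Sy3 Sy4; apply/andP; split; lra.
  apply: le_trans (ler_normD _ _) _; apply: lerD.
    by case: hx => ->; [apply: (vline_dev gxm _ _ ixm)|apply: (vline_dev gxp _ _ ixp)].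
  exact: (hline_dev gyc _ _ iyc).
- move=> hy /andP[h1 h2]; rewrite (affine_dev_trans G (xc, y)).
  have bY : b <= y < b + s by case: hy => ->; clear -s0' Sy1 Sy2 Sy3 Sy4; apply/andP; split; lra.
  have axc : a <= xc < a + s by clear -s0' Sx1 Sx2 Sx3 Sx4; apply/andP; split; lra.
  have byc : b <= yc < b + s by clear -s0' Sy1 Sy2 Sy3 Sy4; apply/andP; split; lra.
  have ax : a <= x < a + s by clear -h1 h2 s0' Sx1 Sx2 Sx3 Sx4; apply/andP; split; lra.
  apply: le_trans (ler_normD _ _) _; apply: lerD.
    by case: hy => ->; [apply: (hline_dev gym _ _ iym)|apply: (hline_dev gyp _ _ iyp)].
  exact: (vline_dev gxc _ _ ixc).
Qed.

(* By frame_dev, G^-1 (f z - f c) differs from z - c by at most s / 32 on a frame whose points are at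
   distance at least 5 s / 16 from its centre c; so the parallelogram |G^-1 (w - f c)| < s / 4 is
   covered. *)
Lemma square_image (G : 'M[R]_2) (a b s k : R) : 0 < s -> \det G != 0 ->
  512 * k * l1dist G 0 < `|\det G| ->
  (\int[area]_(z in hrect a (a + s)%R b (b + s)%R) (l1dist (Df z) G)%:E <= (k * s ^+ 2)%:E)%E ->
  ((`|\det G| / 16 * s ^+ 2)%:E <= area (g @^-1` (hrect a (a + s)%R b (b + s)%R)))%E.
Proof.
move=> s0 D0 kG iM.
have D0' : 0 < `|\det G| by rewrite normr_gt0.
have n0 : 0 < l1dist G 0.
  rewrite lt_neqAle l1dist_ge0 andbT; apply: contraNneq D0 => h.
  have z i j : G i j = 0.
    apply/eqP; rewrite -normr_le0; have := l1dist_entry G 0 i j; rewrite mxE subr0; move/le_trans; apply.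
    by rewrite -h.
  by rewrite det_mx22 !z mulr0 subrr.
(* The excluded upper bound of [k], which makes [MK] strict with e = 8 k' s. The two legs cost 16 k'
   s, and G^-1 turns this into s / 32. *)
pose k' : R := `|\det G| / (512 * l1dist G 0).
have c0 : 0 < 512 * l1dist G 0 by apply: mulr_gt0; [rewrite ltr0n|exact: n0].
have kk' : k < k' by rewrite /k' ltr_pdivlMr// mulrA [k * _]mulrC.
have k'0 : 0 < k' by rewrite divr_gt0.
have k'E : k' = `|\det G| / (512 * l1dist G 0) by [].
clearbody k'.
have MK : k * s ^+ 2 < 8 * k' * s * (s / 8).
  have -> : 8 * k' * s * (s / 8) = k' * s ^+ 2 by field.
  by rewrite ltr_pM2r// exprn_gt0.
have [xm [x0 [xp [ym [y0 [yp [Sx Sy dx dy]]]]]]] := frame_dev s0 MK iM.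
have ee : 8 * k' * s + 8 * k' * s = 16 * k' * s by ring.
rewrite ee in dx, dy; clear iM MK ee kG kk' c0.
set D := \det G in D0 D0' k'E *.
have DE : D = G 0 0 * G 1 1 - G 0 1 * G 1 0 by rewrite /D det_mx22.
pose w0 := f (x0, y0).
(* The matrix is G^-1, of determinant 1 / det G, so the radius s / 4 gives an area of at least |det
   G| s^2 / 16. *)
pose P := para (G 1 1 / D) (- G 0 1 / D) (- G 1 0 / D) (G 0 0 / D) w0.1 w0.2 (s / 4).
have DP : G 1 1 / D * (G 0 0 / D) - (- G 0 1 / D) * (- G 1 0 / D) = D^-1.
  apply: (@mulfI _ (D ^+ 2)); first by rewrite expf_neq0.
  have -> : D ^+ 2 * D^-1 = D by rewrite expr2 mulfK.
  by rewrite [RHS]DE; field.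
have aP : ((`|D| / 16 * s ^+ 2)%:E <= area P)%E.
  have := @area_parallelogram R (G 1 1 / D) (- G 0 1 / D) (- G 1 0 / D) (G 0 0 / D) w0.1 w0.2 (s / 4).
  rewrite DP invr_eq0 => /(_ D0) h; apply: le_trans (h _); last by lra.
  by rewrite lee_fin normfV invrK le_eqVlt; apply/orP; left; apply/eqP; field.
apply: (le_trans aP).
have entry i j : `|G i j| <= l1dist G 0.
  by have := l1dist_entry G 0 i j; rewrite mxE subr0.
(* s / 4 + s / 32 is less than 5 s / 16, so no point of the frame can be mapped into [P]. *)
have key z : `|affine_dev G z (x0, y0)| <= 16 * k' * s -> P (f z) ->
    `|z.1 - x0| < 5 / 16 * s /\ `|z.2 - y0| < 5 / 16 * s.
  case: z => x y dz; rewrite /P /para /= => /andP[].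
  move: dz; rewrite prod_normE/= ge_max => /andP[].
  set u := f (x, y); rewrite -/w0.
  set e1 := u.1 - w0.1 - _; set e2 := u.2 - w0.2 - _ => he1 he2.
  have E1 : G 1 1 / D * (u.1 - w0.1) + - G 0 1 / D * (u.2 - w0.2) =
     (x - x0) + (G 1 1 * e1 - G 0 1 * e2) / D.
    have -> : x - x0 = (x - x0) * D / D by rewrite mulfK.
    by rewrite {3}DE /e1 /e2; field.
  have E2 : - G 1 0 / D * (u.1 - w0.1) + G 0 0 / D * (u.2 - w0.2) =
     (y - y0) + (G 0 0 * e2 - G 1 0 * e1) / D.
    have -> : y - y0 = (y - y0) * D / D by rewrite mulfK.
    by rewrite {3}DE /e1 /e2; field.
  rewrite E1 E2 => h1 h2.
  have small (p q : R) : `|p| + `|q| <= l1dist G 0 -> forall e e' : R,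
      `|e| <= 16 * k' * s -> `|e'| <= 16 * k' * s -> `|(p * e - q * e') / D| <= s / 32.
    move=> pq e e' he he'; rewrite normrM normfV ler_pdivrMr//.
    apply: le_trans (ler_normB _ _) _; rewrite !normrM.
    apply: (@le_trans _ _ (`|p| * (16 * k' * s) + `|q| * (16 * k' * s))).
      by apply: lerD; apply: ler_wpM2l.
    rewrite -mulrDl; apply: (@le_trans _ _ (l1dist G 0 * (16 * k' * s))).
      by rewrite ler_wpM2r// !mulr_ge0// ltW.
    rewrite k'E le_eqVlt; apply/orP; left; apply/eqP; field.
    by rewrite gt_eqF.
  have s1 : `|G 1 1| + `|G 0 1| <= l1dist G 0.
    rewrite /l1dist !mxE !subr0; have := normr_ge0 (G 0 0); have := normr_ge0 (G 1 0); lra.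
  have s2 : `|G 0 0| + `|G 1 0| <= l1dist G 0.
    rewrite /l1dist !mxE !subr0; have := normr_ge0 (G 0 1); have := normr_ge0 (G 1 1); lra.
  have := small _ _ s1 e1 e2 he1 he2; have := small _ _ s2 e2 e1 he2 he1.
  move: h1 h2; rewrite !ltr_norml !ler_norml.
  by move=> /andP[? ?] /andP[? ?] /andP[? ?] /andP[? ?]; split; apply/andP; split; lra.
apply: le_measure; rewrite ?inE.
- exact: measurable_para.
- by exact: (measurable_homeo_preimage cg (@measurable_hrect R _ _ _ _)).
move=> w Pw; suff [/andP[h1 h2] /andP[h3 h4]] : xm < (g w).1 < xp /\ ym < (g w).2 < yp.
  case: Sx Sy => ? _ _ ? [? _ _ ?].
  by split; rewrite /= in_itv/=; apply/andP; split; lra.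
apply: (@convex_sub_image P (x0, y0)) => //=.
- by move=> v t Pv t01; rewrite -/w0 {1}[w0]surjective_pairing; exact: para_star.
- by case: Sx => *; apply/andP; split; lra.
- by case: Sy => *; apply/andP; split; lra.
have [Sx1 Sx2 Sx3 Sx4] := Sx; have [Sy1 Sy2 Sy3 Sy4] := Sy.
move=> [x y] /= hx hy Pz.
have nx (x' y' : R) : (x' = xm \/ x' = xp) -> ym <= y' <= yp -> ~ P (f (x', y')).
  move=> hx' hy' Pz'; have [] := key _ (dx _ _ hx' hy') Pz'; rewrite /= ltr_norml => /andP[? ?] _.
  by case: hx' => ?; lra.
have ny (x' y' : R) : (y' = ym \/ y' = yp) -> xm <= x' <= xp -> ~ P (f (x', y')).
  move=> hx' hy' Pz'; have [] := key _ (dy _ _ hx' hy') Pz'; rewrite /= => _; rewrite ltr_norml => /andP[? ?].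
  by case: hx' => ?; lra.
split; apply/eqP => h.
- by apply: (nx x y) => //; left.
- by apply: (nx x y) => //; right.
- by apply: (ny x y) => //; left.
- by apply: (ny x y) => //; right.
Qed.

End SquareImage.

Section AbsoluteContinuity.
Context d (T : measurableType d) (R : realType) (mu : {measure set T -> \bar R}).

(** The part of [D] above a large height [N] has integral at most e / 2 by dominated convergence;
    the rest is at most [N] and contributes at most N mu(E). *)
Lemma integral_abs_continuous (B : set T) (D : T -> R) (e : R) : measurable B ->
  (forall x, 0 <= D x) -> measurable_fun setT D -> mu.-integrable B (EFin \o D) -> 0 < e ->
  exists2 dl : R, 0 < dl & forall E, measurable E -> E `<=` B -> (mu E < dl%:E)%E ->
    (\int[mu]_(x in E) (D x)%:E <= e%:E)%E.
Proof.
move=> mB D0 mDT iD e0.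
pose h (n : nat) x : R := if n%:R < D x then D x else 0.
have mD : measurable_fun B D by exact: measurable_funTS.
have mh n : measurable_fun B (h n).
  apply: measurable_funTS; apply: measurable_fun_ifT => //.
  exact: measurable_fun_ltr.
have h0 n x : 0 <= h n x by rewrite /h; case: ifP.
have hD n x : h n x <= D x by rewrite /h; case: ifP.
have := @dominated_cvg _ T R mu B mB (fun n => EFin \o h n) (cst 0%E) (EFin \o D).
have X1 : forall n, measurable_fun B (EFin \o h n) by move=> n; apply/measurable_EFinP.
have X2 : forall x, B x -> (EFin \o h n) x @[n --> \oo] --> (cst 0%E : T -> \bar R) x.
  move=> x Bx; apply: cvg_near_cst; near=> n.
  rewrite /= /h ifF//; apply/negbTE; rewrite -leNgt.
  apply: ltW; apply: lt_le_trans (truncnS_gt _) _; rewrite ler_nat.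
  by near: n; exact: nbhs_infty_ge.
have X3 : forall x, B x -> (EFin \o D) x \is a fin_num by [].
have X4 : forall n x, B x -> (`|(EFin \o h n) x| <= (EFin \o D) x)%E.
  by move=> n x Bx; rewrite lee_fin /= ger0_norm.
move=> /(_ X1 X2 X3 iD X4).
rewrite integral0 => /fine_cvgP[_ /cvgrPdist_le] /(_ (e / 2)) [|N _ /(_ N (leqnn N)) /=].
  by rewrite divr_gt0.
rewrite sub0r normrN => hN.
have ih : (\int[mu]_(x in B) (h N x)%:E <= (e / 2)%:E)%E.
  have fi : (\int[mu]_(x in B) (h N x)%:E)%E \is a fin_num.
    rewrite fin_numE; have : (0 <= \int[mu]_(x in B) (h N x)%:E)%E by apply: integral_ge0 => x _; rewrite lee_fin.
    have : (\int[mu]_(x in B) (h N x)%:E < +oo)%E.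
      apply: le_lt_trans (integrable_lty mB iD); apply: ge0_le_integral => //.
      + by move=> x _; rewrite lee_fin.
      + exact/measurable_EFinP.
      + exact/measurable_EFinP.
      + by move=> x _; rewrite lee_fin.
    by case: (\int[mu]_(x in B) (h N x)%:E)%E.
  by rewrite -(fineK fi) lee_fin (le_trans (ler_norm _)).
exists (e / 2 / N.+1%:R); first by rewrite !divr_gt0.
move=> E mE EB muE.
have mDE : measurable_fun E D by exact: measurable_funS mD.
have mhE : measurable_fun E (h N) by exact: measurable_funS (mh N).
apply: (@le_trans _ _ (\int[mu]_(x in E) ((h N x)%:E + (N%:R)%:E))%E).
  apply: ge0_le_integral => //.
  - by move=> x _; rewrite lee_fin.
  - exact/measurable_EFinP.
  - by apply: emeasurable_funD => //; exact/measurable_EFinP.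
  - move=> x _; rewrite -EFinD lee_fin /h; case: ltP => ?; rewrite ?add0r//.
    by rewrite lerDl.
rewrite ge0_integralD//; last 2 first.
- by move=> x _; rewrite lee_fin.
- exact/measurable_EFinP.
have -> : e = e / 2 + e / 2 by field.
rewrite EFinD; apply: leeD.
  apply: le_trans ih; apply: ge0_subset_integral => //.
  - exact/measurable_EFinP.
  - by move=> x _; rewrite lee_fin.
rewrite integral_cst//.
apply: (@le_trans _ _ (N%:R%:E * (e / 2 / N.+1%:R)%:E)%E).
  by apply: lee_pmul => //; rewrite ?lee_fin// ltW.
rewrite -EFinM lee_fin mulrCA -[leRHS]mulr1 ler_wpM2l ?divr_ge0// ?ltW//.
by rewrite ltr_pdivrMr// mul1r ltr_nat.
Unshelve. all: by end_near. Qed.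

End AbsoluteContinuity.

(** * Comparison of measures on grid cells *)

Section GridCovering.
Context {R : realType}.
Notation leb := (@lebesgue_measure R).
Notation area := (@area R).
Notation plane_measure := {measure set (measurableTypeR R * measurableTypeR R)%type -> \bar R}.

(** Grids of different mesh need not be nested, so a point caught at one level may be lost at the
    next. [F n] collects the points missed at some level from n on; these sets decrease to the empty
    set, since a point of an open set is caught at all fine enough levels. *)
Lemma open_cells_cvg (m : plane_measure) (A O : set (R * R)) (e : R) : open O -> A `<=` O ->
  measurable A -> (m A < +oo)%E -> 0 < e ->
  exists k, (m (A `\` cell_union k (cells_in k O)) <= e%:E)%E.
Proof.
move=> oO AO mA mfin e0.
pose F n := A `\` \bigcap_(k in [set k | (n <= k)%N]) cell_union k (cells_in k O).
have mF n : measurable (F n).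
  apply: measurableD => //; apply: bigcap_measurable => [|k _]; first by exists n => /=.
  exact: measurable_cell_union.
have IF : \bigcap_n F n = set0.
  rewrite -subset0 => z Fz.
  have Az : A z by have [] := Fz 0%N I.
  have [N _ HN] := open_cells oO (AO _ Az).
  have [_] := Fz N I; apply => k /= Nk; exists (cell_of k z) => //.
  exact: HN.
have dF : {homo F : n k / (n <= k)%N >-> (k <= n)%O}.
  move=> n k nk; rewrite subsetEset => z [Az nz]; split => // h; apply: nz => j /= kj.
  by apply: h => /=; exact: leq_trans kj.
have F0 n : (m (F n) < +oo)%E.
  by apply: le_lt_trans mfin; apply: le_measure; [rewrite inE; exact: mF|rewrite inE; exact: mA|move=> z []].
have := @nonincreasing_cvg_mu _ _ _ m _ (F0 0%N) mF _ dF; rewrite IF measure0 => /(_ measurable0).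
move=> /fine_cvgP[_ /cvgrPdist_le /(_ _ e0)] [N _ /(_ N (leqnn N))].
rewrite /= sub0r normrN => h; exists N.
apply: (@le_trans _ _ (m (F N))).
  apply: le_measure; rewrite ?inE.
  - by apply: measurableD; [exact: mA|exact: measurable_cell_union].
  - exact: mF.
  - by move=> z [Az nz]; split => // hz; apply: nz; exact: (hz N (leqnn N)).
have fF : m (F N) \is a fin_num by rewrite ge0_fin_numE.
by rewrite -(fineK fF) lee_fin; exact: le_trans (ler_norm _) h.
Qed.

(* Approximate A from outside by an open set and the open set from inside by cells of a fine grid;
   the cells on which the mean of D exceeds 2 k have small total area, by Chebyshev. *)
Lemma grid_covering (mu : plane_measure) (D : R * R -> R) (A : set (R * R)) (N c k : R) :
  measurable A -> A `<=` box N -> (forall z, 0 <= D z) -> measurable_fun setT D ->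
  area.-integrable (box (N + 1)) (EFin \o D) -> (mu (box (N + 1)) < +oo)%E ->
  0 <= c -> 0 < k -> (forall z, A z -> D z <= k) ->
  (forall n p, (\int[area]_(z in cell n p) (D z)%:E <= (2 * k)%:E * area (cell n p))%E ->
     (c%:E * area (cell n p) <= mu (cell n p))%E) ->
  (c%:E * area A <= mu A)%E.
Proof.
move=> mA AN D0 mD iD mufin c0 k0 Ak Hc.
set B := box (N + 1) in iD mufin.
have mB : measurable B by exact: measurable_box.
have aBfin : (area B < +oo)%E by exact: area_box_lty.
apply/lee_addgt0Pr => e e0.
(* Three errors of e / 3 each: the points missed by the grid, the bad cells, and the excess of mu on
   [O] minus [A]. The 1 in c + 1 covers c = 0. *)
pose e1 := e / (3 * (c + 1)).
have c1 : 0 < c + 1 by rewrite ltr_wpDl.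
have c13 : 0 < 3 * (c + 1) by apply: mulr_gt0.
have e10 : 0 < e1 by exact: divr_gt0.
have ce1 : c * e1 <= e / 3.
  have -> : c * e1 = c / (c + 1) * (e / 3) by rewrite /e1; field; rewrite gt_eqF.
  by rewrite ler_piMl ?divr_ge0 ?(ltW e0)// ler_pdivrMr// mul1r lerDl.
have [dl dl0 Hdl] := @integral_abs_continuous _ (measurableTypeR R * measurableTypeR R)%type R area B D _ mB D0 mD iD (mulr_gt0 k0 e10).
(* The sum of the two measures, made finite by restriction to [B]: a single open set is then close
   to [A] for both. *)
pose m0 : plane_measure := measure_add area mu.
have m0E E : m0 E = (area E + mu E)%E by exact: measure_addE.
have m0fin : (m0 B < +oo)%E by rewrite m0E lte_add_pinfty.
have mB' : @measurable _ (measurableTypeR R * measurableTypeR R)%type B by exact: mB.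
pose m : {finite_measure set (measurableTypeR R * measurableTypeR R)%type -> \bar R} := mfrestr mB' m0fin.
pose et := Num.min (e / 3) (dl / 2).
have et0 : 0 < et by rewrite lt_min !divr_gt0.
have [V1 [oV1 AV1] mV1] := @outer_regularity R m A et mA et0.
pose O := V1 `&` ball (0 : R * R) (N + 1).
have oO : open O by apply: openI => //; exact: ball_open.
have OB : O `<=` B.
  by move=> z [_]; rewrite -ball_normE /ball_/= sub0r normrN => h; apply/box_norm; exact: ltW.
have AO : A `<=` O.
  move=> z Az; split; first exact: AV1.
  by rewrite -ball_normE /ball_/= sub0r normrN; have /box_norm := AN _ Az; lra.
have mO : measurable O by exact: measurable_open2.
have mOA : measurable (O `\` A) by exact: measurableD.
have OAet : (area (O `\` A) + mu (O `\` A) <= et%:E)%E.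
  apply: le_trans mV1; rewrite -m0E /m/= /mfrestr /mrestr; apply: le_measure; rewrite ?inE//.
    by apply: measurableI => //; apply: measurableD => //; exact: measurable_open2.
  by move=> z [Oz nAz]; split; [split => //; case: Oz|exact: OB].
have aOA : (area (O `\` A) < dl%:E)%E.
  apply: (@le_lt_trans _ _ et%:E); first by apply: le_trans OAet; exact: leeDl.
  by rewrite lte_fin /et gt_min; apply/orP; right; lra.
have muOA : (mu (O `\` A) <= (e / 3)%:E)%E.
  apply: (@le_trans _ _ et%:E); first by apply: le_trans OAet; exact: leeDr.
  by rewrite lee_fin /et ge_min lexx.
have afin E : measurable E -> E `<=` B -> (area E < +oo)%E.
  by move=> mE EB; apply: le_lt_trans aBfin; apply: le_measure; rewrite ?inE.
have AB : A `<=` B by move=> z /AO /OB.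
have [n An] := @open_cells_cvg area A O e1 oO AO mA (afin _ mA AB) e10.
pose I := cells_in n O.
pose good := [set p | (\int[area]_(z in cell n p) (D z)%:E <= (2 * k)%:E * area (cell n p))%E].
pose Ug : set (R * R) := cell_union n (I `&` good); pose Ub : set (R * R) := cell_union n (I `\` good).
have mUg : measurable Ug by exact: measurable_cell_union.
have mUb : measurable Ub by exact: measurable_cell_union.
have UgO : Ug `<=` O by move=> z [p [Ip _]]; exact: Ip.
have UbO : Ub `<=` O by move=> z [p [Ip _]]; exact: Ip.
have UE : (cell_union n I : set (R * R)) `<=` Ug `|` Ub.
  move=> z [p Ip pz]; have [g|g] := pselect (good p); [left|right]; by exists p.
have Hg : (c%:E * area Ug <= mu A + (e / 3)%:E)%E.
  apply: (@le_trans _ _ (mu Ug)).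
    have := @le_measure_cell_union R n (I `&` good) (mscale (NngNum c0) area) mu.
    by apply => p [_ gp]; exact: Hc.
  apply: (@le_trans _ _ (mu (A `|` (O `\` A)))).
    apply: le_measure; rewrite ?inE//; first exact: measurableU.
    by move=> z /UgO Oz; have [Az|nAz] := pselect (A z); [left|right].
  by apply: le_trans (measureU2 _ _ _) _ => //; exact: leeD.
have Hb : (area Ub <= e1%:E)%E.
  have mDE E : measurable E -> measurable_fun E (fun z => (D z)%:E).
    by move=> mE; apply/measurable_EFinP; exact: measurable_funTS.
  (* On the bad cells the mean of [D] exceeds 2 k, while D <= k on [A] and the part outside [A]
     contributes at most k e1. So 2 k |Ub| <= k |Ub| + k e1. *)
  have b1 : ((2 * k)%:E * area Ub <= \int[area]_(z in Ub) (D z)%:E)%E.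
    apply: le_measure_integral_cell_union.
    - by rewrite mulr_ge0// ltW.
    - exact: mDE.
    - by move=> z; rewrite lee_fin.
    - by move=> p [_ /negP]; rewrite -ltNge => /ltW.
  have b2 : (\int[area]_(z in Ub) (D z)%:E <= k%:E * area Ub + (k * e1)%:E)%E.
    have mUA : measurable (Ub `&` A) by exact: measurableI.
    have mUD : measurable (Ub `\` A) by exact: measurableD.
    have -> : (\int[area]_(z in Ub) (D z)%:E = \int[area]_(z in Ub `&` A) (D z)%:E + \int[area]_(z in Ub `\` A) (D z)%:E)%E.
      rewrite -[in LHS](setUIDK Ub A); apply: ge0_integral_setU.
      - exact: mUA.
      - exact: mUD.
      - by apply: mDE; exact: measurableU.
      - by move=> z _; rewrite lee_fin.
      - by apply/disj_set2P; rewrite -subset0 => z [[? ?] [_]].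
    apply: leeD.
      apply: (@le_trans _ _ (\int[area]_(z in Ub `&` A) (cst k%:E z))%E).
        apply: ge0_le_integral => //.
        - by move=> z _; rewrite lee_fin.
        - exact: mDE.
        - by move=> z [_ Az]; rewrite lee_fin Ak.
      rewrite integral_cst//.
      apply: lee_wpmul2l; first by rewrite lee_fin ltW.
      by apply: le_measure; rewrite ?inE.
    apply: Hdl => //.
      by move=> z [/UbO/OB].
    apply: le_lt_trans aOA; apply: le_measure; rewrite ?inE//.
    by move=> z [/UbO].
  have fU : area Ub \is a fin_num.
    by rewrite ge0_fin_numE//; apply: afin => // z /UbO/OB.
  have := le_trans b1 b2; rewrite -(fineK fU) -!EFinM -EFinD !lee_fin.
  by move=> h; rewrite -(ler_pM2l k0); lra.
apply: (@le_trans _ _ (c%:E * (area (A `\` cell_union n I) + area Ub + area Ug))%E).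
  apply: lee_wpmul2l; first by rewrite lee_fin.
  have mAU : measurable (A `\` cell_union n I) by apply: measurableD => //; exact: measurable_cell_union.
  apply: (@le_trans _ _ (area ((A `\` cell_union n I) `|` Ub `|` Ug))).
    apply: le_measure; rewrite ?inE//; first by apply: measurableU => //; exact: measurableU.
    move=> z Az; have [/UE[]|nUz] := pselect (cell_union n I z); [by right|by left; right|by left; left; split].
  apply: le_trans (measureU2 _ _ _) _ => //; first exact: measurableU.
  by apply: leeD => //; apply: measureU2.
have cD (x y z : \bar R) : (0 <= x)%E -> (0 <= y)%E -> (0 <= z)%E ->
    (c%:E * (x + y + z) = c%:E * x + c%:E * y + c%:E * z)%E.
  by move=> x0 y0 z0; rewrite !ge0_muleDr// adde_ge0.
rewrite (cD _ _ _ (measure_ge0 _ _) (measure_ge0 _ _) (measure_ge0 _ _)).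
apply: (@le_trans _ _ ((c * e1)%:E + (c * e1)%:E + (mu A + (e / 3)%:E))%E).
  by apply: leeD => //; apply: leeD; rewrite EFinM lee_wpmul2l// lee_fin.
rewrite addeCA; apply: leeD => //; rewrite -!EFinD lee_fin; lra.
Qed.

End GridCovering.

(** * Jacobian and area of images *)

Section AreaInequality.
Context {R : realType}.
Notation leb := (@lebesgue_measure R).
Notation area := (@area R).
Notation plane_measure := {measure set (measurableTypeR R * measurableTypeR R)%type -> \bar R}.

Lemma area_hrect (a b s : R) : 0 < s -> area (hrect a (a + s) b (b + s)) = (s ^+ 2)%:E.
Proof.
move=> s0; rewrite /area /hrect product_measure1E//= !lebesgue_measure_itv/= !lte_fin !ltrDl s0.
by rewrite -!EFinB -EFinM; congr EFin; ring.
Qed.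

Lemma cell_hrect k p : cell k p = hrect (p.1%:~R / k.+1%:R) (p.1%:~R / k.+1%:R + k.+1%:R^-1)
  (p.2%:~R / k.+1%:R) (p.2%:~R / k.+1%:R + k.+1%:R^-1) :> set (R * R).
Proof. by rewrite cellE /hrect !intrD !mulrDl !mul1r. Qed.

Lemma area_cell k p : area (cell k p) = (k.+1%:R^-1 ^+ 2)%:E.
Proof. by rewrite cell_hrect area_hrect// invr_gt0. Qed.

(** A countable dense family of matrices, which cuts the plane into countably many pieces with
    nearly constant differential. *)
Definition rat_mx (q : (rat * rat) * (rat * rat)) : 'M[R]_2 :=
  \matrix_(i, j) ratr (if i == 0 then if j == 0 then q.1.1 else q.1.2
                       else if j == 0 then q.2.1 else q.2.2).

Lemma rat_approx (x e : R) : 0 < e -> exists q : rat, `|x - ratr q| <= e.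
Proof.
move=> e0; have [q] : exists q, ratr q \in `]x - e, x + e[ by apply: rat_in_itvoo; lra.
by rewrite in_itv/= => /andP[? ?]; exists q; rewrite ler_norml; apply/andP; split; lra.
Qed.

(** The tolerance is expressed through the approximating matrix G, as the covering argument needs
    it, while the entries are chosen in terms of [M]. Determinant and norm of G are comparable with
    those of [M] once the error is small against det M / |M|. *)
Lemma rat_mx_approx (M : 'M[R]_2) (K : R) : 1 <= K -> 0 < \det M -> exists q,
  [/\ \det (rat_mx q) != 0,
      l1dist M (rat_mx q) <= `|\det (rat_mx q)| / (K * l1dist (rat_mx q) 0) &
      \det M <= 2 * `|\det (rat_mx q)|].
Proof.
move=> K1 J0; have K0 : 0 < K := lt_le_trans ltr01 K1; pose n := l1dist M 0.
have nE : n = `|M 0 0| + `|M 0 1| + (`|M 1 0| + `|M 1 1|) by rewrite /n /l1dist !mxE !subr0.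
have a00 := normr_ge0 (M 0 0); have a01 := normr_ge0 (M 0 1).
have a10 := normr_ge0 (M 1 0); have a11 := normr_ge0 (M 1 1).
have n0 : 0 < n.
  rewrite lt_neqAle l1dist_ge0 andbT; apply: contraTneq J0 => h.
  have z i j : M i j = 0.
    apply/eqP; rewrite -normr_le0; have := l1dist_entry M 0 i j; rewrite mxE subr0; move/le_trans; apply.
    by rewrite /n in h; rewrite -h.
  by rewrite det_mx22 !z mulr0 subrr ltxx.
set J := \det M in J0 *.
have Jn : J <= n ^+ 2.
  apply: le_trans (ler_norm _) _; rewrite /J det_mx22.
  apply: le_trans (ler_normB _ _) _; rewrite !normrM nE; nra.
(* Then e K (2 n) = J / 2, which is at most det G, because the determinant moves by at most 3 e n /
   2 < J / 2. *)
pose e : R := J / (4 * K * n).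
have e0 : 0 < e by apply: divr_gt0 => //; apply: mulr_gt0 => //; apply: mulr_gt0.
have eKn : e * (4 * K * n) = J by rewrite /e divfK// gt_eqF//; apply: mulr_gt0 => //; apply: mulr_gt0.
clearbody e.
have eJ : e * n <= J / 4.
  rewrite ler_pdivlMr// -eKn.
  have -> : e * (4 * K * n) = K * (e * n * 4) by ring.
  by rewrite ler_peMl// !mulr_ge0// ltW.
have en : e <= n / 4.
  rewrite -(ler_pM2r n0); have -> : n / 4 * n = n ^+ 2 / 4 by field.
  by apply: (le_trans eJ); rewrite ler_pM2r.
have e40 : 0 < e / 4 by rewrite divr_gt0.
have [q00 h00] := rat_approx (M 0 0) e40; have [q01 h01] := rat_approx (M 0 1) e40.
have [q10 h10] := rat_approx (M 1 0) e40; have [q11 h11] := rat_approx (M 1 1) e40.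
exists ((q00, q01), (q10, q11)); set G := rat_mx _.
have G00 : G 0 0 = ratr q00 by rewrite mxE.
have G01 : G 0 1 = ratr q01 by rewrite mxE.
have G10 : G 1 0 = ratr q10 by rewrite mxE.
have G11 : G 1 1 = ratr q11 by rewrite mxE.
rewrite -G00 in h00; rewrite -G01 in h01; rewrite -G10 in h10; rewrite -G11 in h11.
have dMG : l1dist M G <= e by rewrite /l1dist; lra.
have gle (x y : R) : `|x - y| <= e / 4 -> `|y| <= `|x| + e / 4.
  move=> h; have -> : y = x - (x - y) by rewrite opprB addrC subrK.
  by apply: le_trans (ler_normB _ _) _; rewrite lerD2l.
have g00 := gle _ _ h00; have g01 := gle _ _ h01; have g10 := gle _ _ h10; have g11 := gle _ _ h11.
have GnE : l1dist G 0 = `|G 0 0| + `|G 0 1| + (`|G 1 0| + `|G 1 1|) by rewrite /l1dist !mxE !subr0.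
have Gn : l1dist G 0 <= 2 * n by rewrite GnE; lra.
have dd : `|\det G - J| <= J / 2.
  have -> : \det G - J = - (M 0 0 - G 0 0) * G 1 1 - M 0 0 * (M 1 1 - G 1 1)
      + (M 0 1 - G 0 1) * G 1 0 + M 0 1 * (M 1 0 - G 1 0).
    by rewrite /J !det_mx22; ring.
  have T (x y d : R) : `|x| <= e / 4 -> `|y| <= d -> `|x * y| <= e / 4 * d.
    by move=> hx hy; rewrite normrM; apply: ler_pM.
  have t1 : `|- (M 0 0 - G 0 0) * G 1 1| <= e / 4 * (2 * n) by apply: T; rewrite ?normrN//; lra.
  have t2 : `|M 0 0 * (M 1 1 - G 1 1)| <= e / 4 * n by rewrite mulrC; apply: T => //; lra.
  have t3 : `|(M 0 1 - G 0 1) * G 1 0| <= e / 4 * (2 * n) by apply: T => //; lra.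
  have t4 : `|M 0 1 * (M 1 0 - G 1 0)| <= e / 4 * n by rewrite mulrC; apply: T => //; lra.
  apply: le_trans (ler_normD _ _) _; apply: le_trans (lerD (ler_normD _ _) (lexx _)) _.
  apply: le_trans (lerD (lerD (ler_normB _ _) (lexx _)) (lexx _)) _.
  apply: (le_trans (lerD (lerD (lerD t1 t2) t3) t4)).
  have -> : e / 4 * (2 * n) + e / 4 * n + e / 4 * (2 * n) + e / 4 * n = 3 / 2 * (e * n) by field.
  lra.
have dG : J / 2 <= \det G.
  have := dd; rewrite ler_norml => /andP[? _]; lra.
have dG0 : 0 < \det G by apply: lt_le_trans dG; rewrite divr_gt0.
have Gn0 : 0 < l1dist G 0.
  have nG : n <= l1dist G 0 + l1dist M G.
    rewrite nE GnE /l1dist.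
    have tr (x y : R) : `|x| <= `|y| + `|x - y|.
      by rewrite -{1}(subrK y x) [leRHS]addrC; exact: ler_normD.
    have := tr (M 0 0) (G 0 0); have := tr (M 0 1) (G 0 1).
    have := tr (M 1 0) (G 1 0); have := tr (M 1 1) (G 1 1); lra.
  lra.
rewrite (ger0_norm (ltW dG0)); split.
- by rewrite gt_eqF.
- apply: (le_trans dMG); rewrite ler_pdivlMr ?mulr_gt0//.
  apply: le_trans dG; apply: (@le_trans _ _ (e * (K * (2 * n)))).
    by rewrite ler_pM2l// ler_pM2l.
  by rewrite ler_pdivlMr// -eKn le_eqVlt; apply/orP; left; apply/eqP; ring.
- lra.
Qed.

Variables (f g : R * R -> R * R) (Df : R * R -> 'M[R]_2).
Hypotheses (cf : continuous f) (cg : continuous g) (fK : cancel f g) (gK : cancel g f).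
Hypothesis iDf : forall i j, loc_integrable (fun z => Df z i j).
Hypotheses (gv : {ae leb, forall x, good_vline f Df x}) (gh : {ae leb, forall y, good_hline f Df y}).

Let mDf i j : measurable_fun setT (fun z => Df z i j).
Proof. by have [] := iDf i j. Qed.

Let mg : measurable_fun [set: measurableTypeR R * measurableTypeR R] (g : _ -> measurableTypeR R * measurableTypeR R).
Proof. exact: measurable_continuous_plane. Qed.

(** Since the preimage of A under [g] is f(A), the push-forward of area by [g] measures images; it
    is needed as a bundled measure for [grid_covering]. *)
Let mu : plane_measure := measure_function_pushforward__canonical__measure_function_Measure (area : plane_measure) mg.

Let muE A : mu A = area (g @^-1` A).
Proof. by []. Qed.

Lemma image_area_box_lty N : (area (g @^-1` (box N)) < +oo)%E.
Proof.
have cK : compact (f @` (box N)).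
  by apply: continuous_compact (@compact_box R N); apply: continuous_subspaceT.
have [M KM] := compact_sub_box cK.
apply: le_lt_trans (area_box_lty M); apply: le_measure; rewrite ?inE.
- exact: (measurable_homeo_preimage cg (measurable_box N)).
- exact: measurable_box.
- by move=> w gw; apply: KM; exists (g w).
Qed.

Lemma integrable_l1dist G N : area.-integrable (box N) (EFin \o (fun z => l1dist (Df z) G)).
Proof.
have i i' j : area.-integrable (box N) (EFin \o (fun z => `|Df z i' j - G i' j|)).
  apply: (@integrable_norm _ _ _ area (box N) (fun z => Df z i' j - G i' j)) => /=.
  rewrite (_ : EFin \o _ = (EFin \o (fun z => Df z i' j)) \- cst (G i' j)%:E)%E; last by apply/funext.
  apply: integrableB; first exact: measurable_box.
    exact: loc_integrable_box.
  apply/integrableP; split; first exact: measurable_cst.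
  rewrite (eq_integral (cst `|G i' j|%:E)) // integral_cst; last exact: measurable_box.
  by rewrite lte_mul_pinfty// ?lee_fin// area_box_lty.
have iD2 (F1 F2 : R * R -> R) : area.-integrable (box N) (EFin \o F1) ->
    area.-integrable (box N) (EFin \o F2) -> area.-integrable (box N) (EFin \o (fun z => F1 z + F2 z)).
  by move=> i1 i2; apply: (integrableD _ i1 i2); exact: measurable_box.
exact: (iD2 _ _ (iD2 _ _ (i 0 0) (i 0 1)) (iD2 _ _ (i 1 0) (i 1 1))).
Qed.

(** [grid_covering] with the distance from [Df] to [G] and k = |det G| / (K |G|). Cells with mean at
    most 2 k fall under [square_image], whose condition 512 (2 k) |G| < |det G| amounts to K >
    1024. *)
Lemma matrix_area_bound (G : 'M[R]_2) (A : set (R * R)) (N K : R) : 1024 < K -> \det G != 0 ->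
  measurable A -> A `<=` box N ->
  (forall z, A z -> l1dist (Df z) G <= `|\det G| / (K * l1dist G 0)) ->
  ((`|\det G| / 16)%:E * area A <= area (g @^-1` A))%E.
Proof.
move=> K1024 D0 mA AN Ak.
have D0' : 0 < `|\det G| by rewrite normr_gt0.
have K0 : 0 < K by apply: lt_trans K1024; rewrite ltr0n.
have n0 : 0 < l1dist G 0.
  rewrite lt_neqAle l1dist_ge0 andbT; apply: contraNneq D0 => h.
  have z i j : G i j = 0.
    apply/eqP; rewrite -normr_le0; have := l1dist_entry G 0 i j; rewrite mxE subr0; move/le_trans; apply.
    by rewrite -h.
  by rewrite det_mx22 !z mulr0 subrr.
have Kn0 : 0 < K * l1dist G 0 by exact: mulr_gt0.
pose k : R := `|\det G| / (K * l1dist G 0).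
have k0 : 0 < k by exact: divr_gt0.
have D1 z := l1dist_ge0 (Df z) G.
apply: (@grid_covering R mu (fun z => l1dist (Df z) G) A N (`|\det G| / 16) k) => //.
- exact: measurable_l1dist.
- exact: integrable_l1dist.
- exact: image_area_box_lty.
move=> n p; rewrite area_cell cell_hrect -EFinM => h; rewrite -EFinM muE.
apply: (square_image cg fK gK mDf gv gh _ D0 _ h); first by rewrite invr_gt0.
have -> : 512 * (2 * k) * l1dist G 0 = 1024 / K * `|\det G|.
  by rewrite /k; field; rewrite !gt_eqF.
by rewrite gtr_pMl; [rewrite ltr_pdivrMr; [rewrite mul1r; exact: K1024|exact: K0]|exact: D0'].
Qed.

(** The positive part is nonnegative at every point, not only almost everywhere. Where the
    determinant is not positive, the distortion inequality forces [Df] to vanish, up to a null set,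
    so the estimate of |Df| loses nothing. *)
Definition jac_pos z := Num.max (\det (Df z)) 0.

Lemma measurable_jacobian : measurable_fun setT (fun z => \det (Df z)).
Proof.
rewrite (_ : (fun z => _) = (fun z => Df z 0 0 * Df z 1 1 - Df z 0 1 * Df z 1 0)); last first.
  by apply/funext => z; rewrite det_mx22.
by apply: measurable_funB; apply: measurable_funM.
Qed.

Lemma measurable_jac_pos : measurable_fun setT jac_pos.
Proof. by apply: measurable_maxr => //; exact: measurable_jacobian. Qed.

(* A is cut according to a rational matrix close to Df z. *)
Lemma jacobian_area (A : set (R * R)) (N : R) : measurable A -> A `<=` box N ->
  (\int[area]_(z in A) (jac_pos z)%:E <= 32%:E * area (g @^-1` A))%E.
Proof.
move=> mA AN.
have [K K1 K1024] : exists2 K : R, 1 <= K & 1024 < K.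
  by exists 1025; rewrite ?ler1n ?ltr_nat.
pose Sq q := [set z | [/\ \det (rat_mx q) != 0,
      l1dist (Df z) (rat_mx q) <= `|\det (rat_mx q)| / (K * l1dist (rat_mx q) 0) &
      \det (Df z) <= 2 * `|\det (rat_mx q)|]] : set (R * R).
have mSq q : measurable (Sq q).
  have [D0|D0] := boolP (\det (rat_mx q) == 0).
    rewrite (_ : Sq q = set0); first exact: measurable0.
    by rewrite -subset0 => z []; rewrite D0.
  rewrite (_ : Sq q = [set z | l1dist (Df z) (rat_mx q) <= `|\det (rat_mx q)| / (K * l1dist (rat_mx q) 0)] `&`
     [set z | \det (Df z) <= 2 * `|\det (rat_mx q)|]); last first.
    by apply/seteqP; split => [z []|z []//] ? ? ?; split.
  apply: measurableI; rewrite -[X in measurable X]setTI.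
    by apply: (measurable_fun_le _ (measurable_l1dist mDf _)) => //; exact: measurable_cst.
  by apply: (measurable_fun_le _ measurable_jacobian) => //; exact: measurable_cst.
pose S n := if @pickle_inv ((rat * rat) * (rat * rat))%type n is Some q then Sq q else set0.
have mS n : measurable (S n) by rewrite /S; case: pickle_inv => // q; exact: mSq.
have coverS z : 0 < \det (Df z) -> (\bigcup_n S n) z.
  move=> /(rat_mx_approx K1)[q [q1 q2 q3]]; exists (pickle q); first exact: I.
  by rewrite /S pickleK_inv.
(* The sets [S n] overlap; [seqDU] makes the pieces disjoint. *)
pose E n := A `&` seqDU S n.
have mE n : measurable (E n) by apply: measurableI => //; apply: measurableD => //; exact: bigsetU_measurable.
have tE : trivIset setT E.
  by apply: trivIset_setIl; exact: trivIset_seqDU.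
have UE : \bigcup_n E n = A `&` \bigcup_n S n by rewrite -setI_bigcupr -seqDU_bigcup_eq.
have mUE : measurable (\bigcup_n E n) by exact: bigcupT_measurable.
have j0 z : (0 <= (jac_pos z)%:E)%E by rewrite lee_fin le_max lexx orbT.
have mj B : measurable_fun B (fun z => (jac_pos z)%:E).
  by apply/measurable_EFinP; apply: measurable_funTS; exact: measurable_jac_pos.
have -> : (\int[area]_(z in A) (jac_pos z)%:E = \int[area]_(z in \bigcup_n E n) (jac_pos z)%:E)%E.
  rewrite integral_mkcond [RHS]integral_mkcond; apply: eq_integral => z _; rewrite !patchE UE.
  have [zA|zA] := boolP (z \in A); last by rewrite memNset// => -[/mem_set Az _]; move/negP: zA.
  have [J0|J0] := ltP 0 (\det (Df z)).
    by rewrite mem_set//; split; [exact/set_mem|exact: coverS].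
  have -> : jac_pos z = 0 by apply/max_idPr.
  by case: ifP.
rewrite (@ge0_integral_bigcup _ (measurableTypeR R * measurableTypeR R)%type R area E _ mE (mj _) (fun z _ => j0 z) tE).
apply: (@le_trans _ _ (\sum_(0 <= n <oo) (32%:E * mu (E n)))%E).
  apply: lee_nneseries => [n _ _|n _]; first by apply: integral_ge0 => z _; exact: j0.
  have [En0|/set0P[z0 Ez0]] := eqVneq (E n) set0; first by rewrite En0 integral_set0 measure0 mule0.
  have [q qn] : exists q, S n = Sq q.
    have : S n z0 by have [_ []] := Ez0.
    by rewrite /S; case: pickle_inv => // q _; exists q.
  have EnS z : E n z -> Sq q z by rewrite -qn => -[_ []].
  have [D0 _ _] := EnS _ Ez0.
  have EA : E n `<=` A by move=> z [].
  have := @matrix_area_bound (rat_mx q) (E n) N K K1024 D0 (mE n) (subset_trans EA AN) (fun z Ez => let: And3 _ h _ := EnS z Ez in h).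
  set D : R := `|\det (rat_mx q)| => h.
  apply: (@le_trans _ _ ((2 * D)%:E * area (E n))%E).
    apply: (@le_trans _ _ (\int[area]_(z in E n) (cst (2 * D)%:E z))%E).
      apply: ge0_le_integral; [exact: mE|by move=> z _|exact: mj|exact: measurable_cst|].
      move=> z Ez; rewrite lee_fin.
      by have [_ _ h3] := EnS z Ez; rewrite ge_max; apply/andP; split; [exact: h3|apply: mulr_ge0 => //; exact: normr_ge0].
    by rewrite integral_cst; last exact: mE.
  (* On a piece J <= 2 D, and its image has at least D / 16 times its area: hence 32. *)
  have -> : (2 * D)%:E = (32%:E * (D / 16)%:E)%E by rewrite -EFinM; congr EFin; field.
  rewrite -muleA; apply: lee_wpmul2l => //; by rewrite lee_fin.
rewrite nneseriesZl//.
apply: lee_wpmul2l; first by rewrite lee_fin.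
rewrite -(measure_semi_bigcup mu mE tE mUE).
by apply: le_measure; rewrite ?inE// UE => z [].
Qed.

End AreaInequality.

(** * The logarithmic derivative *)

Section LogarithmicArea.
Context {R : realType}.
Notation leb := (@lebesgue_measure R).
Notation area := (@area R).
Variables (f g : R * R -> R * R) (Df : R * R -> 'M[R]_2).
Hypotheses (cf : continuous f) (cg : continuous g) (gK : cancel g f).
Hypothesis mJ : measurable_fun setT (jac_pos Df).
Hypothesis image_area : forall (A : set (R * R)) (N : R), measurable A -> A `<=` box N ->
  (\int[area]_(z in A) (jac_pos Df z)%:E <= 32%:E * area (g @^-1` A))%E.

Lemma area_box (r : R) : 0 <= r -> area (box r) = (4 * r ^+ 2)%:E.
Proof.
move=> r0; rewrite /area /box product_measure1E//= !lebesgue_measure_itv/= !lte_fin.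
have [rr|rr] := ltP (- r) r; first by rewrite -!EFinB -EFinM; congr EFin; ring.
have -> : r = 0 by lra.
by rewrite mule0 expr0n/= mulr0.
Qed.

Lemma jac_pos_ge0 z : 0 <= jac_pos Df z.
Proof. by rewrite le_max lexx orbT. Qed.

(** f(A) lies in [box r], of area 4 r^2, and the area inequality multiplies this by 32. *)
Lemma integral_jac_pos_le (A : set (R * R)) (N r : R) : measurable A -> A `<=` box N ->
  0 <= r -> (forall z, A z -> `|f z| <= r) ->
  (\int[area]_(z in A) (jac_pos Df z)%:E <= (128 * r ^+ 2)%:E)%E.
Proof.
move=> mA AN r0 fr; apply: (le_trans (image_area mA AN)).
have -> : (128 * r ^+ 2)%:E = (32%:E * area (box r))%E by rewrite area_box// -EFinM; congr EFin; ring.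
apply: lee_wpmul2l; first by rewrite lee_fin.
apply: le_measure; rewrite ?inE.
- exact: (measurable_homeo_preimage cg mA).
- exact: measurable_box.
- by move=> w /fr; rewrite gK => /box_norm.
Qed.

(** 1 / |f| truncated at 1 / m, hence continuous on the whole plane, including the zero of f. *)
Definition inv_norm (m : R) z : R := (Num.max m `|f z|)^-1.

Lemma continuous_norm_f : continuous (fun z => `|f z|).
Proof. by move=> z; apply: cvg_norm; exact: cf. Qed.

Lemma measurable_inv_norm m : 0 < m -> measurable_fun setT (inv_norm m).
Proof.
move=> m0; apply: continuous_measurable2 => z.
apply: cvgV; first by rewrite gt_eqF// lt_max m0.
apply: (@continuous_max R _ (cst m) (fun z => `|f z|)); first exact: cvg_cst.
exact: continuous_norm_f.
Qed.

Lemma inv_norm_ge0 m z : 0 < m -> 0 <= inv_norm m z.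
Proof. by move=> m0; rewrite invr_ge0 le_max ltW. Qed.

Lemma inv_normE m z : m <= `|f z| -> inv_norm m z = `|f z|^-1.
Proof. by move=> h; rewrite /inv_norm; congr (_^-1); apply/max_idPr. Qed.

(* one annulus m 2^i <= |f z| < m 2^(i+1) at a time *)
Lemma logarithmic_area (A : set (R * R)) (N m : R) n : measurable A -> A `<=` box N -> 0 < m ->
  (forall z, A z -> m <= `|f z| < m * 2 ^+ n) ->
  (\int[area]_(z in A) (jac_pos Df z * inv_norm m z ^+ 2)%:E <= (512 * n%:R)%:E)%E.
Proof.
have mF B m' : 0 < m' -> measurable_fun B (fun z => (jac_pos Df z * inv_norm m' z ^+ 2)%:E).
  move=> m0; apply/measurable_EFinP; apply: measurable_funTS; apply: measurable_funM => //.
  by apply: measurable_funX; exact: measurable_inv_norm.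
have F0 m' z : (0 <= (jac_pos Df z * inv_norm m' z ^+ 2)%:E)%E.
  by rewrite lee_fin mulr_ge0 ?jac_pos_ge0 ?sqr_ge0.
elim: n A => [|n IH] A mA AN m0 Am.
  have -> : A = set0 by rewrite -subset0 => z /Am /andP[h1 h2]; move: (le_lt_trans h1 h2); rewrite expr0 mulr1 ltxx.
  by rewrite integral_set0 mulr0.
pose L := [set z | `|f z| < m * 2 ^+ n].
have mL : measurable L.
  apply: measurable_open2; have := @open_comp _ _ (fun z => `|f z|) [set y | y < m * 2 ^+ n].
  by apply; [move=> z _; exact: continuous_norm_f|exact: open_lt].
have mAL : measurable (A `&` L) by exact: measurableI.
have mAD : measurable (A `\` L) by exact: measurableD.
have -> : (\int[area]_(z in A) (jac_pos Df z * inv_norm m z ^+ 2)%:E =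
    \int[area]_(z in A `&` L) (jac_pos Df z * inv_norm m z ^+ 2)%:E +
    \int[area]_(z in A `\` L) (jac_pos Df z * inv_norm m z ^+ 2)%:E)%E.
  rewrite -[in LHS](setUIDK A L); apply: ge0_integral_setU.
  - exact: mAL.
  - exact: mAD.
  - exact: mF.
  - by move=> z _; exact: F0.
  - by apply/disj_set2P; rewrite -subset0 => z [[? ?] [_]].
have -> : (512 * n.+1%:R)%:E = ((512 * n%:R)%:E + 512%:E : \bar R)%E.
  by rewrite -EFinD; congr EFin; rewrite -[n.+1%:R]natr1; ring.
apply: leeD.
  apply: IH => //; first by move=> z [/AN].
  by move=> z [/Am/andP[-> _]].
set r := m * 2 ^+ n.
have r0 : 0 < r by rewrite mulr_gt0// exprn_gt0.
apply: (@le_trans _ _ (\int[area]_(z in A `\` L) ((r ^- 2)%:E * (jac_pos Df z)%:E))%E).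
  apply: ge0_le_integral.
  - exact: mAD.
  - by move=> z _; exact: F0.
  - exact: mF.
  - by apply: measurable_funeM; apply/measurable_EFinP; exact: measurable_funTS.
  - move=> z [Az /negP]; rewrite -leNgt => rf.
    have [mf _] := andP (Am _ Az).
    rewrite -EFinM lee_fin mulrC ler_wpM2r ?jac_pos_ge0// inv_normE//.
    by rewrite -exprVn ler_sqr ?nnegrE ?invr_ge0// ?lef_pV2 ?posrE ?(lt_le_trans r0)// ltW.
rewrite ge0_integralZl//.
(* On the annulus r <= |f| < 2 r the bound is r^-2 times 128 (2 r)^2, that is 512. *)
- apply: (@le_trans _ _ ((r ^- 2)%:E * (128 * (m * 2 ^+ n.+1) ^+ 2)%:E)%E).
    apply: lee_wpmul2l; first by rewrite lee_fin invr_ge0 sqr_ge0.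
    apply: (@integral_jac_pos_le _ N) => //.
    + by move=> z [/AN].
    + by rewrite mulr_ge0 ?exprn_ge0// ltW.
    + by move=> z [/Am/andP[_ /ltW]].
  rewrite -EFinM lee_fin le_eqVlt; apply/orP; left; apply/eqP.
  have -> : m * 2 ^+ n.+1 = 2 * r by rewrite /r exprS; ring.
  by field; rewrite gt_eqF.
- by apply/measurable_EFinP; exact: measurable_funTS.
- by move=> z _; rewrite lee_fin jac_pos_ge0.
- by rewrite lee_fin invr_ge0 sqr_ge0.
Qed.

End LogarithmicArea.

(** * The distortion inequality *)

Section Distortion.
Context {R : realType}.
Notation area := (@area R).
Variables (Df : R * R -> 'M[R]_2).

Lemma entry_le_opnorm (M : 'M[R]_2) i j : `|M i j| <= opnorm M.
Proof.
have cle (z : R * R) : cabs z <= `|z.1| + `|z.2|.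
  rewrite /cabs -(ler_sqr (x := Num.sqrt _)) ?nnegrE ?sqrtr_ge0 ?addr_ge0// sqr_sqrtr ?addr_ge0 ?sqr_ge0//.
  rewrite sqrrD !real_normK ?num_real// lerD2r lerDl mulrn_wge0// mulr_ge0//.
have cge1 (z : R * R) : `|z.1| <= cabs z.
  by rewrite /cabs -sqrtr_sqr ler_sqrt ?lerDl ?addr_ge0 ?sqr_ge0.
have cge2 (z : R * R) : `|z.2| <= cabs z.
  by rewrite /cabs -sqrtr_sqr ler_sqrt ?lerDr ?addr_ge0 ?sqr_ge0.
(* [sup] is an upper bound only for a set known to be bounded above. *)
have hub : has_ubound [set cabs (mxact M h) | h in [set h | cabs h <= 1]].
  exists (`|M 0 0| + `|M 0 1| + (`|M 1 0| + `|M 1 1|)) => _ [h /= h1 <-].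
  apply: le_trans (cle _) _ => /=.
  have e1 : `|h.1| <= 1 := le_trans (cge1 h) h1.
  have e2 : `|h.2| <= 1 := le_trans (cge2 h) h1.
  have m1 (x y : R) : `|y| <= 1 -> `|x * y| <= `|x|.
    by move=> ?; rewrite normrM ler_piMr.
  apply: lerD; (apply: le_trans (ler_normD _ _) _); apply: lerD; exact: m1.
have ent (h : R * R) : cabs h <= 1 -> cabs (mxact M h) <= opnorm M.
  by move=> h1; apply: ub_le_sup => //; exists h.
have c10 : cabs ((1, 0) : R * R) <= 1 by rewrite /cabs/= expr1n expr0n addr0 sqrtr1.
have c01 : cabs ((0, 1) : R * R) <= 1 by rewrite /cabs/= expr1n expr0n add0r sqrtr1.
have a10 := ent _ c10; have a01 := ent _ c01.
have b1 := le_trans (cge1 _) a10; have b2 := le_trans (cge2 _) a10.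
have b3 := le_trans (cge1 _) a01; have b4 := le_trans (cge2 _) a01.
move: b1 b2 b3 b4; rewrite /mxact/= !mulr1 !mulr0 !addr0 !add0r => b1 b2 b3 b4.
have h2 (k : 'I_2) : k = 0 \/ k = 1.
  by case: k => -[|[|//]] ?; [left|right]; apply/val_inj.
by case: (h2 i) => ->; case: (h2 j) => ->.
Qed.

Lemma l1dist_le_opnorm (M : 'M[R]_2) : l1dist M 0 <= 4 * opnorm M.
Proof.
rewrite /l1dist !mxE !subr0.
have := entry_le_opnorm M 0 0; have := entry_le_opnorm M 0 1.
have := entry_le_opnorm M 1 0; have := entry_le_opnorm M 1 1; lra.
Qed.

Lemma opnorm_ge0 (M : 'M[R]_2) : 0 <= opnorm M.
Proof. exact: le_trans (normr_ge0 _) (entry_le_opnorm M 0 0). Qed.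

Lemma distortion_ge0 z : 0 <= distortion Df z.
Proof. by rewrite /distortion; case: ifPn => // /ltW J0; rewrite divr_ge0// sqr_ge0. Qed.

(** The function [K] of the definition has extended values and is not assumed minimal. Where J > 0,
    [distortion] gives equality by definition; elsewhere almost every K z is finite and at least 1,
    so that |Df|^2 <= K J <= 0. *)
Lemma opnorm_sqr_le_distortion (f : R * R -> R * R) : homeo_finite_distortion f Df ->
  {ae area, forall z, opnorm (Df z) ^+ 2 <= distortion Df z * jac_pos Df z}.
Proof.
move=> [_ _ _ _ [K [mK K1 Kfin Kle]]].
move: Kfin Kle; apply: filterS2; first exact: (ae_filter_ringOfSetsType area).
move=> z Kfin Kle; rewrite /distortion; case: ltP => J0.
  by rewrite /jac_pos (max_idPl (ltW J0)) divfK// gt_eqF.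
rewrite mul1r; apply: le_trans (jac_pos_ge0 _ _).
move: Kle; move: (K1 z) Kfin; case: (K z) => // k; rewrite lee_fin => k1 _.
rewrite -EFinM lee_fin => /le_trans; apply.
by rewrite mulr_ge0_le0// (le_trans ler01).
Qed.

Lemma amgm (t a b l : R) : 0 <= t -> 0 <= a -> 0 <= b -> 0 < l -> t ^+ 2 <= a * b ->
  2 * t <= l * a + b / l.
Proof.
move=> t0 a0 b0 l0 tab.
have lb : 0 <= b / l by rewrite divr_ge0// ltW.
have la : 0 <= l * a by rewrite mulr_ge0// ltW.
rewrite -ler_sqr ?nnegrE ?mulr_ge0 ?addr_ge0//.
have e : (l * a) * (b / l) = a * b by field; rewrite gt_eqF.
have := sqr_ge0 (l * a - b / l); rewrite sqrrB sqrrD exprMn e; lra.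
Qed.

End Distortion.

Section LogarithmicDerivative.
Context {R : realType}.
Notation area := (@area R).
Variables (f g : R * R -> R * R) (Df : R * R -> 'M[R]_2).
Hypotheses (cf : continuous f) (cg : continuous g) (gK : cancel g f).
Hypothesis mDf : forall i j, measurable_fun setT (fun z => Df z i j).
Hypothesis mJ : measurable_fun setT (jac_pos Df).
Hypothesis mK : measurable_fun setT (distortion Df).
Hypothesis image_area : forall (A : set (R * R)) (N : R), measurable A -> A `<=` box N ->
  (\int[area]_(z in A) (jac_pos Df z)%:E <= 32%:E * area (g @^-1` A))%E.
Hypothesis fD : {ae area, forall z, opnorm (Df z) ^+ 2 <= distortion Df z * jac_pos Df z}.

(** A majorant of |Df| / |f| where |f| >= m, defined on the whole plane thanks to [inv_norm]. *)
Definition log_deriv (m : R) z := l1dist (Df z) 0 * inv_norm f m z.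

Lemma measurable_log_deriv m : 0 < m -> measurable_fun setT (log_deriv m).
Proof.
move=> m0; apply: measurable_funM; first exact: measurable_l1dist.
exact: measurable_inv_norm.
Qed.

Lemma log_deriv_ge0 m z : 0 < m -> 0 <= log_deriv m z.
Proof. by move=> m0; rewrite mulr_ge0 ?l1dist_ge0 ?inv_norm_ge0. Qed.

(** The entries of [Df] add up to at most 4 |Df|, and [amgm] with weight [l] bounds 4 |Df| / |f| by
    2 l times the distortion plus (2 / l) J / |f|^2. The last term contributes 512 n by
    [logarithmic_area]. *)
Lemma integral_log_deriv (A : set (R * R)) (N m B l : R) n : measurable A -> A `<=` box N -> 0 < m ->
  (forall z, A z -> m <= `|f z| < m * 2 ^+ n) -> 0 < l ->
  (\int[area]_(z in A) (distortion Df z)%:E <= B%:E)%E ->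
  (\int[area]_(z in A) (log_deriv m z)%:E <= (2 * l * B + 1024 * n%:R / l)%:E)%E.
Proof.
move=> mA AN m0 Am l0 AB.
have mJA : measurable_fun A (fun z => (jac_pos Df z * inv_norm f m z ^+ 2)%:E).
  apply/measurable_EFinP; apply: measurable_funTS; apply: measurable_funM => //.
  by apply: measurable_funX; exact: measurable_inv_norm.
have mKA : measurable_fun A (fun z => (distortion Df z)%:E).
  by apply/measurable_EFinP; exact: measurable_funTS.
have J0 z : (0 <= (jac_pos Df z * inv_norm f m z ^+ 2)%:E)%E.
  by rewrite lee_fin mulr_ge0 ?jac_pos_ge0 ?sqr_ge0.
have K0 z : (0 <= (distortion Df z)%:E)%E by rewrite lee_fin distortion_ge0.
have l20 : (0 <= (2 * l)%:E)%E by rewrite lee_fin mulr_ge0// ltW.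
have l21 : (0 <= (2 / l)%:E)%E by rewrite lee_fin divr_ge0// ltW.
apply: (@le_trans _ _ (\int[area]_(z in A) ((2 * l)%:E * (distortion Df z)%:E +
    (2 / l)%:E * (jac_pos Df z * inv_norm f m z ^+ 2)%:E))%E).
  apply: ae_ge0_le_integral.
  - exact: mA.
  - by move=> z _; rewrite lee_fin log_deriv_ge0.
  - by apply/measurable_EFinP; apply: measurable_funTS; exact: measurable_log_deriv.
  - by move=> z _; rewrite adde_ge0// mule_ge0.
  - by apply: emeasurable_funD; apply: measurable_funeM.
  - move: fD; apply: filterS; first exact: (ae_filter_ringOfSetsType area).
    move=> z hz _; rewrite -!EFinM -EFinD lee_fin.
    have iv0 := inv_norm_ge0 f z m0; have K0z := distortion_ge0 Df z; have J0z := jac_pos_ge0 Df z.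
    have t0 : 0 <= opnorm (Df z) * inv_norm f m z by rewrite mulr_ge0// opnorm_ge0.
    have b0 : 0 <= jac_pos Df z * inv_norm f m z ^+ 2 by rewrite mulr_ge0// sqr_ge0.
    have h : (opnorm (Df z) * inv_norm f m z) ^+ 2 <= distortion Df z * (jac_pos Df z * inv_norm f m z ^+ 2).
      have -> : (opnorm (Df z) * inv_norm f m z) ^+ 2 = opnorm (Df z) ^+ 2 * inv_norm f m z ^+ 2 by ring.
      by rewrite [leRHS]mulrA; exact: (ler_wpM2r (sqr_ge0 _) hz).
    have := amgm t0 K0z b0 l0 h.
    have : log_deriv m z <= 4 * opnorm (Df z) * inv_norm f m z.
      by rewrite ler_wpM2r// l1dist_le_opnorm.
    lra.
rewrite ge0_integralD//.
- rewrite ge0_integralZl// ge0_integralZl// EFinD; apply: leeD.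
    by rewrite EFinM; have h := lee_wpmul2l l20 AB; exact: h.
  have -> : 1024 * n%:R / l = 2 / l * (512 * n%:R) by ring.
  rewrite EFinM; have h := lee_wpmul2l l21 (logarithmic_area cf cg gK mJ image_area mA AN m0 Am).
  exact: h.
- by move=> z _; rewrite mule_ge0.
- by apply: measurable_funeM.
- by move=> z _; rewrite mule_ge0.
- by apply: measurable_funeM.
Qed.

End LogarithmicDerivative.

(** * Arguments and their liftings *)

Section Angles.
Context {R : realType}.
Implicit Types (w : R * R) (t th : R).

Lemma cabs_ge0 w : 0 <= cabs w.
Proof. exact: sqrtr_ge0. Qed.

Lemma cabs_sqr w : cabs w ^+ 2 = w.1 ^+ 2 + w.2 ^+ 2.
Proof. by rewrite /cabs sqr_sqrtr// addr_ge0 ?sqr_ge0. Qed.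

Lemma cabs_eq0 w : (cabs w == 0) = (w == 0).
Proof.
rewrite -sqrf_eq0 cabs_sqr paddr_eq0 ?sqr_ge0// !sqrf_eq0.
by case: w => x y /=; rewrite xpair_eqE.
Qed.

Lemma cabs_gt0 w : (0 < cabs w) = (w != 0).
Proof. by rewrite lt_def cabs_ge0 andbT cabs_eq0. Qed.

Lemma cabs_polar r th : 0 <= r -> cabs (polar r th) = r.
Proof.
move=> r0; rewrite /cabs /polar/= !exprMn -mulrDr cos2Dsin2 mulr1.
by rewrite sqrtr_sqr ger0_norm.
Qed.

Lemma norm_le_cabs w : `|w| <= cabs w.
Proof.
rewrite prod_normE/= ge_max; apply/andP; split.
  by rewrite /cabs -sqrtr_sqr ler_sqrt ?lerDl ?addr_ge0 ?sqr_ge0.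
by rewrite /cabs -sqrtr_sqr ler_sqrt ?lerDr ?addr_ge0 ?sqr_ge0.
Qed.

Lemma norm_fst w : `|w.1| <= `|w|.
Proof. by rewrite prod_normE/= le_max lexx. Qed.

Lemma norm_snd w : `|w.2| <= `|w|.
Proof. by rewrite prod_normE/= le_max lexx orbT. Qed.

Lemma cabs_le_norm w : cabs w <= 2 * `|w|.
Proof.
rewrite -ler_sqr ?nnegrE ?cabs_ge0 ?mulr_ge0// cabs_sqr.
have := norm_fst w; have := norm_snd w => h1 h2.
have : w.1 ^+ 2 <= `|w| ^+ 2 by rewrite -[w.1 ^+ 2]real_normK ?num_real// ler_sqr ?nnegrE.
have : w.2 ^+ 2 <= `|w| ^+ 2 by rewrite -[w.2 ^+ 2]real_normK ?num_real// ler_sqr ?nnegrE.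
have := sqr_ge0 `|w|; rewrite exprMn; lra.
Qed.

Definition is_arg w th := w = polar (cabs w) th.

Lemma continuous_pair_fun (T : topologicalType) (F G : T -> R) (x : T) :
  {for x, continuous F} -> {for x, continuous G} -> {for x, continuous (fun y => (F y, G y))}.
Proof. by move=> cF cG; exact: (cvg_pair cF cG). Qed.

Lemma continuous_polar : continuous (fun p : R * R => polar p.1 p.2).
Proof.
move=> p.
have c1 : {for p, continuous (fun p : R * R => p.1 * cos p.2)}.
  apply: cvgM; first exact: cvg_fst.
  by apply: (cvg_comp snd cos); [exact: cvg_snd|exact: continuous_cos].
have c2 : {for p, continuous (fun p : R * R => p.1 * sin p.2)}.
  apply: cvgM; first exact: cvg_fst.
  by apply: (cvg_comp snd sin); [exact: cvg_snd|exact: continuous_sin].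
exact: (continuous_pair_fun c1 c2).
Qed.

Lemma continuous_cabs : continuous (@cabs R).
Proof.
move=> w; apply: (cvg_comp (fun w : R * R => w.1 ^+ 2 + w.2 ^+ 2) Num.sqrt); last exact: sqrt_continuous.
by apply: cvgD; apply: cvgM; exact: cvg_fst || exact: cvg_snd.
Qed.

(* cross product over dot product: the increment of arg from w to w', when it is less than pi/2 *)
Definition dot w w' := w.1 * w'.1 + w.2 * w'.2.
Definition angle w w' := atan ((w.1 * w'.2 - w.2 * w'.1) / dot w w').

(** By Lagrange's identity dot^2 + cross^2 = |w|^2 |w'|^2, cosine and sine of [angle] are dot and
    cross over |w| |w'|; the addition formulas do the rest. *)
Lemma is_arg_add w w' th : is_arg w th -> 0 < dot w w' -> is_arg w' (th + angle w w').
Proof.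
rewrite /is_arg /angle => wth d0; set d := dot w w' in d0 *; set c := _ - _.
have w0 : 0 < cabs w.
  by rewrite cabs_gt0; apply: contraTneq d0 => w0; rewrite /d /dot w0 !mul0r addr0 ltxx.
have dc : d ^+ 2 + c ^+ 2 = (cabs w * cabs w') ^+ 2.
  by rewrite exprMn !cabs_sqr /d /c /dot; ring.
have w'0 : 0 < cabs w'.
  by rewrite cabs_gt0; apply: contraTneq d0 => w0'; rewrite /d /dot w0' !mulr0 addr0 ltxx.
have sE : Num.sqrt (1 + (c / d) ^+ 2) = cabs w * cabs w' / d.
  have -> : 1 + (c / d) ^+ 2 = (cabs w * cabs w' / d) ^+ 2.
    by rewrite [RHS]exprMn -dc; field; rewrite gt_eqF.
  by rewrite sqrtr_sqr ger0_norm// divr_ge0 ?mulr_ge0 ?cabs_ge0// ltW.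
have cE : cos (atan (c / d)) = d / (cabs w * cabs w') by rewrite cos_atan sE invf_div.
have cos0 : cos (atan (c / d)) != 0 by rewrite cE gt_eqF// divr_gt0// mulr_gt0.
have sinE : sin (atan (c / d)) = c / (cabs w * cabs w').
  have := atanK (c / d); rewrite /tan => /(canRL (divfK cos0)) ->.
  by rewrite cE mulrA divfK// gt_eqF.
have [w1 w2] : w.1 = cabs w * cos th /\ w.2 = cabs w * sin th by rewrite {1 3}wth.
have cs : cabs w ^+ 2 = w.1 ^+ 2 + w.2 ^+ 2 by exact: cabs_sqr.
have costh : cos th = w.1 / cabs w by rewrite w1 mulrAC divff ?mul1r// gt_eqF.
have sinth : sin th = w.2 / cabs w by rewrite w2 mulrAC divff ?mul1r// gt_eqF.
rewrite /polar cosD sinD cE sinE costh sinth [w' in LHS]surjective_pairing; congr pair.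
- have -> : w'.1 = (w.1 ^+ 2 + w.2 ^+ 2) * w'.1 / cabs w ^+ 2.
    by rewrite cs mulrAC divff ?mul1r// -cs gt_eqF// exprn_gt0.
  rewrite /c /d /dot; field.
  by rewrite !gt_eqF.
- have -> : w'.2 = (w.1 ^+ 2 + w.2 ^+ 2) * w'.2 / cabs w ^+ 2.
    by rewrite cs mulrAC divff ?mul1r// -cs gt_eqF// exprn_gt0.
  rewrite /c /d /dot; field.
  by rewrite !gt_eqF.
Qed.

Lemma abs_atan_le (x : R) : `|atan x| <= `|x|.
Proof.
have H (y : R) : 0 <= y -> `|atan y| <= `|y|.
  move=> y0; have := @MVT_segment R atan (fun x => (1 + x ^+ 2)^-1) 0 y y0.
  have h1 (z : R) : z \in `]0, y[ -> is_derive z 1 (@atan R) (1 + z ^+ 2)^-1 by move=> _; exact: is_derive1_atan.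
  have h2 : {within `[0, y], continuous (@atan R)} by apply: continuous_subspaceT => z; apply: continuous_atan.
  move=> /(_ h1 h2)[c _]; rewrite atan0 !subr0 => ->; rewrite normrM ler_piMl//.
  have h : 1 <= 1 + c ^+ 2 by rewrite lerDl sqr_ge0.
  by rewrite ger0_norm ?invr_ge0 ?(le_trans ler01)// invf_le1// (lt_le_trans ltr01).
have [|/ltW x0] := leP 0 x; first exact: H.
by rewrite -normrN -atanN -[leRHS]normrN H// oppr_ge0.
Qed.

Lemma dot_ge w w' : `|w' - w| <= `|w| / 4 -> `|w| ^+ 2 / 2 <= dot w w'.
Proof.
move=> h; have -> : dot w w' = (w.1 ^+ 2 + w.2 ^+ 2) + (w.1 * (w'.1 - w.1) + w.2 * (w'.2 - w.2)).
  by rewrite /dot; ring.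
have h1 : `|w'.1 - w.1| <= `|w| / 4 by apply: le_trans (norm_fst (w' - w)) h.
have h2 : `|w'.2 - w.2| <= `|w| / 4 by apply: le_trans (norm_snd (w' - w)) h.
have w0 := normr_ge0 w.
have b1 : `|w.1 * (w'.1 - w.1)| <= `|w| * (`|w| / 4) by rewrite normrM ler_pM// norm_fst.
have b2 : `|w.2 * (w'.2 - w.2)| <= `|w| * (`|w| / 4) by rewrite normrM ler_pM// norm_snd.
have ws : `|w| ^+ 2 <= w.1 ^+ 2 + w.2 ^+ 2.
  rewrite -[w.1 ^+ 2]real_normK ?num_real// -[w.2 ^+ 2]real_normK ?num_real//.
  by rewrite prod_normE/= maxEle; case: ifP => _; rewrite ?lerDl ?lerDr sqr_ge0.
move: b1 b2; rewrite !ler_norml => /andP[b1 _] /andP[b2 _].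
have e : `|w| * (`|w| / 4) = `|w| ^+ 2 / 4 by ring.
rewrite e in b1 b2; lra.
Qed.

Lemma dot_gt0 w w' : w != 0 -> `|w' - w| <= `|w| / 4 -> 0 < dot w w'.
Proof.
move=> w0 /dot_ge; apply: lt_le_trans.
by rewrite divr_gt0// exprn_gt0// normr_gt0.
Qed.

(** The cross product is at most 2 |w| |w' - w|, the dot product at least |w|^2 / 2, and |atan x| <=
    |x|: hence the factor 4. *)
Lemma abs_angle_le w w' : w != 0 -> `|w' - w| <= `|w| / 4 -> `|angle w w'| <= 4 * (`|w' - w| / `|w|).
Proof.
move=> w0 h; apply: le_trans (abs_atan_le _) _.
have d0 := dot_gt0 w0 h; have nw : 0 < `|w| by rewrite normr_gt0.
rewrite normrM normfV (ger0_norm (ltW d0)) ler_pdivrMr//.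
have c1 : `|w.1 * w'.2 - w.2 * w'.1| <= 2 * (`|w| * `|w' - w|).
  have -> : w.1 * w'.2 - w.2 * w'.1 = w.1 * (w'.2 - w.2) - w.2 * (w'.1 - w.1) by ring.
  apply: le_trans (ler_normB _ _) _; rewrite mulr_natl mulr2n; apply: lerD; rewrite normrM ler_pM//.
  - exact: norm_fst.
  - exact: (norm_snd (w' - w)).
  - exact: norm_snd.
  - exact: (norm_fst (w' - w)).
apply: (le_trans c1).
have -> : 2 * (`|w| * `|w' - w|) = 4 * (`|w' - w| / `|w|) * (`|w| ^+ 2 / 2) by field; rewrite gt_eqF.
by rewrite ler_wpM2l ?mulr_ge0 ?divr_ge0// dot_ge.
Qed.

Lemma cos_eq1 (x : R) : cos x = 1 -> `|x| < pi *+ 2 -> x = 0.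
Proof.
have H (y : R) : cos y = 1 -> 0 <= y -> y < pi *+ 2 -> y = 0.
  move=> c1 y0 y2; apply/eqP; apply: contraPT c1 => yn0.
  have {}y0 : 0 < y by rewrite lt_def yn0.
  have : 0 < sin (y / 2) by apply: sin_gt0_pi; rewrite divr_gt0//= ltr_pdivrMr// mulr_natr.
  have := cos2Dsin2 (y / 2); have := cos_mulr2n (y / 2).
  have -> : y / 2 *+ 2 = y by field.
  move=> -> cs s0.
  have := exprn_gt0 2 s0; move=> ?; move=> ?; lra.
move=> cx xb; have [x0|/ltW x0] := leP 0 x.
  by apply: H => //; rewrite -(ger0_norm x0).
by apply: oppr_inj; rewrite oppr0; apply: H; rewrite ?cosN ?oppr_ge0// -(ler0_norm x0).
Qed.

Lemma is_arg_cosB w th th' : w != 0 -> is_arg w th -> is_arg w th' -> cos (th - th') = 1 /\ sin (th - th') = 0.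
Proof.
rewrite -cabs_gt0 => w0 h h'.
have [e1 e2] : polar (cabs w) th = polar (cabs w) th' by rewrite -h -h'.
have {}e1 : cos th = cos th' by apply: (mulfI (lt0r_neq0 w0)).
have {}e2 : sin th = sin th' by apply: (mulfI (lt0r_neq0 w0)).
by rewrite cosB sinB e1 e2 -!expr2 cos2Dsin2 mulrC subrr.
Qed.

Lemma is_arg_inj w th th' : w != 0 -> is_arg w th -> is_arg w th' -> `|th - th'| < pi *+ 2 -> th = th'.
Proof.
by move=> w0 h h' d; apply/eqP; rewrite -subr_eq0; apply/eqP; apply: cos_eq1 d; have [] := is_arg_cosB w0 h h'.
Qed.

(* The difference is continuous with values in 2 pi Z; a value +- pi in between is impossible. *)
Lemma is_arg_path (w : R -> R * R) (A B : R -> R) (a b : R) : a <= b ->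
  {within `[a, b], continuous A} -> {within `[a, b], continuous B} ->
  (forall t, a <= t <= b -> [/\ w t != 0, is_arg (w t) (A t) & is_arg (w t) (B t)]) ->
  A b - B b = A a - B a.
Proof.
move=> ab cA cB wAB; pose D t := A t - B t - (A a - B a).
have cD : {within `[a, b], continuous D}.
  by move=> t; apply: cvgB; [apply: cvgB; [exact: cA|exact: cB]|exact: cvg_cst].
have D1 t : a <= t <= b -> cos (D t) = 1.
  move=> tab; have [wt0 wA wB] := wAB t tab; have aab : a <= a <= b by rewrite lexx.
  have [wa0 waA waB] := wAB a aab.
  have [c1 s1] := is_arg_cosB wt0 wA wB; have [c2 s2] := is_arg_cosB wa0 waA waB.
  by rewrite /D cosB c1 c2 s1 mul0r mulr1 addr0.
have Da : D a = 0 by rewrite /D subrr.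
apply/eqP; rewrite -subr_eq0; apply/eqP; rewrite -/(D b).
have [Db|Db] := ltP `|D b| (pi *+ 2); first by apply: cos_eq1 => //; apply: D1; rewrite lexx ab.
have pi0 := pi_gt0 R.
have cospi' : cos (pi : R) != 1 by rewrite cospi; apply/eqP; lra.
have [Db0|/ltW Db0] := leP 0 (D b).
  rewrite ger0_norm// in Db.
  have [|t] := @IVT R D a b pi ab cD.
    by rewrite Da ge_min le_max; apply/andP; split; apply/orP; [left|right]; rewrite mulr2n in Db; lra.
  by rewrite in_itv/= => tab Dt; move: (D1 t tab); rewrite Dt => /eqP; rewrite (negPf cospi').
rewrite ler0_norm// in Db.
have [|t] := @IVT R D a b (- pi) ab cD.
  by rewrite Da ge_min le_max; apply/andP; split; apply/orP; [right|left]; rewrite mulr2n in Db; lra.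
by rewrite in_itv/= => tab Dt; move: (D1 t tab); rewrite Dt cosN => /eqP; rewrite (negPf cospi').
Qed.

End Angles.

Section Charts.
Context {R : realType}.
Implicit Types (z : R * R).

(** Half-angle tangent with angles measured from the positive y-axis: the denominator y + r vanishes
    only on the negative y-axis, away from the half-plane in which the formula is used. *)
Lemma half_angle (x y r : R) : 0 < r -> r ^+ 2 = x ^+ 2 + y ^+ 2 -> 0 < y + r ->
  cos (atan (x / (y + r)) *+ 2) = y / r /\ sin (atan (x / (y + r)) *+ 2) = x / r.
Proof.
move=> r0 rE d0; set u := x / (y + r).
have u1 : 1 + u ^+ 2 = 2 * r / (y + r).
  have -> : 1 + u ^+ 2 = ((y + r) ^+ 2 + x ^+ 2) / (y + r) ^+ 2 by rewrite /u; field; rewrite gt_eqF.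
  have -> : (y + r) ^+ 2 + x ^+ 2 = 2 * r * (y + r).
    have -> : x ^+ 2 = r ^+ 2 - y ^+ 2 by rewrite rE addrK.
    by ring.
  by field; rewrite gt_eqF.
have up : 0 < 1 + u ^+ 2 by rewrite ltr_wpDr ?sqr_ge0.
have c2 : cos (atan u) ^+ 2 = (y + r) / (2 * r).
  by rewrite cos_atan exprVn sqr_sqrtr ?ltW// u1 invf_div.
have c0 : cos (atan u) != 0.
  by rewrite -sqrf_eq0 c2 gt_eqF// divr_gt0// mulr_gt0.
have sE : sin (atan u) = u * cos (atan u).
  by have := atanK u; rewrite /tan => /(canRL (divfK c0)).
split; first by rewrite cos_mulr2n c2; field; rewrite gt_eqF.
rewrite sin_mulr2n sE mulrCA -expr2 c2 /u; field.
by rewrite !gt_eqF.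
Qed.

(** Arguments in [0, 2 pi[, the range of angles in [arg_branch]: [chart_up] is used on the closed
    upper half-plane without 0, [chart_dn] on the open lower one, and each is continuous there. *)
Definition chart_up z : R := pi / 2 - atan (z.1 / (z.2 + cabs z)) *+ 2.
Definition chart_dn z : R := pi + (pi / 2 + atan (z.1 / (- z.2 + cabs z)) *+ 2).

Lemma is_arg_chart_up z : z != 0 -> 0 < z.2 + cabs z -> is_arg z (chart_up z).
Proof.
rewrite -cabs_gt0 => z0 d0; have [cE sE] := half_angle z0 (cabs_sqr z) d0.
rewrite /is_arg /polar /chart_up cosB sinB cos_pihalf sin_pihalf cE sE !mul0r !mul1r add0r subr0.
by rewrite ![cabs z * _]mulrC !divfK ?gt_eqF// -surjective_pairing.
Qed.

Lemma is_arg_chart_dn z : z != 0 -> 0 < - z.2 + cabs z -> is_arg z (chart_dn z).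
Proof.
rewrite -cabs_gt0 => z0 d0.
have [cE sE] := @half_angle z.1 (- z.2) _ z0 (etrans (cabs_sqr z) (congr1 _ (esym (sqrrN _)))) d0.
rewrite /is_arg /polar /chart_dn ![pi + (_ + _)]addrC cosDpi sinDpi ![pi / 2 + _]addrC cosDpihalf sinDpihalf.
rewrite cE sE mulNr !opprK.
by rewrite ![cabs z * _]mulrC !divfK ?gt_eqF// -surjective_pairing.
Qed.

Lemma is_arg_exists z : z != 0 -> exists th, is_arg z th.
Proof.
move=> z0; have r0 : 0 < cabs z by rewrite cabs_gt0.
have [y0|y0] := leP 0 z.2.
  by exists (chart_up z); apply: is_arg_chart_up => //; rewrite ltr_wpDl.
by exists (chart_dn z); apply: is_arg_chart_dn => //; rewrite ltr_wpDl// oppr_ge0 ltW.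
Qed.

Lemma chart_up_range z : 0 <= z.2 -> z != 0 -> 0 <= chart_up z < 2 * pi.
Proof.
rewrite -cabs_gt0 => y0 z0; have pi0 := pi_gt0 R.
have x1 := le_trans (norm_fst z) (norm_le_cabs z); have d0 : 0 < z.2 + cabs z by rewrite ltr_wpDl.
set u := z.1 / (z.2 + cabs z).
have u1 : `|u| <= 1 by rewrite /u normrM normfV (gtr0_norm d0) ler_pdivrMr// mul1r; lra.
have : `|atan u| <= pi / 4.
  rewrite -(atan1 R) ler_norml -atanN !le_atan//; last by move: u1; rewrite ler_norml => /andP[].
  by move: u1; rewrite ler_norml => /andP[].
by rewrite /chart_up -/u [atan u *+ 2]mulr2n ler_norml => /andP[? ?]; apply/andP; split; lra.
Qed.

Lemma chart_dn_range z : z.2 < 0 -> 0 <= chart_dn z < 2 * pi.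
Proof.
move=> y0; have z0 : 0 < cabs z.
  by rewrite cabs_gt0; apply: contraTneq y0 => ->; rewrite ltxx.
have pi0 := pi_gt0 R.
have x1 := le_trans (norm_fst z) (norm_le_cabs z); have d0 : 0 < - z.2 + cabs z by lra.
set u := z.1 / (- z.2 + cabs z).
have u1 : `|u| < 1 by rewrite /u normrM normfV (gtr0_norm d0) ltr_pdivrMr// mul1r; lra.
have : `|atan u| < pi / 4.
  rewrite -(atan1 R) ltr_norml -atanN !lt_atan//; last by move: u1; rewrite ltr_norml => /andP[].
  by move: u1; rewrite ltr_norml => /andP[].
by rewrite /chart_dn -/u [atan u *+ 2]mulr2n ltr_norml => /andP[? ?]; apply/andP; split; lra.
Qed.

Lemma continuous_chart_up z : 0 < z.2 + cabs z -> {for z, continuous chart_up}.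
Proof.
move=> d0; apply: cvgB; first exact: cvg_cst.
have c : {for z, continuous (fun z => atan (z.1 / (z.2 + cabs z)))}.
  apply: (cvg_comp (fun z : R * R => z.1 / (z.2 + cabs z)) (@atan R)); last exact: continuous_atan.
  apply: cvgM; first exact: cvg_fst.
  apply: cvgV; first by rewrite gt_eqF.
  by apply: cvgD; [exact: cvg_snd|exact: continuous_cabs].
by rewrite /= mulr2n; exact: (cvgD c c).
Qed.

Lemma continuous_chart_dn z : 0 < - z.2 + cabs z -> {for z, continuous chart_dn}.
Proof.
move=> d0; apply: cvgD; first exact: cvg_cst.
apply: cvgD; first exact: cvg_cst.
have c : {for z, continuous (fun z => atan (z.1 / (- z.2 + cabs z)))}.
  apply: (cvg_comp (fun z : R * R => z.1 / (- z.2 + cabs z)) (@atan R)); last exact: continuous_atan.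
  apply: cvgM; first exact: cvg_fst.
  apply: cvgV; first by rewrite gt_eqF.
  by apply: cvgD; [apply: cvgN; exact: cvg_snd|exact: continuous_cabs].
by rewrite /= mulr2n; exact: (cvgD c c).
Qed.

End Charts.

(** * Continuous arguments on rectangles *)

Section Lifting.
Context {R : realType}.

Lemma unif_continuous_compact (V W : normedModType R) (F : V -> W) (K : set V) (e : R) :
  compact K -> continuous F -> 0 < e ->
  exists2 d : R, 0 < d & forall z w, K z -> `|z - w| < d -> `|F z - F w| < e.
Proof.
move=> /compact_near_coveringP cK cF e0.
pose P (d : R) (z : V) := forall w : V, `|z - w| < d -> `|F z - F w| < e.
have : \forall d \near 0^'+, K `<=` P d.
  apply: cK => z _; have e20 : 0 < e / 2 by rewrite divr_gt0.
  have /cvgrPdist_lt/(_ _ e20)/nbhs_ballP[r /= r0 Hr] := cF z.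
  exists (ball z (r / 2), [set d | d < r / 2]) => /=.
    split; first by apply: nbhsx_ballx; rewrite divr_gt0.
    by apply: nbhs_right_lt; rewrite divr_gt0.
  move=> [z' d] [/= zz' dr] w z'w.
  have zr : ball z r z' by apply: le_ball zz'; lra.
  have wr : ball z r w.
    rewrite -ball_normE /ball_/=; rewrite -ball_normE /ball_/= in zz'.
    have -> : z - w = (z - z') + (z' - w) by rewrite addrA subrK.
    by apply: le_lt_trans (ler_normD _ _) _; lra.
  have -> : F z' - F w = (F z - F w) - (F z - F z') by rewrite opprB [RHS]addrC addrA subrK.
  apply: le_lt_trans (ler_normB _ _) _.
  by have := Hr _ zr; have := Hr _ wr; rewrite /=; lra.
move=> HP; near (0 : R)^'+ => d; exists d => //.
by move=> z w Kz; have := near HP d; apply => //.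
Unshelve. all: by end_near. Qed.

Lemma norm_min_compact (F : R * R -> R * R) (K : set (R * R)) : compact K -> continuous F ->
  (forall z, K z -> F z != 0) -> exists2 m : R, 0 < m & forall z, K z -> m <= `|F z|.
Proof.
move=> /compact_near_coveringP cK cF F0.
have : \forall m \near 0^'+, K `<=` (fun z => m <= `|F z|).
  apply: (cK _ _ (fun m z => m <= `|F z|)) => z /F0 Fz0.
  have e0 : 0 < `|F z| / 2 by rewrite divr_gt0// normr_gt0.
  have /cvgrPdist_lt/(_ _ e0) Hr := cF z.
  exists ([set z' | `|F z - F z'| < `|F z| / 2], [set m | m < `|F z| / 2]) => /=.
    by split; [exact: Hr|exact: nbhs_right_lt].
  move=> [z' m] [/= h1 h2].
  have : `|F z| <= `|F z'| + `|F z - F z'|.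
    by rewrite -{1}(subrK (F z') (F z)) [leRHS]addrC; exact: ler_normD.
  by lra.
move=> HP; near (0 : R)^'+ => m; exists m => //.
by near: m.
Unshelve. all: by end_near. Qed.

Lemma continuous_angle (T : topologicalType) (u v : T -> R * R) (x : T) :
  {for x, continuous u} -> {for x, continuous v} -> dot (u x) (v x) != 0 ->
  {for x, continuous (fun y => angle (u y) (v y))}.
Proof.
move=> cu cv d0.
have u1 : {for x, continuous (fun y => (u y).1)} by apply: (cvg_comp u fst cu); exact: cvg_fst.
have u2 : {for x, continuous (fun y => (u y).2)} by apply: (cvg_comp u snd cu); exact: cvg_snd.
have v1 : {for x, continuous (fun y => (v y).1)} by apply: (cvg_comp v fst cv); exact: cvg_fst.
have v2 : {for x, continuous (fun y => (v y).2)} by apply: (cvg_comp v snd cv); exact: cvg_snd.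
apply: (cvg_comp _ (@atan R)); last exact: continuous_atan.
apply: cvgM; first by apply: cvgB; apply: cvgM.
by apply: cvgV => //; apply: cvgD; apply: cvgM.
Qed.

Definition rect (a b c d : R) : set (R * R) := `[a, b]%classic `*` `[c, d]%classic.

Lemma rectP a b c d z : rect a b c d z <-> [/\ a <= z.1, z.1 <= b, c <= z.2 & z.2 <= d].
Proof.
rewrite /rect /= !in_itv/=; split; first by move=> [/andP[? ?] /andP[? ?]].
by move=> [-> -> -> ->].
Qed.

Lemma compact_rect a b c d : compact (rect a b c d).
Proof. by apply: compact_setX; exact: segment_compact. Qed.

(* Sum of increments of arg f along n + 1 equal steps from a corner; clamping makes the formula
   continuous on the whole plane. *)
Lemma lift_rect (f : R * R -> R * R) (a b c d : R) : a <= b -> c <= d -> continuous f ->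
  (forall z, rect a b c d z -> f z != 0) ->
  exists2 B : R * R -> R, continuous B & forall z, rect a b c d z -> is_arg (f z) (B z).
Proof.
move=> ab cd cf f0; set K := rect a b c d in f0 *.
have cK : compact K by exact: compact_rect.
have [m m0 Km] := norm_min_compact cK cf f0.
have m40 : 0 < m / 4 by rewrite divr_gt0.
have [dl dl0 Hdl] := unif_continuous_compact cK cf m40.
pose clamp (p q x : R) := Num.max p (Num.min q x).
have clamp_id p q x : p <= x <= q -> clamp p q x = x.
  by move=> /andP[h1 h2]; rewrite /clamp (min_idPr h2) (max_idPr h1).
have clamp_in p q x : p <= q -> p <= clamp p q x <= q.
  by move=> pq; rewrite /clamp le_max lexx /= ge_max pq ge_min lexx.
have cclamp p q : continuous (clamp p q).
  move=> x; apply: (@continuous_max R _ (cst p) (fun x => Num.min q x)); first exact: cvg_cst.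
  apply: (@continuous_min R _ (cst q) id); [exact: cvg_cst|exact: cvg_id].
pose pr (z : R * R) : R * R := (clamp a b z.1, clamp c d z.2).
(* [pr] projects to the rectangle; [q t z] is the point at fraction [t] of the segment from the
   corner (a, c) to [pr z]. *)
pose q (t : R) (z : R * R) : R * R := (a + t * ((pr z).1 - a), c + t * ((pr z).2 - c)).
have cq t : continuous (q t).
  move=> z.
  have c1 : {for z, continuous (fun z => a + t * ((pr z).1 - a))}.
    apply: cvgD; first exact: cvg_cst.
    apply: cvgM; first exact: cvg_cst.
    apply: cvgB; last exact: cvg_cst.
    by apply: (cvg_comp fst (clamp a b)); [exact: cvg_fst|exact: cclamp].
  have c2 : {for z, continuous (fun z => c + t * ((pr z).2 - c))}.
    apply: cvgD; first exact: cvg_cst.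
    apply: cvgM; first exact: cvg_cst.
    apply: cvgB; last exact: cvg_cst.
    by apply: (cvg_comp snd (clamp c d)); [exact: cvg_snd|exact: cclamp].
  exact: (continuous_pair_fun c1 c2).
have qK t z : 0 <= t <= 1 -> K (q t z).
  move=> /andP[t0 t1]; apply/rectP => /=.
  have /andP[p1 p2] := clamp_in a b z.1 ab; have /andP[p3 p4] := clamp_in c d z.2 cd.
  have h x y : x <= y -> x <= x + t * (y - x) <= y.
    by move=> xy; rewrite lerDl mulr_ge0 ?subr_ge0//= -lerBrDl ler_piMl// subr_ge0.
  have /andP[? ?] := h _ _ p1; have /andP[? ?] := h _ _ p3.
  by split => //; [apply: le_trans p2|apply: le_trans p4].
(* Both sides are at most [L], so one of n + 1 steps is shorter than [dl], and over a step f moves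
   by at most a quarter of its norm: [angle] gives the increment of the argument. *)
pose L := (b - a) + (d - c) + 1.
have L0 : 0 < L by rewrite /L; lra.
have [n Hn] : exists n : nat, L / n.+1%:R < dl.
  exists (Num.truncn (L / dl)); rewrite ltr_pdivrMr// mulrC -ltr_pdivrMr//; exact: truncnS_gt.
pose tk (k : nat) : R := k%:R / n.+1%:R.
have tk01 k : (k <= n.+1)%N -> 0 <= tk k <= 1.
  by move=> kn; rewrite /tk divr_ge0//= ler_pdivrMr// mul1r ler_nat.
have step k z : (k < n.+1)%N -> `|q (tk k) z - q (tk k.+1) z| < dl.
  move=> kn; apply: le_lt_trans Hn.
  have tE : tk k.+1 = tk k + n.+1%:R^-1 by rewrite /tk -natr1 mulrDl mul1r.
  have /andP[p1 p2] := clamp_in a b z.1 ab; have /andP[p3 p4] := clamp_in c d z.2 cd.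
  have i0 : 0 < n.+1%:R^-1 :> R by rewrite invr_gt0.
  have hh x y : x <= y -> y - x <= L -> `|x + tk k * (y - x) - (x + tk k.+1 * (y - x))| <= L / n.+1%:R.
    move=> xy yL; have -> : x + tk k * (y - x) - (x + tk k.+1 * (y - x)) = - ((y - x) * n.+1%:R^-1).
      by rewrite tE; ring.
    by rewrite normrN ger0_norm ?mulr_ge0 ?subr_ge0 ?(ltW i0)// ler_pM2r.
  rewrite prod_normE/= ge_max; apply/andP; split; apply: hh => //=; rewrite /pr/= /L; lra.
have dot0 k z : (k < n.+1)%N -> 0 < dot (f (q (tk k) z)) (f (q (tk k.+1) z)).
  move=> kn; have Kk := qK _ z (tk01 k (ltnW kn)).
  apply: dot_gt0; first exact: f0.
  rewrite distrC; apply: ltW; apply: lt_le_trans (Hdl _ _ Kk (step k z kn)) _.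
  by rewrite ler_pM2r// Km.
have [th0 Hth0] : exists th, is_arg (f (a, c)) th.
  by apply: is_arg_exists; apply: f0; apply/rectP; split => /=.
pose S j z := th0 + \sum_(k < j) angle (f (q (tk k) z)) (f (q (tk k.+1) z)).
have argS j z : (j <= n.+1)%N -> is_arg (f (q (tk j) z)) (S j z).
  elim: j => [|j IH] jn.
    rewrite /S big_ord0 addr0 (_ : q (tk 0) z = (a, c))//.
    by rewrite /q /tk !mul0r !addr0.
  by rewrite /S big_ord_recr/= addrA; apply: is_arg_add (dot0 _ _ jn); apply: IH; exact: ltnW.
have cS j : (j <= n.+1)%N -> continuous (S j).
  elim: j => [|j IH] jn z.
    rewrite (_ : S 0%N = cst th0); first exact: cvg_cst.
    by apply/funext => w; rewrite /S big_ord0 addr0.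
  rewrite (_ : S j.+1 = fun z => S j z + angle (f (q (tk j) z)) (f (q (tk j.+1) z))); last first.
    by apply/funext => w; rewrite /S big_ord_recr/= addrA.
  apply: cvgD; first by apply: IH; exact: ltnW.
  apply: (@continuous_angle _ (fun z => f (q (tk j) z)) (fun z => f (q (tk j.+1) z))).
  - by apply: (cvg_comp (q (tk j)) f); [exact: cq|exact: cf].
  - by apply: (cvg_comp (q (tk j.+1)) f); [exact: cq|exact: cf].
  - by rewrite gt_eqF// dot0.
exists (S n.+1); first exact: cS.
move=> z /rectP[z1 z2 z3 z4].
have -> : f z = f (q (tk n.+1) z).
  rewrite /q /tk divff// !mul1r /pr !clamp_id ?z1 ?z2 ?z3 ?z4//=.
  by congr (f _); rewrite ![_ + (_ - _)]addrC !subrK -surjective_pairing.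
exact: argS.
Qed.

End Lifting.

(** * Variation of the argument *)

Section PathVariation.
Context {R : realType}.
Notation leb := (@lebesgue_measure R).
Variables (w : R -> R * R) (th l : R -> R) (m y1 y2 : R).
Hypotheses (m0 : 0 < m) (cw : continuous w) (cth : continuous th).
Hypotheses (ml : measurable_fun setT l) (l0 : forall t, 0 <= l t).
Hypothesis arg_th : forall t, y1 <= t <= y2 -> m <= `|w t| /\ is_arg (w t) (th t).
Hypothesis speed : forall s t, y1 <= s -> s <= t -> t <= y2 ->
  (`|w t - w s|%:E <= \int[leb]_(x in `[s, t[) (l x)%:E)%E.

Let iv x : R := (Num.max m `|w x|)^-1.

Let civ : continuous iv.
Proof.
move=> x; apply: cvgV; first by rewrite gt_eqF// lt_max m0.
apply: (@continuous_max R _ (cst m) (fun x => `|w x|)); first exact: cvg_cst.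
by apply: cvg_norm; exact: cw.
Qed.

Let iv0 x : 0 <= iv x.
Proof. by rewrite invr_ge0 le_max ltW. Qed.

Let mliv (D : set R) : measurable_fun D (fun x => (l x * iv x)%:E).
Proof.
apply/measurable_EFinP; apply: measurable_funTS; apply: measurable_funM => //.
exact: continuous_measurable_fun.
Qed.

Let liv0 x : (0 <= (l x * iv x)%:E)%E.
Proof. by rewrite lee_fin mulr_ge0. Qed.

(** Over so short an interval the increment of [th] is [angle], at most 4 / |w s| times the integral
    of [l]; then |w x| <= 2 |w s| brings |w x| under the integral, hence 8. *)
Lemma path_variation_local s t : y1 <= s -> s <= t -> t <= y2 ->
  (forall x, s <= x <= t -> `|w s - w x| <= m / 4) -> `|th s - th t| <= 1 ->
  (`|th t - th s|%:E <= 8%:E * \int[leb]_(x in `[s, t[) (l x * iv x)%:E)%E.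
Proof.
move=> ys st ty2 wst tst.
have [ms as_] : m <= `|w s| /\ is_arg (w s) (th s) by apply: arg_th; rewrite ys (le_trans st).
have [mt at_] : m <= `|w t| /\ is_arg (w t) (th t) by apply: arg_th; rewrite ty2 (le_trans ys).
have ws0 : w s != 0 by rewrite -normr_gt0 (lt_le_trans m0).
have wt0 : w t != 0 by rewrite -normr_gt0 (lt_le_trans m0).
have nws : 0 < `|w s| by rewrite normr_gt0.
have d4 : `|w t - w s| <= `|w s| / 4.
  rewrite distrC; apply: le_trans (wst t _) _; first by rewrite st lexx.
  by rewrite ler_pM2r.
have al := abs_angle_le ws0 d4.
have al1 : `|angle (w s) (w t)| <= 1.
  apply: (le_trans al); rewrite -ler_pdivlMl// mulr1 ler_pdivrMr// mulrC//.
(* Two arguments of w t that differ by at most 2, less than 2 pi, coincide. *)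
have tE : th t = th s + angle (w s) (w t).
  apply: (is_arg_inj wt0 at_); first exact: is_arg_add (dot_gt0 ws0 d4).
  rewrite opprD addrA; apply: le_lt_trans (ler_normB _ _) _.
  rewrite distrC; have := pi_ge2 R; rewrite mulr2n; lra.
have -> : th t - th s = angle (w s) (w t) by rewrite tE addrC addKr.
apply: (@le_trans _ _ ((4 / `|w s|)%:E * \int[leb]_(x in `[s, t[) (l x)%:E)%E).
  apply: (@le_trans _ _ (4 / `|w s| * `|w t - w s|)%:E).
    by rewrite lee_fin; apply: (le_trans al); rewrite mulrA mulrAC.
  by rewrite EFinM; apply: lee_wpmul2l; [rewrite lee_fin divr_ge0// ltW|exact: speed].
have mL : measurable_fun `[s, t[ (fun x => (l x)%:E).
  by apply/measurable_EFinP; exact: measurable_funTS.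
have k0 : 0 <= 4 / `|w s| by rewrite divr_ge0// ltW.
rewrite -ge0_integralZl//; last by move=> x _; rewrite lee_fin.
rewrite -[leRHS]ge0_integralZl//; last exact: mliv.
apply: ge0_le_integral => //.
- by move=> x _; rewrite -EFinM lee_fin mulr_ge0.
- by apply: measurable_funeM.
- by apply: measurable_funeM; exact: mliv.
move=> x; rewrite /= in_itv/= => /andP[sx xt].
rewrite -!EFinM lee_fin [leRHS]mulrCA [leLHS]mulrC ler_wpM2l//.
have [mx _] : m <= `|w x| /\ is_arg (w x) (th x).
  by apply: arg_th; rewrite (le_trans ys sx) (le_trans (ltW xt)).
rewrite /iv (max_idPr mx) ler_pdivrMr// mulrAC ler_pdivlMr ?(lt_le_trans m0)//.
have : `|w x| <= `|w s| + `|w s - w x|.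
  by rewrite -[X in `|X| <= _](subrK (w s)) [leRHS]addrC [`|w s - _|]distrC; exact: ler_normD.
have := wst x; rewrite sx (ltW xt) => /(_ isT); lra.
Qed.

(** Uniform continuity of [w] and [th] gives one length [d] for which the local estimate holds;
    induction on the number of steps of this length adds the estimates up. *)
Lemma path_variation : y1 <= y2 ->
  (`|th y2 - th y1|%:E <= 8%:E * \int[leb]_(x in `[y1, y2[) (l x * iv x)%:E)%E.
Proof.
move=> y12.
have m40 : 0 < m / 4 by rewrite divr_gt0.
have cI : compact (`[y1, y2]%classic : set R) by exact: segment_compact.
have [d1 d10 H1] := unif_continuous_compact cI cw m40.
have [d2 d20 H2] := unif_continuous_compact cI cth (@ltr01 R).
pose d : R := Num.min d1 d2 / 2.
have d0 : 0 < d by rewrite divr_gt0// lt_min d10.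
have dd1 : d < d1.
  have h : Num.min d1 d2 <= d1 by rewrite ge_min lexx.
  by rewrite /d; lra.
have dd2 : d < d2.
  have h : Num.min d1 d2 <= d2 by rewrite ge_min lexx orbT.
  by rewrite /d; lra.
have loc s t : y1 <= s -> s <= t -> t <= y2 -> t - s <= d ->
    (`|th t - th s|%:E <= 8%:E * \int[leb]_(x in `[s, t[) (l x * iv x)%:E)%E.
  move=> ys st ty std.
  have sI : `[y1, y2]%classic s by rewrite /= in_itv/= ys (le_trans st).
  apply: path_variation_local => //.
    move=> x /andP[sx xt]; apply: ltW; apply: (H1 s x sI).
    by rewrite distrC ger0_norm ?subr_ge0//; apply: le_lt_trans dd1; lra.
  apply: ltW; apply: (H2 s t sI); rewrite distrC ger0_norm ?subr_ge0//.
  exact: le_lt_trans dd2.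
have IH n : forall s t, y1 <= s -> s <= t -> t <= y2 -> t - s <= n%:R * d ->
    (`|th t - th s|%:E <= 8%:E * \int[leb]_(x in `[s, t[) (l x * iv x)%:E)%E.
  elim: n => [|n IH] s t ys st ty tsn.
    by apply: loc => //; apply: (le_trans tsn); rewrite mul0r ltW.
  have [ts|/ltW ts] := leP (t - s) d; first exact: loc.
  have sd : s <= s + d by rewrite lerDl ltW.
  have dt : s + d <= t by rewrite addrC -lerBrDr.
  have tsn' : t - (s + d) <= n%:R * d by rewrite -natr1 mulrDl mul1r in tsn; lra.
  have e1 : (`|th (s + d) - th s|%:E <= 8%:E * \int[leb]_(x in `[s, (s + d)%R[) (l x * iv x)%:E)%E.
    by apply: loc => //; [apply: le_trans ty|rewrite addrAC subrr add0r].
  have e2 := IH (s + d) t (le_trans ys sd) dt ty tsn'.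
  have -> : (\int[leb]_(x in `[s, t[) (l x * iv x)%:E =
     \int[leb]_(x in `[s, (s + d)%R[) (l x * iv x)%:E + \int[leb]_(x in `[(s + d)%R, t[) (l x * iv x)%:E)%E.
    rewrite (@itv_bndbnd_setU _ _ (BLeft s) (BLeft (s + d)) (BLeft t)) ?bnd_simp//.
    apply: ge0_integral_setU => //; first exact: mliv.
    by apply/disj_set2P; rewrite -subset0 => x [/=]; rewrite !in_itv/= => /andP[_ h1] /andP[h2 _]; lra.
  have cD (x y : \bar R) : (0 <= x)%E -> (0 <= y)%E -> (8%:E * (x + y) = 8%:E * x + 8%:E * y)%E.
    by move=> x0 y0; rewrite ge0_muleDr.
  rewrite cD; [|by apply: integral_ge0..].
  apply: le_trans (leeD e1 e2).
  rewrite -EFinD lee_fin [leRHS]addrC; have -> : th t - th s = (th t - th (s + d)) + (th (s + d) - th s) by rewrite addrA subrK.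
  exact: ler_normD.
apply: (IH (Num.truncn ((y2 - y1) / d)).+1) => //.
by rewrite -ler_pdivrMr// ltW// truncnS_gt.
Qed.

End PathVariation.

Section LineVariation.
Context {R : realType}.
Notation leb := (@lebesgue_measure R).
Variables (f : R * R -> R * R) (Df : R * R -> 'M[R]_2) (B : R * R -> R) (m : R).
Hypotheses (cf : continuous f) (cB : continuous B) (m0 : 0 < m).
Hypothesis mDf : forall i j, measurable_fun setT (fun z => Df z i j).

Lemma ac_line_speed (u g l : R -> R) s t : ac_line u g -> s <= t ->
  measurable_fun setT g -> measurable_fun setT l -> (forall x, `|g x| <= l x) ->
  (`|u t - u s|%:E <= \int[leb]_(x in `[s, t[) (l x)%:E)%E.
Proof.
move=> ac st mg ml gl; have := ac s t 0 st; rewrite mul0r subr0 => /le_trans; apply.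
rewrite integral_itv_bndo_bndc; last by apply/measurable_EFinP; exact: measurable_funTS.
apply: ge0_le_integral => //.
- apply/measurable_EFinP; apply: measurable_funTS; apply: measurableT_comp => //.
  by apply: measurable_funB.
- by apply/measurable_EFinP; exact: measurable_funTS.
- by move=> x _; rewrite lee_fin subr0.
Qed.

Lemma vline_variation (x c d y1 y2 e : R) : good_vline f Df x -> c <= y1 -> y1 <= y2 -> y2 < d ->
  (forall y, y1 <= y <= y2 -> m <= `|f (x, y)| /\ is_arg (f (x, y)) (B (x, y))) ->
  (\int[leb]_(y in `[c, d[) (log_deriv f Df m (x, y))%:E <= e%:E)%E ->
  `|B (x, y2) - B (x, y1)| <= 8 * e.
Proof.
move=> [g1 g2] cy y12 yd H ie.
have mld : measurable_fun setT (fun y => l1dist (Df (x, y)) 0).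
  exact: (measurable_fun_pair2 x (measurable_l1dist mDf 0)).
have ent i j y : `|Df (x, y) i j| <= l1dist (Df (x, y)) 0.
  by have := l1dist_entry (Df (x, y)) 0 i j; rewrite mxE subr0.
have := @path_variation R (fun y => f (x, y)) (fun y => B (x, y)) (fun y => l1dist (Df (x, y)) 0) m y1 y2 m0.
have c1 : continuous (fun y => f (x, y)).
  by move=> y; apply: (cvg_comp (pair x) f); [exact: continuous_pairr|exact: cf].
have c2 : continuous (fun y => B (x, y)).
  by move=> y; apply: (cvg_comp (pair x) B); [exact: continuous_pairr|exact: cB].
move=> /(_ c1 c2 mld (fun y => l1dist_ge0 _ _) H) h.
rewrite -lee_fin; apply: le_trans (h _ y12) _.
  move=> s t _ st _; rewrite prod_normE/= EFin_max ge_max; apply/andP; split.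
    exact: (ac_line_speed g1 st (measurable_fun_pair2 x (mDf 0 1)) mld (ent 0 1)).
  exact: (ac_line_speed g2 st (measurable_fun_pair2 x (mDf 1 1)) mld (ent 1 1)).
rewrite EFinM; apply: lee_wpmul2l; first by rewrite lee_fin.
apply: le_trans ie; apply: ge0_subset_integral => //.
- apply/measurable_EFinP; apply: measurable_funTS.
  exact: (measurable_fun_pair2 x (measurable_log_deriv cf mDf m0)).
- by move=> y _; rewrite lee_fin log_deriv_ge0.
- by move=> y /=; rewrite !in_itv/= => /andP[h1 h2]; rewrite (le_trans cy h1) (lt_trans h2 yd).
Qed.

Lemma hline_variation (y a b x1 x2 e : R) : good_hline f Df y -> a <= x1 -> x1 <= x2 -> x2 < b ->
  (forall x, x1 <= x <= x2 -> m <= `|f (x, y)| /\ is_arg (f (x, y)) (B (x, y))) ->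
  (\int[leb]_(x in `[a, b[) (log_deriv f Df m (x, y))%:E <= e%:E)%E ->
  `|B (x2, y) - B (x1, y)| <= 8 * e.
Proof.
move=> [g1 g2] ax x12 xb H ie.
have mld : measurable_fun setT (fun x => l1dist (Df (x, y)) 0).
  exact: (measurable_fun_pair1 y (measurable_l1dist mDf 0)).
have ent i j x : `|Df (x, y) i j| <= l1dist (Df (x, y)) 0.
  by have := l1dist_entry (Df (x, y)) 0 i j; rewrite mxE subr0.
have := @path_variation R (fun x => f (x, y)) (fun x => B (x, y)) (fun x => l1dist (Df (x, y)) 0) m x1 x2 m0.
have c1 : continuous (fun x => f (x, y)).
  by move=> x; apply: (cvg_comp (fun x => (x, y)) f); [exact: continuous_pairl|exact: cf].
have c2 : continuous (fun x => B (x, y)).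
  by move=> x; apply: (cvg_comp (fun x => (x, y)) B); [exact: continuous_pairl|exact: cB].
move=> /(_ c1 c2 mld (fun x => l1dist_ge0 _ _) H) h.
rewrite -lee_fin; apply: le_trans (h _ x12) _.
  move=> s t _ st _; rewrite prod_normE/= EFin_max ge_max; apply/andP; split.
    exact: (ac_line_speed g1 st (measurable_fun_pair1 y (mDf 0 0)) mld (ent 0 0)).
  exact: (ac_line_speed g2 st (measurable_fun_pair1 y (mDf 1 0)) mld (ent 1 0)).
rewrite EFinM; apply: lee_wpmul2l; first by rewrite lee_fin.
apply: le_trans ie; apply: ge0_subset_integral => //.
- apply/measurable_EFinP; apply: measurable_funTS.
  exact: (measurable_fun_pair1 y (measurable_log_deriv cf mDf m0)).
- by move=> x _; rewrite lee_fin log_deriv_ge0.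
- by move=> x /=; rewrite !in_itv/= => /andP[h1 h2]; rewrite (le_trans ax h1) (lt_trans h2 xb).
Qed.

End LineVariation.

(** * Leaving a rectangle along the preimage of a circle *)

Section CircleExit.
Context {R : realType}.

(** The infimum of the times with psi >= 0. The first such time matters because an argument of f is
    available only inside the rectangle, so the path must not have left it before. *)
Lemma first_hit (psi : R -> R) (T : R) : continuous psi -> 0 <= T -> psi 0 < 0 -> 0 <= psi T ->
  exists t, [/\ 0 <= t <= T, psi t = 0 & forall s, 0 <= s <= t -> psi s <= 0].
Proof.
move=> cpsi T0 p0 pT.
pose S := [set t | 0 <= t <= T /\ 0 <= psi t].
have ST : S T by split; rewrite ?T0 ?lexx.
have lbS : lbound S 0 by move=> s [/andP[]].
have hiS : has_inf S by split; [exists T|exists 0].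
have i0 : 0 <= inf S by apply: lb_le_inf => //; exists T.
have iT : inf S <= T by apply: ge_inf ST; exists 0.
have below s : 0 <= s -> s < inf S -> psi s < 0.
  move=> s0 si; rewrite ltNge; apply/negP => ps.
  have /(ge_inf (ex_intro _ _ lbS)) : S s by split; rewrite ?s0 ?(le_trans (ltW si)).
  by rewrite leNgt si.
have pi0 : 0 <= psi (inf S).
  rewrite leNgt; apply/negP => pn.
  have e0 : 0 < - psi (inf S) by rewrite oppr_gt0.
  have /cvgrPdist_lt/(_ _ e0)/nbhs_ballP[r /= r0 Hr] := cpsi (inf S).
  have [s Ss si] := inf_adherent r0 hiS.
  have is' : inf S <= s by apply: ge_inf Ss; exists 0.
  have : ball (inf S) r s.
    by rewrite -ball_normE /ball_/= distrC ger0_norm ?subr_ge0//; lra.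
  move=> /Hr /=; case: Ss => _ ps; rewrite ltr_norml => /andP[h1 h2]; lra.
have pE : psi (inf S) = 0.
  apply/eqP; rewrite eq_le pi0 andbT leNgt; apply/negP => pp.
  have [|t] := @IVT R psi 0 (inf S) 0 i0 (continuous_subspaceT cpsi).
    by rewrite ge_min le_max (ltW p0) pi0 orbT.
  rewrite in_itv/= => /andP[t0 ti] pt.
  have : t < inf S by rewrite lt_neqAle ti andbT; apply: contraTneq pp => <-; rewrite pt ltxx.
  by move=> /(below _ t0); rewrite pt ltxx.
exists (inf S); split; [by rewrite i0|by []|].
move=> s /andP[s0]; rewrite le_eqVlt => /predU1P[->|si]; first by rewrite pE.
exact: ltW (below _ s0 si).
Qed.

(** Rotate v by -b and take the argument of the result in [0, 2 pi[: one full turn started at angle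
    [b] passes through every direction. *)
Lemma polar_from (v : R * R) (b : R) : v != 0 ->
  exists2 phi, 0 <= phi <= 2 * pi & v = polar (cabs v) (b + phi).
Proof.
move=> v0; pose u : R * R := (v.1 * cos b + v.2 * sin b, v.2 * cos b - v.1 * sin b).
have cs := cos2Dsin2 b.
have cu : cabs u = cabs v.
  congr Num.sqrt; rewrite /u/=.
  have -> : (v.1 * cos b + v.2 * sin b) ^+ 2 + (v.2 * cos b - v.1 * sin b) ^+ 2 =
     (v.1 ^+ 2 + v.2 ^+ 2) * (cos b ^+ 2 + sin b ^+ 2) by ring.
  by rewrite cs mulr1.
have u0 : u != 0 by rewrite -cabs_gt0 cu cabs_gt0.
have [phi phi2 uphi] : exists2 phi, 0 <= phi <= 2 * pi & is_arg u phi.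
  have r0 : 0 < cabs u by rewrite cabs_gt0.
  have [y0|y0] := leP 0 u.2.
    exists (chart_up u); first by have /andP[-> /ltW ->] := chart_up_range y0 u0.
    by apply: is_arg_chart_up => //; rewrite ltr_wpDl.
  exists (chart_dn u); first by have /andP[-> /ltW ->] := chart_dn_range y0.
  by apply: is_arg_chart_dn => //; rewrite ltr_wpDl// oppr_ge0 ltW.
exists phi => //.
have [e1 e2] : u.1 = cabs v * cos phi /\ u.2 = cabs v * sin phi by rewrite -cu {1 3}uphi.
rewrite /polar cosD sinD [v in LHS]surjective_pairing; congr pair.
- have -> : cabs v * (cos b * cos phi - sin b * sin phi) = cos b * u.1 - sin b * u.2 by rewrite e1 e2; ring.
  rewrite /u /=; have -> : cos b * (v.1 * cos b + v.2 * sin b) - sin b * (v.2 * cos b - v.1 * sin b) =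
     v.1 * (cos b ^+ 2 + sin b ^+ 2) by ring.
  by rewrite cs mulr1.
- have -> : cabs v * (sin b * cos phi + cos b * sin phi) = sin b * u.1 + cos b * u.2 by rewrite e1 e2; ring.
  rewrite /u /=; have -> : sin b * (v.1 * cos b + v.2 * sin b) + cos b * (v.2 * cos b - v.1 * sin b) =
     v.2 * (cos b ^+ 2 + sin b ^+ 2) by ring.
  by rewrite cs mulr1.
Qed.

Variables (f g : R * R -> R * R).
Hypotheses (cf : continuous f) (cg : continuous g) (fK : cancel f g) (gK : cancel g f).
Hypothesis f00 : f 0 = 0.

Lemma f_eq0 z : (f z == 0) = (z == 0).
Proof. by apply/eqP/eqP => [fz|->//]; apply: (can_inj fK); rewrite fz f00. Qed.

(** The preimage under f of [box rho] is bounded, so |f (F t)| starts at 0 and gets beyond rho. *)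
Lemma ray_meets_circle (F : R -> R * R) (rho : R) : continuous F -> F 0 = 0 ->
  (forall N, exists2 t, 0 <= t & N < `|F t|) -> 0 <= rho ->
  exists2 t, 0 <= t & cabs (f (F t)) = rho.
Proof.
move=> cF F0 Finf rho0.
have cK : compact (g @` (box rho)).
  by apply: continuous_compact (@compact_box R rho); apply: continuous_subspaceT.
have [N KN] := compact_sub_box cK.
have [T T0 NT] := Finf N.
have hT : rho <= cabs (f (F T)).
  apply: ltW; apply: lt_le_trans (norm_le_cabs _); rewrite ltNge; apply/negP => h.
  have : box N (F T) by apply: KN; exists (f (F T)); [exact/box_norm|rewrite fK].
  by move=> /box_norm; rewrite leNgt NT.
have ch : continuous (fun t => cabs (f (F t))).
  move=> t; apply: (cvg_comp (f \o F) (@cabs R)); last exact: continuous_cabs.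
  by apply: (cvg_comp F f); [exact: cF|exact: cf].
have h0 : cabs (f (F 0)) = 0 by apply/eqP; rewrite cabs_eq0 F0 f00.
have [|t] := @IVT R (fun t => cabs (f (F t))) 0 T rho T0 (continuous_subspaceT ch).
  by rewrite h0 ge_min le_max rho0 hT orbT.
by rewrite in_itv/= => /andP[t0 _] <-; exists t.
Qed.

(* If the preimage of the circle |w| = |f z0| stayed in the rectangle, the image of F, which joins 0 to
   infinity, would not meet that circle. *)
Lemma circle_exit (F : R -> R * R) (B : R * R -> R) (a b c d : R) (z0 : R * R) :
  continuous F -> F 0 = 0 -> (forall N, exists2 t, 0 <= t & N < `|F t|) ->
  (forall t, 0 <= t -> ~ rect a b c d (F t)) ->
  continuous B -> (forall z, rect a b c d z -> is_arg (f z) (B z)) ->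
  a < z0.1 < b -> c < z0.2 < d ->
  exists p, [/\ rect a b c d p, [\/ p.1 = a, p.1 = b, p.2 = c | p.2 = d] & `|B p - B z0| <= 2 * pi].
Proof.
move=> cF F0 Finf FQ cB HB z1 z2.
have Rz0 : rect a b c d z0.
  by apply/rectP; case/andP: z1 => *; case/andP: z2 => *; split; exact: ltW.
have z00 : z0 != 0.
  by apply/negP => /eqP h; apply: (FQ 0 (lexx _)); rewrite F0 -h.
have fz0 : f z0 != 0 by rewrite f_eq0.
pose rho := cabs (f z0); have rho0 : 0 < rho by rewrite cabs_gt0.
(* The preimage of the circle |w| = |f z0|, parametrized by the angle and started at z0. *)
pose eta phi := g (polar rho (B z0 + phi)).
have cpol : continuous (fun phi : R => polar rho (B z0 + phi)).
  move=> phi; have c1 : {for phi, continuous (fun _ : R => rho)} by exact: cvg_cst.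
  have c2 : {for phi, continuous (fun phi : R => B z0 + phi)}.
    by apply: cvgD; [exact: cvg_cst|exact: cvg_id].
  exact: (cvg_comp _ (fun p : R * R => polar p.1 p.2) (continuous_pair_fun c1 c2) (@continuous_polar R _)).
have ceta : continuous eta.
  by move=> phi; apply: (cvg_comp (fun phi => polar rho (B z0 + phi)) g); [exact: cpol|exact: cg].
pose N (z : R * R) := Num.max (Num.max (a - z.1) (z.1 - b)) (Num.max (c - z.2) (z.2 - d)).
have cN : continuous N.
  have k1 (k : R) : continuous (fun z : R * R => k - z.1).
    by move=> z; apply: cvgB; [exact: cvg_cst|exact: cvg_fst].
  have k2 (k : R) : continuous (fun z : R * R => z.1 - k).
    by move=> z; apply: cvgB; [exact: cvg_fst|exact: cvg_cst].
  have k3 (k : R) : continuous (fun z : R * R => k - z.2).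
    by move=> z; apply: cvgB; [exact: cvg_cst|exact: cvg_snd].
  have k4 (k : R) : continuous (fun z : R * R => z.2 - k).
    by move=> z; apply: cvgB; [exact: cvg_snd|exact: cvg_cst].
  have cm (F1 F2 : R * R -> R) : continuous F1 -> continuous F2 ->
      continuous (fun z => Num.max (F1 z) (F2 z)).
    by move=> h1 h2 z; apply: (@continuous_max R _ F1 F2 z); [exact: h1|exact: h2].
  exact: (cm _ _ (cm _ _ (k1 a) (k2 b)) (cm _ _ (k3 c) (k4 d))).
have Nle z : N z <= 0 -> rect a b c d z.
  rewrite /N !ge_max => /andP[/andP[? ?] /andP[? ?]].
  by apply/rectP; split; lra.
have eta0 : eta 0 = z0.
  rewrite /eta addr0; have <- : f z0 = polar rho (B z0) by exact: HB.
  exact: fK.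
pose psi phi := N (eta phi).
have cpsi : continuous psi.
  by move=> phi; apply: (cvg_comp eta N); [exact: ceta|exact: cN].
have psi0 : psi 0 < 0.
  rewrite /psi eta0 /N !gt_max; case/andP: z1 => *; case/andP: z2 => *.
  by apply/andP; split; apply/andP; split; lra.
have [T T02 psiT] : exists2 T, 0 <= T <= 2 * pi & 0 <= psi T.
  have [t t0 ft] := ray_meets_circle cF F0 Finf (ltW rho0).
  have fFt0 : f (F t) != 0 by rewrite -cabs_gt0 ft.
  have [phi phi2 fE] := polar_from (B z0) fFt0; exists phi => //.
  rewrite leNgt; apply/negP => /ltW /Nle; rewrite /eta -ft -fE fK.
  exact: FQ.
have /andP[T0 T2] := T02.
have [t [/andP[t0 tT] pt tle]] := first_hit cpsi T0 psi0 psiT.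
have Rt s : 0 <= s <= t -> rect a b c d (eta s) by move=> /tle /Nle.
exists (eta t); split.
- by apply: Rt; rewrite t0 lexx.
- have := Rt t; rewrite t0 lexx => /(_ isT)/rectP[r1 r2 r3 r4].
  move: pt; rewrite /psi /N.
  rewrite -[Num.max (Num.max _ _) _]/(Num.max _ _).
  (* At the first zero of [psi] the maximum of four signed distances is 0; the one that attains it
     tells which side is reached. *)
  have [h1|h1] := leP ((eta t).2 - d) (c - (eta t).2); have [h2|h2] := leP ((eta t).1 - b) (a - (eta t).1);
    rewrite ?(max_idPl h1) ?(max_idPr (ltW h1)) ?(max_idPl h2) ?(max_idPr (ltW h2)).
  + have [h3|h3] := leP (a - (eta t).1) (c - (eta t).2); rewrite ?(max_idPr h3) ?(max_idPl (ltW h3)) => h.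
      by constructor 3; lra.
    by constructor 1; lra.
  + have [h3|h3] := leP ((eta t).1 - b) (c - (eta t).2); rewrite ?(max_idPr h3) ?(max_idPl (ltW h3)) => h.
      by constructor 3; lra.
    by constructor 2; lra.
  + have [h3|h3] := leP (a - (eta t).1) ((eta t).2 - d); rewrite ?(max_idPr h3) ?(max_idPl (ltW h3)) => h.
      by constructor 4; lra.
    by constructor 1; lra.
  + have [h3|h3] := leP ((eta t).1 - b) ((eta t).2 - d); rewrite ?(max_idPr h3) ?(max_idPl (ltW h3)) => h.
      by constructor 4; lra.
    by constructor 2; lra.
(* Along [eta], both B (eta s) and B z0 + s are continuous arguments of f (eta s) that agree at s =
   0; so [B] changes by exactly [t], at most one turn. *)
- have := @is_arg_path R (fun s => f (eta s)) (fun s => B (eta s)) (fun s => B z0 + s) 0 t t0.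
  have cBe : continuous (fun s => B (eta s)).
    by move=> s; apply: (cvg_comp eta B); [exact: ceta|exact: cB].
  have cs : continuous (fun s : R => B z0 + s).
    by move=> s; apply: cvgD; [exact: cvg_cst|exact: cvg_id].
  move=> /(_ (continuous_subspaceT cBe) (continuous_subspaceT cs)) h.
  have -> : B (eta t) - B z0 = t.
    have : B (eta t) - (B z0 + t) = B (eta 0) - (B z0 + 0).
      apply: h => s s0; have fE : f (eta s) = polar rho (B z0 + s) by rewrite /eta gK.
      have cr : cabs (f (eta s)) = rho by rewrite fE cabs_polar// ltW.
      by split; [rewrite -cabs_gt0 cr|exact/HB/Rt|rewrite /is_arg cr].
    by rewrite eta0; lra.
  by rewrite ger0_norm// (le_trans tT).
Qed.

End CircleExit.

(** * Change of the argument along a strip *)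

Section Strip.
Context {R : realType}.
Notation leb := (@lebesgue_measure R).
Notation area := (@area R).
Variables (f g : R * R -> R * R) (Df : R * R -> 'M[R]_2).
Hypotheses (cf : continuous f) (cg : continuous g) (fK : cancel f g) (gK : cancel g f).
Hypothesis f00 : f 0 = 0.
Hypothesis mDf : forall i j, measurable_fun setT (fun z => Df z i j).
Hypotheses (gv : {ae leb, forall x, good_vline f Df x}) (gh : {ae leb, forall y, good_hline f Df y}).

Section Frame.
Variables (a b c d xm xp ym yp m K : R) (B : R * R -> R).
Hypotheses (m0 : 0 < m) (cB : continuous B).
Hypotheses (xm1 : a <= xm) (xmp : xm <= xp) (xp2 : xp < b).
Hypotheses (ym1 : c <= ym) (ymp : ym <= yp) (yp2 : yp < d).
Hypothesis HB : forall z, rect xm xp ym yp z -> m <= `|f z| /\ is_arg (f z) (B z).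
Hypotheses (gxm : good_vline f Df xm) (gxp : good_vline f Df xp).
Hypotheses (gym : good_hline f Df ym) (gyp : good_hline f Df yp).
Hypothesis ixm : (\int[leb]_(y in `[c, d[) (log_deriv f Df m (xm, y))%:E <= K%:E)%E.
Hypothesis ixp : (\int[leb]_(y in `[c, d[) (log_deriv f Df m (xp, y))%:E <= K%:E)%E.
Hypothesis iym : (\int[leb]_(x in `[a, b[) (log_deriv f Df m (x, ym))%:E <= K%:E)%E.
Hypothesis iyp : (\int[leb]_(x in `[a, b[) (log_deriv f Df m (x, yp))%:E <= K%:E)%E.

(** Every boundary point is reached from the corner (xm, ym) along at most two sides, each of which
    costs 8 K. *)
Lemma frame_variation (p : R * R) : rect xm xp ym yp p ->
  [\/ p.1 = xm, p.1 = xp, p.2 = ym | p.2 = yp] -> `|B p - B (xm, ym)| <= 16 * K.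
Proof.
have K0 : 0 <= K.
  rewrite -lee_fin; apply: le_trans ixm; apply: integral_ge0 => y _.
  by rewrite lee_fin log_deriv_ge0.
have vl x y1 y2 : good_vline f Df x -> (\int[leb]_(y in `[c, d[) (log_deriv f Df m (x, y))%:E <= K%:E)%E ->
    xm <= x <= xp -> ym <= y1 -> y1 <= y2 -> y2 <= yp -> `|B (x, y2) - B (x, y1)| <= 8 * K.
  move=> gx ix /andP[x1 x2] h1 h2 h3; apply: (vline_variation cf cB m0 mDf gx _ h2 _ _ ix).
  - exact: le_trans h1.
  - exact: le_lt_trans yp2.
  - move=> y /andP[? ?]; apply: HB; apply/rectP; split => //=; [exact: (le_trans h1)|exact: le_trans h3].
have hl y x1 x2 : good_hline f Df y -> (\int[leb]_(x in `[a, b[) (log_deriv f Df m (x, y))%:E <= K%:E)%E ->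
    ym <= y <= yp -> xm <= x1 -> x1 <= x2 -> x2 <= xp -> `|B (x2, y) - B (x1, y)| <= 8 * K.
  move=> gx ix /andP[y1 y2] h1 h2 h3; apply: (hline_variation cf cB m0 mDf gx _ h2 _ _ ix).
  - exact: le_trans h1.
  - exact: le_lt_trans xp2.
  - move=> x /andP[? ?]; apply: HB; apply/rectP; split => //=; [exact: (le_trans h1)|exact: le_trans h3].
have tri (u v w : R) : `|u - v| <= 8 * K -> `|v - w| <= 8 * K -> `|u - w| <= 16 * K.
  move=> h1 h2; have -> : u - w = (u - v) + (v - w) by rewrite addrA subrK.
  by apply: le_trans (ler_normD _ _) _; lra.
have le816 : 8 * K <= 16 * K by lra.
have mm : xm <= xm <= xp by rewrite lexx.
have mp : xm <= xp <= xp by rewrite lexx andbT.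
have nm : ym <= ym <= yp by rewrite lexx.
have np : ym <= yp <= yp by rewrite lexx andbT.
case: p => x y /rectP[/= x1 x2 y1 y2] [] /= e; rewrite ?e in x1 x2 y1 y2 *.
- by apply: le_trans le816; apply: vl.
- by apply: (tri _ (B (xp, ym))); [apply: vl|apply: hl].
- by apply: le_trans le816; apply: hl.
- by apply: (tri _ (B (xm, yp))); [apply: hl|apply: vl].
Qed.

End Frame.

(** From (x0, c) to a boundary point p, from p by way of the corner to a boundary point q, and from
    q to (x0, d), the argument changes by at most 2 pi + 32 K + 2 pi, where K is the bound for the
    integral over a chosen side. Everything is multiplied by tau. *)
Lemma strip_estimate (x0 c d tau m M : R) (A : R -> R) (F : R -> R * R) :
  0 < tau -> c < d -> 0 < m ->
  (forall z, hrect (x0 - tau) (x0 + tau) (c - tau) (d + tau) z -> m <= `|f z|) ->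
  continuous F -> F 0 = 0 -> (forall N, exists2 t, 0 <= t & N < `|F t|) ->
  (forall t, 0 <= t -> ~ hrect (x0 - tau) (x0 + tau) (c - tau) (d + tau) (F t)) ->
  (\int[area]_(z in hrect (x0 - tau)%R (x0 + tau)%R (c - tau)%R (d + tau)%R) (log_deriv f Df m z)%:E <= M%:E)%E ->
  {within `[c, d], continuous A} -> (forall y, c <= y <= d -> is_arg (f (x0, y)) (A y)) ->
  tau * `|A d - A c| <= 4 * pi * tau + 32 * (M + tau).
Proof.
move=> tau0 cd m0 Hm cF F0 Finf FQ iM cA HA.
(* The summand 1 makes [MK] strict, as the choice of lines requires; it is the source of the tau
   beside M in the conclusion. *)
pose K : R := M / tau + 1.
have KE : K * tau = M + tau by rewrite /K mulrDl divfK ?gt_eqF// mul1r.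
have MK : M < K * tau by rewrite KE ltrDl.
have D0 z := log_deriv_ge0 f Df z m0; have mD := measurable_log_deriv cf mDf m0.
have MK1 : M < K * (x0 - (x0 - tau)) by rewrite opprB addrC subrK.
have MK2 : M < K * (x0 + tau - x0) by rewrite addrAC subrr add0r.
have MK3 : M < K * (c - (c - tau)) by rewrite opprB addrC subrK.
have MK4 : M < K * (d + tau - d) by rewrite addrAC subrr add0r.
clearbody K.
have l1 : x0 - tau < x0 by lra.
have l2 : x0 < x0 + tau by lra.
have l3 : c - tau < c by lra.
have l4 : d < d + tau by lra.
have l5 : c - tau <= d by lra.
have l6 : c <= d + tau by lra.
have [xm [/andP[xm1 xm2] gxm ixm]] := pick_vline D0 mD gv iM (lexx _) l1 (ltW l2) MK1.
have [xp [/andP[xp1 xp2] gxp ixp]] := pick_vline D0 mD gv iM (ltW l1) l2 (lexx _) MK2.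
have [ym [/andP[ym1 ym2] gym iym]] := pick_hline D0 mD gh iM (lexx _) l3 l6 MK3.
have [yp [/andP[yp1 yp2] gyp iyp]] := pick_hline D0 mD gh iM l5 l4 (lexx _) MK4.
have xmp : xm <= xp by lra.
have ymp : ym <= yp by lra.
have RQ z : rect xm xp ym yp z -> hrect (x0 - tau) (x0 + tau) (c - tau) (d + tau) z.
  by move=> /rectP[? ? ? ?]; split; rewrite /= in_itv/=; apply/andP; split; lra.
have f0 z : rect xm xp ym yp z -> f z != 0.
  by move=> /RQ/Hm h; rewrite -normr_gt0 (lt_le_trans m0).
have [B cB HB] := lift_rect xmp ymp cf f0.
have HB' z : rect xm xp ym yp z -> m <= `|f z| /\ is_arg (f z) (B z).
  by move=> Rz; split; [exact/Hm/RQ|exact: HB].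
have fv := frame_variation m0 cB (ltW xm1) xmp xp2 (ltW ym1) ymp yp2 HB' gxm gxp gym gyp ixm ixp iym iyp.
have FR t : 0 <= t -> ~ rect xm xp ym yp (F t) by move=> t0 /RQ; exact: FQ.
have zx : xm < x0 < xp by rewrite xm2.
have zc : ym < c < yp by rewrite ym2 (lt_trans cd).
have zd : ym < d < yp by rewrite yp1 (lt_trans ym2).
have [p [Rp bp hp]] := circle_exit cf cg fK gK f00 (z0 := (x0, c)) cF F0 Finf FR cB HB zx zc.
have [q [Rq bq hq]] := circle_exit cf cg fK gK f00 (z0 := (x0, d)) cF F0 Finf FR cB HB zx zd.
have vp := fv p Rp bp; have vq := fv q Rq bq.
have Bdc : `|B (x0, d) - B (x0, c)| <= 4 * pi + 32 * K.
  have -> : B (x0, d) - B (x0, c) = (B p - B (x0, c)) - (B q - B (x0, d)) +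
     ((B q - B (xm, ym)) - (B p - B (xm, ym))) by ring.
  apply: le_trans (ler_normD _ _) _.
  apply: le_trans (lerD (ler_normB _ _) (ler_normB _ _)) _; lra.
(* [A] and [B] are both continuous arguments of f on the segment, so their difference is
   constant. *)
have AB : A d - B (x0, d) = A c - B (x0, c).
  apply: (@is_arg_path R (fun y => f (x0, y)) A (fun y => B (x0, y)) c d (ltW cd) cA).
    apply: continuous_subspaceT => y.
    by apply: (cvg_comp (pair x0) B); [exact: continuous_pairr|exact: cB].
  move=> y cdy; have Ry : rect xm xp ym yp (x0, y).
    by case/andP: cdy => *; apply/rectP; split => /=; lra.
  by split; [exact: f0|exact: HA|exact: HB].
have -> : A d - A c = B (x0, d) - B (x0, c) by lra.
rewrite -KE; have -> : 4 * pi * tau + 32 * (K * tau) = tau * (4 * pi + 32 * K) by ring.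
by rewrite ler_pM2l.
Qed.

End Strip.

(** * Behaviour near the origin *)

Section ArgBranch.
Context {R : realType}.

Lemma within_continuous_comp (T U V : topologicalType) (D : set T) (S : set U) (p : T -> U) (G : U -> V) :
  (forall x, D x -> {for x, continuous p}) -> (forall x, D x -> S (p x)) ->
  {within S, continuous G} -> {within D, continuous (G \o p)}.
Proof.
move=> cp DS /subspace_continuousP cG; apply/subspace_continuousP => x Dx.
apply: (cvg_comp p G _ (cG _ (DS x Dx))) => W /= SW.
have := cp x Dx _ SW; rewrite /= !nbhs_simpl /= /within/=; apply: filterS => y h Dy.
exact/h/DS.
Qed.

Variables (f : R * R -> R * R) (argf : R * R -> R).
Hypothesis argfP : arg_branch f argf.

(** [argf] may jump across the positive real axis, where the angle is 0. The axis belongs to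
    [upper], and [argf] is continuous within each of the two sets. *)
Definition upper : set (R * R) := [set z | 0 <= z.2 /\ z != 0].
Definition lower : set (R * R) := [set z | z.2 < 0].

Lemma lower_neq0 z : lower z -> z != 0.
Proof. by move=> z0; apply: contraTneq z0 => ->; rewrite /lower/= ltxx. Qed.

Lemma polar_upper z : upper z ->
  [/\ 0 < z.2 + cabs z, 0 < cabs z, 0 <= chart_up z < 2 * pi & z = polar (cabs z) (chart_up z)].
Proof.
move=> [y0 z0]; have r0 : 0 < cabs z by rewrite cabs_gt0.
have d0 : 0 < z.2 + cabs z by rewrite ltr_wpDl.
by split => //; [exact: chart_up_range|exact: is_arg_chart_up].
Qed.

Lemma polar_lower z : lower z ->
  [/\ 0 < - z.2 + cabs z, 0 < cabs z, 0 <= chart_dn z < 2 * pi & z = polar (cabs z) (chart_dn z)].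
Proof.
move=> z0; have zn0 := lower_neq0 z0; have r0 : 0 < cabs z by rewrite cabs_gt0.
have d0 : 0 < - z.2 + cabs z by rewrite ltr_wpDl// oppr_ge0 ltW.
by split => //; [exact: chart_dn_range|exact: is_arg_chart_dn].
Qed.

Lemma is_arg_argf z : z != 0 -> is_arg (f z) (argf z).
Proof.
move=> z0; have [_ H _] := argfP.
have [y0|y0] := leP 0 z.2.
  by have [_ r0 th0 zE] := polar_upper (conj y0 z0); have := H _ _ r0 th0; rewrite -zE.
by have [_ r0 th0 zE] := polar_lower y0; have := H _ _ r0 th0; rewrite -zE.
Qed.

Lemma argf_chart (D : set (R * R)) (chart : R * R -> R) :
  (forall z, D z -> {for z, continuous chart}) ->
  (forall z, D z -> [/\ 0 < cabs z, 0 <= chart z < 2 * pi & z = polar (cabs z) (chart z)]) ->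
  {within D, continuous argf}.
Proof.
move=> cc Dz; have [cG _ _] := argfP.
have c : {within D, continuous ((fun p : R * R => argf (polar p.1 p.2)) \o (fun z => (cabs z, chart z)))}.
  apply: within_continuous_comp cG.
    move=> z zD; exact: (continuous_pair_fun (@continuous_cabs R z) (cc z zD)).
  by move=> z /Dz[h1 h2 _]; split => /=; rewrite in_itv/= ?h1 ?h2.
apply: subspace_eq_continuous c => z; rewrite inE => /Dz[_ _ e].
exact: (congr1 argf (esym e)).
Qed.

Lemma continuous_argf_upper : {within upper, continuous argf}.
Proof.
apply: (@argf_chart _ (@chart_up R)).
  by move=> z /polar_upper[d0 _ _ _]; exact: continuous_chart_up.
by move=> z /polar_upper[_ ? ? ?].
Qed.

Lemma continuous_argf_lower : {within lower, continuous argf}.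
Proof.
apply: (@argf_chart _ (@chart_dn R)).
  by move=> z /polar_lower[d0 _ _ _]; exact: continuous_chart_dn.
by move=> z /polar_lower[_ ? ? ?].
Qed.

Lemma argf_vline (D : set (R * R)) x c d : {within D, continuous argf} ->
  (forall y, c <= y <= d -> D (x, y)) -> {within `[c, d], continuous (fun y => argf (x, y))}.
Proof.
move=> cD Dy; apply: (within_continuous_comp (p := pair x) _ _ cD).
  by move=> y _; exact: continuous_pairr.
by move=> y /=; rewrite in_itv/=; exact: Dy.
Qed.

Lemma argf_bounded (D K : set (R * R)) : {within D, continuous argf} -> K `<=` D -> compact K ->
  exists M, forall z, K z -> `|argf z| <= M.
Proof.
move=> cD KD cK; have := continuous_compact (continuous_subspaceW KD cD) cK.
move=> /compact_bounded[M [_ HM]]; exists (M + 1) => z Kz.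
by apply: (HM (M + 1)); [rewrite ltrDl|exists z].
Qed.

End ArgBranch.

(** * Lower bound for |f| and number of annuli *)

Section Asymptotics.
Context {R : realType}.
Notation leb := (@lebesgue_measure R).
Notation area := (@area R).
Variables (f g : R * R -> R * R) (alpha C delta : R).
Hypotheses (cf : continuous f) (fK : cancel f g) (f00 : f 0 = 0).
Hypotheses (alpha1 : 1 <= alpha) (C0 : 0 < C) (delta0 : 0 < delta).
Hypothesis f_lower : forall x y : R * R, cabs (x - y) < delta ->
  C * cabs (x - y) `^ alpha <= cabs (f x - f y).

Lemma powR_base_le1 (s : R) : 0 <= s <= 1 -> s `^ alpha <= 1.
Proof.
move=> /andP[s0 s1]; rewrite -[leRHS](congr1 (fun F : R -> R => F alpha) (@powR1 R)).
by apply: ge0_ler_powR; rewrite ?nnegrE// (le_trans ler01).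
Qed.

(** For cabs z < delta the hypothesis on f applies with y = 0, and C / 2 accounts for the passage to
    the sup norm. For the other z compactness gives a positive minimum of |f|, and s^alpha <= 1. *)
Lemma lower_bound_norm N : exists2 c0 : R, 0 < c0 & forall s z, 0 <= s <= 1 -> s <= `|z| -> `|z| <= N ->
  c0 * s `^ alpha <= `|f z|.
Proof.
have cK : compact (box N `&` [set z : R * R | delta / 2 <= `|z|]).
  apply: compact_closedI; first exact: compact_box.
  have := @preimage_closed _ _ (fun z : R * R => `|z|) [set y | delta / 2 <= y].
  by apply; [move=> z _; exact: norm_continuous|exact: closed_ge].
have fz z : (box N `&` [set z : R * R | delta / 2 <= `|z|]) z -> f z != 0.
  move=> [_ /= dz]; rewrite (f_eq0 fK f00) -normr_gt0; apply: lt_le_trans dz; exact: divr_gt0.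
have [m m0 Hm] := norm_min_compact cK cf fz.
exists (Num.min (C / 2) m); first by rewrite lt_min m0 divr_gt0.
move=> s z /andP[s0 s1] sz zN.
have p0 := powR_ge0 s alpha; have p1 : s `^ alpha <= 1 by apply: powR_base_le1; rewrite s0.
have [zd|zd] := ltP (cabs z) delta.
  have := @f_lower z 0; rewrite subr0 f00 subr0 => /(_ zd) h.
  have hp : s `^ alpha <= cabs z `^ alpha.
    apply: ge0_ler_powR; rewrite ?nnegrE ?cabs_ge0// ?(le_trans ler01)//.
    exact: le_trans sz (norm_le_cabs z).
  apply: (@le_trans _ _ (C / 2 * s `^ alpha)); first by rewrite ler_wpM2r// ge_min lexx.
  have h2 : C * s `^ alpha <= C * cabs z `^ alpha by rewrite ler_pM2l.
  have := le_trans h2 (le_trans h (cabs_le_norm (f z))); lra.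
apply: (@le_trans _ _ (m * 1)); first by apply: ler_pM => //; rewrite ?ge_min ?lexx ?orbT// le_min (ltW m0) divr_ge0// ltW.
rewrite mulr1; apply: Hm; split; first exact/box_norm.
by have := cabs_le_norm z; rewrite /=; lra.
Qed.

Lemma layer_number (m M : R) : 0 < m -> m <= M ->
  exists n : nat, M < m * 2 ^+ n /\ n%:R <= ln (M / m) / ln 2 + 1.
Proof.
move=> m0 mM; have M0 : 0 < M := lt_le_trans m0 mM.
have l2 : 0 < ln (2 : R) by rewrite ln_gt0// ltr1n.
have q0 : 0 <= ln (M / m) / ln 2.
  by rewrite divr_ge0 ?(ltW l2)// ln_ge0// ler_pdivlMr// mul1r.
exists (Num.truncn (ln (M / m) / ln 2)).+1; split; last first.
  by rewrite -natr1 lerD2r truncn_le.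
have := truncnS_gt (ln (M / m) / ln 2); rewrite ltr_pdivrMr// mulr_natl -lnXn// ltr_ln ?posrE ?divr_gt0 ?exprn_gt0//.
by rewrite ltr_pdivrMr// mulrC.
Qed.

End Asymptotics.

(** * Strips near the origin *)

Section NearOrigin.
Context {R : realType}.
Notation leb := (@lebesgue_measure R).
Notation area := (@area R).
Variables (f g : R * R -> R * R) (Df : R * R -> 'M[R]_2) (argf : R * R -> R) (alpha c0 Mf : R).
Hypotheses (cf : continuous f) (cg : continuous g) (fK : cancel f g) (gK : cancel g f).
Hypothesis f00 : f 0 = 0.
Hypothesis mDf : forall i j, measurable_fun setT (fun z => Df z i j).
Hypothesis mJ : measurable_fun setT (jac_pos Df).
Hypothesis mK : measurable_fun setT (distortion Df).
Hypothesis image_area : forall (A : set (R * R)) (N : R), measurable A -> A `<=` box N ->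
  (\int[area]_(z in A) (jac_pos Df z)%:E <= 32%:E * area (g @^-1` A))%E.
Hypothesis fD : {ae area, forall z, opnorm (Df z) ^+ 2 <= distortion Df z * jac_pos Df z}.
Hypotheses (gv : {ae leb, forall x, good_vline f Df x}) (gh : {ae leb, forall y, good_hline f Df y}).
Hypothesis argfP : arg_branch f argf.
Hypotheses (c00 : 0 < c0) (c0M : c0 <= Mf).
Hypothesis lower_f : forall s z, 0 <= s <= 1 -> s <= `|z| -> `|z| <= 3 -> c0 * s `^ alpha <= `|f z|.
Hypothesis upper_f : forall z, `|z| <= 3 -> `|f z| <= Mf.

(** On the strip |f| lies between m = c0 (s/2)^alpha and Mf < m 2^n, so [n] annuli suffice in
    [integral_log_deriv], whose bound then enters [strip_estimate] with tau = s / 2. *)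
Lemma strip_argf (x0 c s B l : R) (n : nat) (D : set (R * R)) (F : R -> R * R) :
  let tau := s / 2 in let Q := hrect (x0 - tau) (x0 + tau) (c - tau) (c + 1 + tau) in
  0 < s -> s <= 1 -> (forall z, Q z -> s / 2 <= `|z| <= 3) ->
  continuous F -> F 0 = 0 -> (forall N, exists2 t, 0 <= t & N < `|F t|) ->
  (forall t, 0 <= t -> ~ Q (F t)) ->
  {within D, continuous argf} -> (forall y, c <= y <= c + 1 -> D (x0, y)) ->
  (forall z, D z -> z != 0) ->
  Mf < c0 * (s / 2) `^ alpha * 2 ^+ n -> 0 < l ->
  (\int[area]_(z in Q) (distortion Df z)%:E <= B%:E)%E ->
  tau * `|argf (x0, c + 1) - argf (x0, c)| <=
    4 * pi * tau + 32 * (2 * l * B + 1024 * n%:R / l + tau).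
Proof.
move=> tau Q s0 s1 Qz cF F0 Finf FQ cD Dseg D0 Mn l0 iB.
have tau0 : 0 < tau by rewrite divr_gt0.
have tau01 : 0 <= s / 2 <= 1 by apply/andP; split; lra.
set m := c0 * (s / 2) `^ alpha in Mn.
have m0 : 0 < m by rewrite mulr_gt0// powR_gt0.
have fQ z : Q z -> m <= `|f z| < m * 2 ^+ n.
  move=> /Qz/andP[sz z3]; apply/andP; split; first exact: lower_f.
  by apply: le_lt_trans Mn; exact: upper_f.
have QB : Q `<=` box 3 by move=> z /Qz/andP[_ h]; exact/box_norm.
have mQ : measurable Q by exact: measurable_hrect.
have iM := integral_log_deriv cf cg gK mDf mJ mK image_area fD mQ QB m0 fQ l0.
have cc : c < c + 1 by rewrite ltrDl.
apply: (strip_estimate cf cg fK gK f00 mDf gv gh tau0 cc m0 _ cF F0 Finf FQ _ (A := fun y => argf (x0, y))).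
- by move=> z /fQ/andP[].
- exact: iM.
- exact: argf_vline cD Dseg.
- by move=> y /Dseg/D0; exact: is_arg_argf.
Qed.

(** Half of the y-axis, pointing away from the strip: downwards for a strip that goes up from z0,
    upwards for one that goes down. *)
Definition ray (sg t : R) : R * R := (0, sg * t).

Lemma continuous_ray sg : continuous (ray sg).
Proof.
move=> t; apply: (continuous_comp (f := fun t => sg * t) (g := pair 0)); last exact: continuous_pairr.
by apply: cvgM; [exact: cvg_cst|exact: cvg_id].
Qed.

Lemma ray0 sg : ray sg 0 = 0.
Proof. by rewrite /ray mulr0. Qed.

Lemma ray_unbounded sg : `|sg| = 1 -> forall N, exists2 t, 0 <= t & N < `|ray sg t|.
Proof.
move=> sg1 N; exists (`|N| + 1); first by rewrite addr_ge0.
rewrite prod_normE/= normr0 normrM sg1 mul1r ger0_norm ?addr_ge0// lt_max.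
by apply/orP; right; rewrite (le_lt_trans (ler_norm _))// ltrDl.
Qed.

Lemma area_strip (x0 c s : R) : 0 < s -> s <= 1 ->
  (area (hrect (x0 - s / 2) (x0 + s / 2) (c - s / 2) (c + 1 + s / 2)) <= (2 * s)%:E)%E.
Proof.
move=> s0 s1; rewrite /area /hrect product_measure1E//= !lebesgue_measure_itv/= !lte_fin.
rewrite !ifT; [|lra..]; rewrite -!EFinB -EFinM lee_fin.
have -> : (x0 + s / 2 - (x0 - s / 2)) * (c + 1 + s / 2 - (c - s / 2)) = s * (1 + s) by field.
by rewrite [leRHS]mulrC ler_pM2l//; lra.
Qed.

(** From the closed upper half-plane the segment goes up, from the lower one down, over length 1: it
    stays in [upper] or in [lower] and ends where |argf| <= M'. *)
Lemma argf_near_origin (z0 : R * R) (dl M' B l : R) (n : nat) :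
  (forall E, measurable E -> E `<=` box 3 -> (area E < dl%:E)%E ->
     (\int[area]_(z in E) (distortion Df z)%:E <= B%:E)%E) ->
  (forall z, rect (-1) 1 (1 / 2) 2 z \/ rect (-1) 1 (-2) (-(1 / 2)) z -> `|argf z| <= M') ->
  z0 != 0 -> `|z0| <= 1 / 4 -> 2 * `|z0| < dl ->
  Mf < c0 * (`|z0| / 2) `^ alpha * 2 ^+ n -> 0 < l ->
  `|z0| / 2 * `|argf z0| <= `|z0| / 2 * (M' + 4 * pi + 32) + 32 * (2 * l * B + 1024 * n%:R / l).
Proof.
move=> HE HM z00 s4 sdl Mn l0.
case: z0 z00 s4 sdl Mn => x0 y0 z00; set s : R := `|(x0, y0)| => s4 sdl Mn.
have s0 : 0 < s by rewrite normr_gt0.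
have s1 : s <= 1 by lra.
have sE : s = Num.max `|x0| `|y0| by [].
have [xs nxs xs0] := abs_bounds x0; have [ys nys ys0] := abs_bounds y0.
have x0s : `|x0| <= s by rewrite sE le_max lexx.
have y0s : `|y0| <= s by rewrite sE le_max lexx orbT.
have sxy : `|x0| = s \/ `|y0| = s.
  by rewrite sE; case: (leP `|x0| `|y0|) => h; [right|left].
have int3 c : (forall z, hrect (x0 - s / 2) (x0 + s / 2) (c - s / 2) (c + 1 + s / 2) z -> s / 2 <= `|z| <= 3) ->
    (\int[area]_(z in hrect (x0 - s / 2)%R (x0 + s / 2)%R (c - s / 2)%R (c + 1 + s / 2)%R) (distortion Df z)%:E <= B%:E)%E.
  move=> Qz; apply: HE.
  - exact: measurable_hrect.
  - by move=> z /Qz/andP[_ h]; exact/box_norm.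
  - by apply: le_lt_trans (area_strip x0 c s0 s1) _; rewrite lte_fin.
have normz (z : R * R) (t : R) : t <= `|z.1| \/ t <= `|z.2| -> `|z.1| <= 3 -> `|z.2| <= 3 -> t <= `|z| <= 3.
  move=> h h1 h2; rewrite prod_normE/= le_max ge_max h1 h2/= andbT.
  by apply/orP; case: h => h; [left|right].
have xcase : `|x0| = s -> x0 = s \/ x0 = - s.
  by have [h|h] := leP 0 x0; [rewrite ger0_norm//; left|rewrite ltr0_norm// => <-; right; rewrite opprK].
clearbody s.
have fin (a a' : R) : `|a'| <= M' ->
    s / 2 * `|a - a'| <= 4 * pi * (s / 2) + 32 * (2 * l * B + 1024 * n%:R / l + s / 2) ->
    s / 2 * `|a| <= s / 2 * (M' + 4 * pi + 32) + 32 * (2 * l * B + 1024 * n%:R / l).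
  move=> aM h; have t1 : `|a| <= `|a'| + `|a - a'|.
    by rewrite -{1}(subrK a' a) [leRHS]addrC; exact: ler_normD.
  have t2 : s / 2 * `|a| <= s / 2 * (M' + `|a - a'|).
    by apply: ler_wpM2l; [rewrite divr_ge0// ltW|apply: (le_trans t1); lra].
  apply: (le_trans t2); set X := 2 * l * B + _ in h *; set d := `|a - a'| in h *.
  have -> : s / 2 * (M' + d) = s / 2 * M' + s / 2 * d by ring.
  have -> : s / 2 * (M' + 4 * pi + 32) = s / 2 * M' + 4 * pi * (s / 2) + 32 * (s / 2) by ring.
  lra.
have [yp|yn] := leP 0 y0.
- have yE : `|y0| = y0 by rewrite ger0_norm.
  have Qz z : hrect (x0 - s / 2) (x0 + s / 2) (y0 - s / 2) (y0 + 1 + s / 2) z -> s / 2 <= `|z| <= 3.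
    case: z => x y [/=]; rewrite !in_itv/= => /andP[h1 h2] /andP[h3 h4].
    clear fin int3 HE HM Mn; have [? ? ?] := abs_bounds x; have [? ? ?] := abs_bounds y.
    apply: normz => /=; last 2 first.
    + by rewrite ler_norml; apply/andP; split; lra.
    + by rewrite ler_norml; apply/andP; split; lra.
    (* Either |x0| = s, and the strip stays on one side of the y-axis at distance s / 2, or |y0| =
       s, and it stays above height s / 2. *)
    case: sxy => [/xcase sx|sx]; [left|right; lra].
    by case: sx => sx; lra.
  have FQ (t : R) : 0 <= t -> ~ hrect (x0 - s / 2) (x0 + s / 2) (y0 - s / 2) (y0 + 1 + s / 2) (ray (-1) t).
    clear fin int3 HE HM Mn; move=> t0 [/=]; rewrite !in_itv/= mulN1r => /andP[h1 h2] /andP[h3 h4].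
    case: sxy => [/xcase sx|sx]; last lra.
    by case: sx => sx; lra.
  (* Only the segment has to avoid the jump of [argf]; the strip around it may cross the real axis,
     since [strip_estimate] lifts arg f anew there. *)
  have seg y : y0 <= y <= y0 + 1 -> @upper R (x0, y).
    move=> /andP[h1 h2]; split => /=; first lra.
    apply: contra z00; rewrite !xpair_eqE => /andP[-> /eqP yE0].
    by apply/eqP; lra.
  have := strip_argf s0 s1 Qz (@continuous_ray (-1)) (ray0 _) (ray_unbounded (normrN1 _)) FQ
    (continuous_argf_upper argfP) seg (fun z h => proj2 h) Mn l0 (int3 _ Qz).
  rewrite distrC; apply: fin.
  by apply: HM; left; apply/rectP => /=; split; lra.
- have yE : `|y0| = - y0 by rewrite ltr0_norm.
  have e1 : y0 - 1 + 1 = y0 by rewrite subrK.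
  have Qz z : hrect (x0 - s / 2) (x0 + s / 2) (y0 - 1 - s / 2) (y0 - 1 + 1 + s / 2) z -> s / 2 <= `|z| <= 3.
    case: z => x y [/=]; rewrite e1 !in_itv/= => /andP[h1 h2] /andP[h3 h4].
    clear fin int3 HE HM Mn; have [? ? ?] := abs_bounds x; have [? ? ?] := abs_bounds y.
    apply: normz => /=; last 2 first.
    + by rewrite ler_norml; apply/andP; split; lra.
    + by rewrite ler_norml; apply/andP; split; lra.
    case: sxy => [/xcase sx|sx]; [left|right; lra].
    by case: sx => sx; lra.
  have FQ (t : R) : 0 <= t -> ~ hrect (x0 - s / 2) (x0 + s / 2) (y0 - 1 - s / 2) (y0 - 1 + 1 + s / 2) (ray 1 t).
    clear fin int3 HE HM Mn; move=> t0 [/=]; rewrite e1 !in_itv/= mul1r => /andP[h1 h2] /andP[h3 h4].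
    case: sxy => [/xcase sx|sx]; last lra.
    by case: sx => sx; lra.
  have seg y : y0 - 1 <= y <= y0 - 1 + 1 -> @lower R (x0, y).
    by rewrite e1 => /andP[h1 h2]; rewrite /lower/=; lra.
  have := strip_argf s0 s1 Qz (@continuous_ray 1) (ray0 _) (ray_unbounded (normr1 _)) FQ
    (continuous_argf_lower argfP) seg (@lower_neq0 R) Mn l0 (int3 _ Qz).
  rewrite e1; apply: fin.
  by apply: HM; right; apply/rectP => /=; split; lra.
Qed.

End NearOrigin.

(** The logarithm equals ln (Mf / c0) - alpha ln (s / 2), and s / 2 >= t / 4. The assumption ln (1 /
    t) >= 1 absorbs the constants into the factor ln (1 / t). *)
Lemma layer_number_le (R : realType) (c0 Mf alpha s t : R) (n : nat) : 0 < c0 -> c0 <= Mf -> 0 <= alpha ->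
  0 < t -> t <= 2 * s -> 1 <= ln (1 / t) ->
  n%:R <= ln (Mf / (c0 * (s / 2) `^ alpha)) / ln 2 + 1 ->
  n%:R <= ((ln (Mf / c0) + alpha * (1 + ln 4)) / ln 2 + 1) * ln (1 / t).
Proof.
move=> c00 cM al0 t0 ts L1 /le_trans; apply.
have s20 : 0 < s / 2 by lra.
have M0 : 0 < Mf := lt_le_trans c00 cM.
have l2 : 0 < ln (2 : R) by rewrite ln_gt0// ltr1n.
have l4 : 0 <= ln (4 : R) by rewrite ln_ge0// ler1n.
have lc : 0 <= ln (Mf / c0) by rewrite ln_ge0// ler_pdivlMr// mul1r.
set L := ln (1 / t) in L1 *.
have LE : L = - ln t by rewrite /L div1r lnV.
have h1 : ln (Mf / (c0 * (s / 2) `^ alpha)) = ln (Mf / c0) - alpha * ln (s / 2).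
  have p0 : 0 < (s / 2) `^ alpha by rewrite powR_gt0.
  have -> : Mf / (c0 * (s / 2) `^ alpha) = Mf / c0 / (s / 2) `^ alpha by field; rewrite !gt_eqF.
  by rewrite ln_div ?posrE ?divr_gt0// ln_powR.
have h2 : - L - ln 4 <= ln (s / 2).
  rewrite LE opprK -ln_div ?posrE// ler_ln ?posrE ?divr_gt0//; lra.
have h3 : ln (Mf / (c0 * (s / 2) `^ alpha)) <= (ln (Mf / c0) + alpha * (1 + ln 4)) * L.
  have k1 : ln (Mf / c0) <= ln (Mf / c0) * L by rewrite ler_peMr.
  have k2 : ln 4 <= ln 4 * L by rewrite ler_peMr.
  have k3 : alpha * (- ln (s / 2)) <= alpha * (L + ln 4 * L) by rewrite ler_wpM2l//; lra.
  have -> : (ln (Mf / c0) + alpha * (1 + ln 4)) * L = ln (Mf / c0) * L + alpha * (L + ln 4 * L) by ring.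
  by rewrite h1; move: k3; rewrite mulrN; lra.
rewrite [leRHS]mulrDl mul1r; apply: lerD => //.
by rewrite [leRHS]mulrAC ler_pM2r// invr_gt0.
Qed.

(** Here q stands for sqrt (log (1/t)). With l = q / ep and int K <= ep^2 both terms are multiples
    of ep q, in total at most (2 + 1024 a) ep q. The 256 in [ep] makes 32 times this equal to e q /
    8, which leaves room for the factor 4 between t A and s A / 2. *)
Lemma weighted_bound (R : realType) (a C1 e ep t s q A n : R) : 0 < a -> 0 < C1 -> 0 < e ->
  ep = e / (256 * (2 + 1024 * a)) -> 0 < s -> 0 <= A -> t <= 2 * s -> 1 <= q ->
  n <= a * q ^+ 2 -> s * (4 * C1) <= e ->
  s / 2 * A <= s / 2 * C1 + 32 * (2 * (q / ep) * ep ^+ 2 + 1024 * n / (q / ep)) ->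
  t / q * A <= e.
Proof.
move=> a0 C10 e0 epE s0 A0 ts q1 na se main.
have q0 : 0 < q := lt_le_trans ltr01 q1.
have k0 : (0 : R) < 1024 by rewrite ltr0n.
have Ca0 : 0 < 2 + 1024 * a by apply: addr_gt0; [rewrite ltr0n|exact: mulr_gt0 k0 a0].
have C256 : 0 < 256 * (2 + 1024 * a) by apply: mulr_gt0; [rewrite ltr0n|exact: Ca0].
have ep0 : 0 < ep by rewrite epE; exact: divr_gt0.
have X3 : 32 * (2 * (q / ep) * ep ^+ 2 + 1024 * n / (q / ep)) <= e / 8 * q.
  have -> : e / 8 * q = 32 * (2 * (q / ep) * ep ^+ 2 + 1024 * (a * q ^+ 2) / (q / ep)).
    have -> : e = ep * (256 * (2 + 1024 * a)) by rewrite epE (divfK (lt0r_neq0 C256)).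
    by field; rewrite !gt_eqF.
  apply: ler_wpM2l; first by rewrite ler0n.
  rewrite lerD2l; apply: ler_wpM2r; first by rewrite invr_ge0 ltW// divr_gt0.
  by apply: ler_wpM2l na; rewrite ler0n.
have X4 : s / 2 * C1 <= e / 8 by lra.
rewrite mulrAC ler_pdivrMr//.
have h1 : t * A <= 4 * (s / 2 * A).
  have -> : 4 * (s / 2 * A) = 2 * s * A by field.
  exact: ler_wpM2r.
have h2 : e / 8 <= e / 8 * q by rewrite ler_peMr// divr_ge0// ltW.
have := le_trans main (lerD X4 X3); lra.
Qed.

Lemma limf_esup_eq0 (R : realType) (h : R * R -> R) : (forall z, 0 <= h z) ->
  (forall e, 0 < e -> exists2 r, 0 < r & forall z, z != 0 -> `|z| < r -> h z <= e) ->
  limf_esup (fun z => (h z)%:E) (0 : R * R)^' = 0%E.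
Proof.
move=> h0 hle; apply/eqP; rewrite eq_le; apply/andP; split.
  apply/lee_addgt0Pr => e e0; rewrite add0e; have [r r0 Hr] := hle e e0.
  rewrite /limf_esup; apply: (@le_trans _ _ (ereal_sup ((fun z => (h z)%:E) @` [set z | z != 0 /\ `|z| < r]))).
    apply: ereal_inf_lbound; exists [set z | z != 0 /\ `|z| < r] => //.
    rewrite /= /dnbhs /within/=; apply/nbhs_ballP; exists r => // z.
    by rewrite -ball_normE /ball_/= sub0r normrN => zr zn0; split.
  by apply: ge_ereal_sup => _ [z [z0 zr] <-]; rewrite lee_fin Hr.
apply: limf_esup_ge0; last by move=> z; rewrite lee_fin.
(* The punctured neighbourhoods of 0 are nonempty: (r / 2, 0) lies in the ball of radius r. *)
move=> /nbhs_ballP[r /= r0 /(_ (r / 2, 0))]; apply.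
  rewrite -ball_normE /ball_/= sub0r normrN prod_normE/= normr0 ger0_norm ?divr_ge0 ?(ltW r0)//.
  by rewrite gt_max r0 andbT; lra.
by rewrite xpair_eqE eqxx andbT gt_eqF// divr_gt0.
Qed.

Theorem corollary3 (R : realType) (f : R * R -> R * R) (Df : R * R -> 'M[R]_2)
    (argf : R * R -> R) (alpha C delta : R)
    (f_homeo : homeo_finite_distortion f Df)
    (f0 : f (0, 0) = (0, 0)) (f1 : f (1, 0) = (1, 0))
    (K_L1loc : loc_integrable (distortion Df))
    (alpha_ge1 : 1 <= alpha) (C_gt0 : 0 < C) (delta_gt0 : 0 < delta)
    (f_lower : forall x y : R * R, cabs (x - y) < delta ->
       C * cabs (x - y) `^ alpha <= cabs (f x - f y))
    (argfP : arg_branch f argf) :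
  limf_esup
    (fun z : R * R =>
       (cabs z / Num.sqrt (ln (1 / cabs z)) * `|argf z|)%:E)
    (0 : R * R)^' = 0%E.
Proof.
have [[cf [g [cg fK gK]]] _ W _ _] := f_homeo.
have f00 : f 0 = 0 := f0.
have iDf : forall i j, loc_integrable (fun z => Df z i j) by have [_ ? _ _] := W.
have mDf i j : measurable_fun setT (fun z => Df z i j) by have [] := iDf i j.
have gv := W11loc_good_vline cf W; have gh := W11loc_good_hline cf W.
have mJ : measurable_fun setT (jac_pos Df) by apply: measurable_jac_pos; exact: iDf.
have mK : measurable_fun setT (distortion Df) by case: K_L1loc.
have iA := jacobian_area cf cg fK gK iDf gv gh.
have fD := opnorm_sqr_le_distortion f_homeo.
(* The box of radius 3 contains all the strips around segments of length 1 that start within 1/4 of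
   the origin. *)
have [c0 c00 lower_f] := lower_bound_norm cf fK f00 alpha_ge1 C_gt0 delta_gt0 f_lower 3.
have [Mf cM upper_f] : exists2 Mf, c0 <= Mf & forall z, `|z| <= 3 -> `|f z| <= Mf.
  have cK : compact (f @` (box 3)).
    by apply: continuous_compact (@compact_box R 3); apply: continuous_subspaceT.
  have [N KN] := compact_sub_box cK; exists (Num.max c0 N); first by rewrite le_max lexx.
  move=> z /box_norm z3; rewrite le_max; apply/orP; right; apply/box_norm; apply: KN.
  by exists z.
(* The far ends of the segments lie in these two compact rectangles, one in each set of continuity
   of [argf]. *)
have [M' M'0 HM] : exists2 M', 0 <= M' & forall z : R * R,
    rect (-1) 1 (1 / 2) 2 z \/ rect (-1) 1 (-2) (-(1 / 2)) z -> `|argf z| <= M'.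
  have K1 : rect (-1) 1 (1 / 2) 2 `<=` @upper R.
    move=> z /rectP[_ _ z2 _]; split; first by lra.
    by apply: contraTneq z2 => -> /=; rewrite -ltNge; lra.
  have K2 : rect (-1) 1 (-2) (-(1 / 2)) `<=` @lower R.
    by move=> z /rectP[_ _ _ z2]; rewrite /lower/=; lra.
  have [M1 H1] := argf_bounded (continuous_argf_upper argfP) K1 (@compact_rect R _ _ _ _).
  have [M2 H2] := argf_bounded (continuous_argf_lower argfP) K2 (@compact_rect R _ _ _ _).
  exists (Num.max 0 (Num.max M1 M2)); first by rewrite le_max lexx.
  by move=> z [/H1|/H2] h; rewrite !le_max h ?orbT.
have iK := loc_integrable_box 3 K_L1loc.
have pi0 := pi_gt0 R.
apply: limf_esup_eq0 => [z|e e0].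
  by rewrite mulr_ge0// divr_ge0 ?sqrtr_ge0 ?cabs_ge0.
have al0 : 0 <= alpha := le_trans ler01 alpha_ge1.
pose a : R := (ln (Mf / c0) + alpha * (1 + ln 4)) / ln 2 + 1.
have a0 : 0 < a.
  rewrite ltr_wpDl// divr_ge0//; last by rewrite ln_ge0// ler1n.
  rewrite addr_ge0//; first by rewrite ln_ge0// ler_pdivlMr// mul1r.
  by apply: mulr_ge0 => //; apply: addr_ge0 => //; rewrite ln_ge0// ler1n.
have k0 : (0 : R) < 1024 by rewrite ltr0n.
have Ca0 : 0 < 2 + 1024 * a by apply: addr_gt0; [rewrite ltr0n|exact: mulr_gt0 k0 a0].
have C256 : 0 < 256 * (2 + 1024 * a) by apply: mulr_gt0; [rewrite ltr0n|exact: Ca0].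
pose ep : R := e / (256 * (2 + 1024 * a)).
have ep0 : 0 < ep by exact: divr_gt0.
have epE : ep = e / (256 * (2 + 1024 * a)) by [].
have aE : a = (ln (Mf / c0) + alpha * (1 + ln 4)) / ln 2 + 1 by [].
clearbody ep a.
(* A strip has area at most 2 s; below [dl] it carries an integral of the distortion of at most
   ep^2, the square being what balances with l = q / ep. *)
have [dl dl0 HE] := @integral_abs_continuous _ (measurableTypeR R * measurableTypeR R)%type R (@area R) (box 3)
  (distortion Df) (ep ^+ 2) (measurable_box _) (distortion_ge0 Df) mK iK (exprn_gt0 2 ep0).
pose C1 : R := M' + 4 * pi + 32.
have C1E : C1 = M' + 4 * pi + 32 by [].
have C10 : 0 < C1 by rewrite /C1; lra.
clearbody C1.
have C40 : 0 < 4 * C1 by exact: mulr_gt0.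
(* In this order: the far end of the segment falls into the rectangles of [HM]; the area of the
   strip is less than [dl]; the term s C1 is absorbed by e; and cabs z <= 2 s <= exp (-1), so that
   the logarithm is at least 1. *)
pose r : R := Num.min (Num.min (1 / 4) (dl / 2)) (Num.min (e / (4 * C1)) (expR (-1) / 2)).
exists r.
  rewrite /r !lt_min; apply/andP; split; apply/andP; split; apply: divr_gt0 => //.
move=> z z0; rewrite /r !lt_min => /andP[/andP[s4 sdl] /andP[se s1]].
set s : R := `|z| in s4 sdl se s1.
have s0 : 0 < s by rewrite normr_gt0.
have t0 : 0 < cabs z by rewrite cabs_gt0.
have ts : cabs z <= 2 * s by exact: cabs_le_norm.
have L1 : 1 <= ln (1 / cabs z).
  rewrite div1r lnV// lerNr -[leRHS]expRK ler_ln ?posrE ?expR_gt0//.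
  by apply: (le_trans ts); lra.
have q1 : 1 <= Num.sqrt (ln (1 / cabs z)) by have := ler_wsqrtr L1; rewrite sqrtr1.
have qq : Num.sqrt (ln (1 / cabs z)) ^+ 2 = ln (1 / cabs z) by rewrite sqr_sqrtr// (le_trans ler01).
have s201 : 0 <= s / 2 <= 1 by clear -s0 s4; apply/andP; split; lra.
have p0 : 0 < (s / 2) `^ alpha by apply: powR_gt0; exact: divr_gt0.
have m0 : 0 < c0 * (s / 2) `^ alpha by exact: mulr_gt0.
have mM : c0 * (s / 2) `^ alpha <= Mf.
  apply: le_trans cM; rewrite ler_piMr ?(ltW c00)//.
  have hp := powR_base_le1 alpha_ge1 s201.
  exact: hp.
have [n [Mn nle]] := layer_number m0 mM.
have naL := layer_number_le c00 cM al0 t0 ts L1 nle.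
have sdl' : 2 * s < dl by clear -sdl; lra.
have l0 : 0 < Num.sqrt (ln (1 / cabs z)) / ep by apply: divr_gt0 => //; exact: lt_le_trans ltr01 q1.
have main := argf_near_origin cf cg fK gK f00 mDf mJ mK iA fD gv gh argfP c00 lower_f upper_f
  HE HM z0 (ltW s4) sdl' Mn l0.
rewrite -/s -C1E in main.
apply: (weighted_bound a0 C10 e0 epE s0 _ ts q1 _ _ main) => //.
- by rewrite qq aE.
- by rewrite -ler_pdivlMr// ltW.
Qed.
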